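(* Let $a>0$ and $0<s<\frac12$. The space $PW^s_a$ is a reproducing kernel Hilbert space with reproducing kernel $$K(w,z)=\frac1{2\pi}\int_{-a}^ae^{i(w-\bar z)\xi}|\xi|^{-2s}\,d\xi ,\qquad w,z\in\mathbb C.$$
   Context: Convention: the reproducing kernel satisfies $K(\cdot,z)\in PW^s_a$ and $f(z)=\langle f\,|\,K(\cdot,z)\rangle_{PW^s_a}$ for all $f\in PW^s_a$, $z\in\mathbb C$, with inner product linear in the first entry. Fourier transform: $\widehat f(\xi)=\mathcal F f(\xi)=\frac1{\sqrt{2\pi}}\int_{\mathbb R}f(x)e^{-ix\xi}\,dx$ on the Schwartz space $\mathcal S$ of $\mathbb R$. $\mathcal E_a$ is the space of entire functions $f$ such that for every $\varepsilon>0$ there is $C_\varepsilon>0$ with $|f(z)|\le C_\varepsilon e^{(a+\varepsilon)|z|}$ for all $z$. For $f$ entire, $f_0:=f|_{\mathbb R}$. Fractional Laplacian: for $f\in\mathcal S$, $\Delta^{s/2}f=\mathcal F^{-1}(|\cdot|^s\widehat f)$. For $0<s<\frac12$ and $f\in\mathcal S'$, we say $\|\Delta^{s/2}f\|_{L^2}<\infty$ if there is $\{f_n\}\subseteq\mathcal S$ with $f_n\to f$ in $\mathcal S'$ and $\{\Delta^{s/2}f_n\}$ Cauchy in $L^2(\mathbb R)$; then $\Delta^{s/2}f:=\lim_n\Delta^{s/2}f_n$ in $L^2$. Let $\frac12-\frac1{2^*}=s$ and $E^{s,2}=\{f\in L^{2^*}(\mathbb R):\|f\|_{E^{s,2}}:=\|\Delta^{s/2}f\|_{L^2}<\infty\}$.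 Then $PW^s_a=\{f\in\mathcal E_a:f_0\in E^{s,2}\}$ with norm $\|f\|_{PW^s_a}=\|f_0\|_{E^{s,2}}$ and inner product $\langle f\,|\,g\rangle_{PW^s_a}=\langle\Delta^{s/2}f_0\,|\,\Delta^{s/2}g_0\rangle_{L^2}$. *)

(* Defs.v *)
From HB Require Import structures.
From mathcomp Require Import all_boot all_order all_algebra.
From mathcomp Require Import complex.
From mathcomp Require Import all_classical all_reals all_analysis.

Set Implicit Arguments.
Unset Strict Implicit.
Unset Printing Implicit Defensive.

Import Order.TTheory GRing.Theory Num.Theory.
Import numFieldNormedType.Exports.

Local Open Scope classical_set_scope.
Local Open Scope ring_scope.
Local Open Scope complex_scope.

(* The modulus as an element of R; the generic `|z| lives in R[i]. *)
Notation cabs z := (Normc.normc z).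

Definition cexp (R : realType) (z : R[i]) : R[i] :=
  (expR (complex.Re z) * cos (complex.Im z)) +i*
  (expR (complex.Re z) * sin (complex.Im z)).

Definition cmeasurable (R : realType) (f : R -> R[i]) : Prop :=
  measurable_fun setT (fun x => complex.Re (f x)) /\
  measurable_fun setT (fun x => complex.Im (f x)).

Definition cintegral (R : realType) (D : set R) (f : R -> R[i]) : R[i] :=
  (\int[@lebesgue_measure R]_(x in D) complex.Re (f x)) +i*
  (\int[@lebesgue_measure R]_(x in D) complex.Im (f x)).

Definition cLnorm (R : realType) (p : R) (f : R -> R[i]) : \bar R :=
  Lnorm (@lebesgue_measure R) p%:E (fun x => (cabs (f x))%:E).

Definition in_Lp (R : realType) (p : R) (f : R -> R[i]) : Prop :=
  cmeasurable f /\ (cLnorm p f < +oo)%E.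

Definition L2_inner (R : realType) (f g : R -> R[i]) : R[i] :=
  cintegral setT (fun x => f x * conjc (g x)).

Definition L2_cauchy (R : realType) (u : nat -> R -> R[i]) : Prop :=
  (forall n, in_Lp 2 (u n)) /\
  forall e : R, 0 < e -> exists N : nat, forall m n : nat,
    (N <= m)%N -> (N <= n)%N ->
    ((cLnorm 2 (fun x => u m x - u n x))%R < e%:E)%E.

Definition L2_cvg (R : realType) (u : nat -> R -> R[i]) (g : R -> R[i]) : Prop :=
  in_Lp 2 g /\
  cLnorm 2 (fun x => u n x - g x) @[n --> \oo] --> 0%E.

Definition schwartz_real (R : realType) (f : R -> R) : Prop :=
  (forall (n : nat) (x : R), derivable (derive1n n f) x 1) /\
  (forall k n : nat, exists M : R, forall x : R, `|x ^+ k * derive1n n f x| <= M).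

Definition schwartz (R : realType) (f : R -> R[i]) : Prop :=
  schwartz_real (fun x => complex.Re (f x)) /\
  schwartz_real (fun x => complex.Im (f x)).

Definition fourier (R : realType) (f : R -> R[i]) (xi : R) : R[i] :=
  ((Num.sqrt (2 * pi))^-1)%:C *
  cintegral setT (fun x => f x * cexp (- ('i%C * (x * xi)%:C))).

Definition inv_fourier (R : realType) (f : R -> R[i]) (x : R) : R[i] :=
  ((Num.sqrt (2 * pi))^-1)%:C *
  cintegral setT (fun xi => f xi * cexp ('i%C * (x * xi)%:C)).

(* The operator written Delta^{s/2}, on Schwartz functions. *)
Definition frac_lap_schwartz (R : realType) (s : R) (f : R -> R[i]) : R -> R[i] :=
  inv_fourier (fun xi => (`|xi| `^ s)%:C * fourier f xi).

(* Distributions are represented by their action on test functions; only the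
   values on Schwartz functions are ever used.  Continuity is not imposed: it
   is automatic for a pointwise limit on S of tempered distributions. *)
Definition functional (R : realType) : Type := (R -> R[i]) -> R[i].

(* Bilinear (no conjugate) pairing. *)
Definition distr_of (R : realType) (f : R -> R[i]) : functional R :=
  fun phi => cintegral setT (fun x => f x * phi x).

Definition tempered_cvg (R : realType) (T_ : nat -> functional R)
    (T : functional R) : Prop :=
  forall phi : R -> R[i], schwartz phi ->
    T_ n phi @[n --> \oo] --> (T phi : R[i]^o).

(* || Delta^{s/2} T ||_{L^2} < oo *)
Definition frac_lap_finite (R : realType) (s : R) (T : functional R) : Prop :=
  exists f_ : nat -> R -> R[i],
    [/\ forall n, schwartz (f_ n),
        tempered_cvg (fun n => distr_of (f_ n)) T &
        L2_cauchy (fun n => frac_lap_schwartz s (f_ n))].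

Definition is_frac_lap (R : realType) (s : R) (T : functional R)
    (g : R -> R[i]) : Prop :=
  exists f_ : nat -> R -> R[i],
    [/\ forall n, schwartz (f_ n),
        tempered_cvg (fun n => distr_of (f_ n)) T &
        L2_cvg (fun n => frac_lap_schwartz s (f_ n)) g].

(* A chosen representative of the L^2 class Delta^{s/2} T; junk value 0 when
   Delta^{s/2} T is not in L^2. *)
Definition frac_lap (R : realType) (s : R) (T : functional R) : R -> R[i] :=
  xget (fun=> 0) [set g | is_frac_lap s T g].

(* The exponent 2^* determined by 1/2 - 1/2^* = s. *)
Definition two_star (R : realType) (s : R) : R := (2^-1 - s)^-1.

Definition E_space (R : realType) (s : R) : set (R -> R[i]) :=
  [set f | in_Lp (two_star s) f /\ frac_lap_finite s (distr_of f)].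

Definition E_norm (R : realType) (s : R) (f : R -> R[i]) : R :=
  fine (cLnorm 2 (frac_lap s (distr_of f))).

(* Differentiability over the field R[i], i.e. complex differentiability. *)
Definition entire (R : realType) (f : R[i] -> R[i]) : Prop :=
  forall z : R[i], derivable (f : R[i]^o -> R[i]^o) z 1.

Definition exp_type_space (R : realType) (a : R) : set (R[i] -> R[i]) :=
  [set f | entire f /\
     forall e : R, 0 < e -> exists C : R, 0 < C /\
       forall z : R[i], cabs (f z) <= C * expR ((a + e) * cabs z)].

Definition on_real (R : realType) (f : R[i] -> R[i]) : R -> R[i] :=
  fun x => f x%:C.

Definition PW (R : realType) (s a : R) : set (R[i] -> R[i]) :=
  [set f | exp_type_space a f /\ E_space s (on_real f)].

Definition PW_norm (R : realType) (s : R) (f : R[i] -> R[i]) : R :=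
  E_norm s (on_real f).

Definition PW_inner (R : realType) (s : R) (f g : R[i] -> R[i]) : R[i] :=
  L2_inner (frac_lap s (distr_of (on_real f)))
           (frac_lap s (distr_of (on_real g))).

(* A set H of functions X -> C, with pointwise operations, is a complex Hilbert
   space for the inner product ip (linear in the first entry) with norm nrm. *)
Record is_hilbert_function_space (R : realType) (X : Type)
    (H : set (X -> R[i])) (nrm : (X -> R[i]) -> R)
    (ip : (X -> R[i]) -> (X -> R[i]) -> R[i]) : Prop := {
  hilbert_zero : H (fun=> 0);
  hilbert_closed : forall (c : R[i]) (f g : X -> R[i]),
    H f -> H g -> H (fun x => c * f x + g x);
  hilbert_linear : forall (c : R[i]) (f g h : X -> R[i]),
    H f -> H g -> H h ->
    ip (fun x => c * f x + g x) h = c * ip f h + ip g h;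
  hilbert_conj : forall f g : X -> R[i], H f -> H g -> 
    ip g f = conjc (ip f g);
  hilbert_norm_ge0 : forall f : X -> R[i], H f -> 0 <= nrm f;
  hilbert_norm : forall f : X -> R[i], H f -> ip f f = (nrm f ^+ 2)%:C;
  hilbert_definite : forall f : X -> R[i], H f -> nrm f = 0 ->
    forall x, f x = 0;
  hilbert_complete : forall u : nat -> X -> R[i],
    (forall n, H (u n)) ->
    (forall e : R, 0 < e -> exists N : nat, forall m n : nat,
      (N <= m)%N -> (N <= n)%N -> nrm (fun x => u m x - u n x) < e) ->
    exists f : X -> R[i], H f /\
      nrm (fun x => u n x - f x) @[n --> \oo] --> (0 : R)
}.

Definition is_RKHS (R : realType) (X : Type)
    (H : set (X -> R[i])) (nrm : (X -> R[i]) -> R)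
    (ip : (X -> R[i]) -> (X -> R[i]) -> R[i]) : Prop :=
  is_hilbert_function_space H nrm ip /\
  forall x : X, exists C : R, forall f : X -> R[i], H f ->
    cabs (f x) <= C * nrm f.

Definition is_reproducing_kernel (R : realType) (X : Type)
    (H : set (X -> R[i])) (ip : (X -> R[i]) -> (X -> R[i]) -> R[i])
    (K : X -> X -> R[i]) : Prop :=
  (forall z : X, H (fun w => K w z)) /\
  (forall (f : X -> R[i]) (z : X), H f -> f z = ip f (fun w => K w z)).

(* Main.v *)
Require Import Defs.
From mathcomp Require Import all_boot all_order all_algebra.
From mathcomp Require Import complex ring lra.
From mathcomp Require Import all_classical all_reals all_analysis.
From mathcomp Require Import measurable_realfun.
Import Order.TTheory GRing.Theory Num.Theory.
Import numFieldNormedType.Exports.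
Local Open Scope classical_set_scope.
Local Open Scope ring_scope.
Local Open Scope complex_scope.

(* For G in L^2 supported in [-a, a] put
     f(z) = (2 pi)^(-1/2) \int |xi|^-s G(xi) e^(i z xi) dxi.
   The map G |-> f is an isometry of L^2(-a, a) onto PW^s_a, so PW^s_a is a
   Hilbert space, and f(z) = <G, G_z> with
   G_z(xi) = (2 pi)^(-1/2) |xi|^-s e^(-i conj(z) xi) yields the kernel.

   Surjectivity.  If f_n are the Schwartz approximants of f, then |xi|^s fhat_n
   converges in L^2 to some G by Plancherel, and f acts on Gaussians as
   |xi|^-s G acts on their Fourier transforms.  Moving the line of integration
   of f(x) e^(-d x^2 - i t x) into the complex plane makes this pairing
   exponentially small for |t| > 3 (a + 1), so G has compact support; pairing f
   with Gaussians centred at a complex point c then recovers f(c) as the integral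
   above.  Finally the growth of f along the imaginary axis forces G to vanish
   off [-a, a].

   Conversely f is entire of exponential type; it belongs to L^(2^* ) by the
   level-set argument of Chemin and Xu, and it is approximated by cutting out
   the low frequencies of G and damping with a wide Gaussian. *)

Set Implicit Arguments.
Unset Strict Implicit.
Unset Printing Implicit Defensive.

(** Gaussians with complex parameters suffice: their transforms are explicit, and an entire function
    can be integrated against them along any horizontal line. Dividing by |xi|^s under a pairing
    requires |xi|^-s to be locally square integrable, which is where s < 1/2 enters. The support is
    found in two steps because the contour shift is lossy: with A = a + 1 as exponent of growth, it
    gains (|t| - A)^2 / (4 d) in the exponent at frequency t and loses A^2 / (2 d); the threshold
    |t| >= 3 A leaves a net gain A^2 / (2 d). Once G has compact support, the integrals of |xi|^-s G
    against real exponentials make sense, and the values of [f] on the imaginary axis are such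
    integrals. Plancherel's theorem is used on the intersection of L^1 and L^2, where the weighted
    transforms of Schwartz functions lie. *)

Local Notation Re := complex.Re.
Local Notation Im := complex.Im.

(** * Complex numbers as pairs of reals *)

Section complex_numbers.
Context {R : realType}.
Implicit Types (x y z w : R[i]) (t u v : R).

Lemma ReD z w : Re (z + w) = Re z + Re w. Proof. by case: z; case: w. Qed.
Lemma ImD z w : Im (z + w) = Im z + Im w. Proof. by case: z; case: w. Qed.
Lemma ReN z : Re (- z) = - Re z. Proof. by case: z. Qed.
Lemma ImN z : Im (- z) = - Im z. Proof. by case: z. Qed.
Lemma ReB z w : Re (z - w) = Re z - Re w. Proof. by rewrite ReD ReN. Qed.
Lemma ImB z w : Im (z - w) = Im z - Im w. Proof. by rewrite ImD ImN. Qed.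
Lemma ReM z w : Re (z * w) = Re z * Re w - Im z * Im w.
Proof. by case: z; case: w. Qed.
Lemma ImM z w : Im (z * w) = Re z * Im w + Im z * Re w.
Proof. by case: z => a b; case: w => c d /=; rewrite [_ * c]mulrC. Qed.
Lemma ReJ z : Re (conjc z) = Re z. Proof. by case: z. Qed.
Lemma ImJ z : Im (conjc z) = - Im z. Proof. by case: z. Qed.

Lemma complex_ext z w : Re z = Re w -> Im z = Im w -> z = w.
Proof. by case: z; case: w => a b c d /= -> ->. Qed.

Definition ReImE := (ReD, ImD, ReN, ImN, ReM, ImM, ReJ, ImJ).

Lemma cabsE z : cabs z = Num.sqrt (Re z ^+ 2 + Im z ^+ 2).
Proof. by case: z. Qed.

Lemma cabs_ge0 z : 0 <= cabs z. Proof. by rewrite cabsE sqrtr_ge0. Qed.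

Lemma sqr_cabs z : cabs z ^+ 2 = Re z ^+ 2 + Im z ^+ 2.
Proof. by rewrite cabsE sqr_sqrtr// addr_ge0 ?sqr_ge0. Qed.

Lemma cabs0 : cabs (0 : R[i]) = 0. Proof. exact: Normc.normc0. Qed.
Lemma cabs1 : cabs (1 : R[i]) = 1. Proof. exact: Normc.normc1. Qed.

Lemma cabs0_eq0 z : cabs z = 0 -> z = 0. Proof. exact: Normc.eq0_normc. Qed.

Lemma cabsM z w : cabs (z * w) = cabs z * cabs w.
Proof. exact: Normc.normcM. Qed.

Lemma le_cabsD z w : cabs (z + w) <= cabs z + cabs w.
Proof. exact: le_normcD. Qed.

Lemma cabsN z : cabs (- z) = cabs z. Proof. exact: normcN. Qed.

Lemma cabsJ z : cabs (conjc z) = cabs z.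
Proof. by rewrite !cabsE ReJ ImJ sqrrN. Qed.

Lemma cabsBC z w : cabs (z - w) = cabs (w - z).
Proof. by rewrite -cabsN opprB. Qed.

Lemma cabs_real t : cabs t%:C = `|t|.
Proof. by rewrite cabsE/= expr0n addr0 sqrtr_sqr. Qed.

Lemma cabs_i : cabs ('i%C : R[i]) = 1.
Proof. by rewrite cabsE/= expr0n add0r expr1n sqrtr1. Qed.

Lemma Re_le_cabs z : `|Re z| <= cabs z.
Proof. by rewrite cabsE -sqrtr_sqr ler_wsqrtr// lerDl sqr_ge0. Qed.

Lemma Im_le_cabs z : `|Im z| <= cabs z.
Proof. by rewrite cabsE -sqrtr_sqr ler_wsqrtr// lerDr sqr_ge0. Qed.

Lemma cabs_le_ReIm z : cabs z <= `|Re z| + `|Im z|.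
Proof.
rewrite -(@ler_pXn2r _ 2)// ?nnegrE ?cabs_ge0 ?addr_ge0// sqr_cabs.
by rewrite sqrrD -!normrX !(ger0_norm (sqr_ge0 _)) addrAC lerDl mulrn_wge0// mulr_ge0.
Qed.

Lemma le_cabsB z w : cabs z - cabs w <= cabs (z - w).
Proof. by rewrite lerBlDr (le_trans _ (le_cabsD _ _))// subrK. Qed.

Lemma cabs_dist z w : `|cabs z - cabs w| <= cabs (z - w).
Proof. by rewrite ler_norml le_cabsB andbT lerNl opprB cabsBC le_cabsB. Qed.

Lemma real_complexD t u : (t + u)%:C = t%:C + u%:C. Proof. exact: rmorphD. Qed.
Lemma real_complexN t : (- t)%:C = - t%:C. Proof. exact: rmorphN. Qed.
Lemma real_complexM t u : (t * u)%:C = t%:C * u%:C. Proof. exact: rmorphM. Qed.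

Lemma conjcM z w : conjc (z * w) = conjc z * conjc w.
Proof. by apply: complex_ext; rewrite !ReImE; ring. Qed.

Lemma mulJ z : z * conjc z = (cabs z ^+ 2)%:C.
Proof.
by apply: complex_ext; rewrite !ReImE/= ?sqr_cabs; [rewrite !expr2; ring|ring].
Qed.

Lemma cexpD z w : cexp (z + w) = cexp z * cexp w.
Proof.
rewrite /cexp; apply: complex_ext; rewrite !ReImE/= expRD ?cosD ?sinD; ring.
Qed.

Lemma cexp0 : cexp (0 : R[i]) = 1.
Proof. by apply: complex_ext; rewrite /cexp/= ?cos0 ?sin0 expR0 ?mul1r ?mulr0. Qed.

Lemma cabs_cexp z : cabs (cexp z) = expR (Re z).
Proof.
rewrite cabsE/= !exprMn -mulrDr cos2Dsin2 mulr1 sqrtr_sqr.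
by rewrite ger0_norm// expR_ge0.
Qed.

Lemma cexpJ z : cexp (conjc z) = conjc (cexp z).
Proof. by apply: complex_ext; rewrite /cexp/= !ReImE/= ?cosN// sinN mulrN. Qed.

Lemma cexp_real t : cexp t%:C = (expR t)%:C.
Proof. by apply: complex_ext; rewrite /cexp/= ?cos0 ?sin0 ?mulr1 ?mulr0. Qed.

Lemma expR_ge1r t : 0 <= t -> 1 <= expR t.
Proof. by move=> t0; rewrite -expR0 ler_expR. Qed.

Lemma expR_ge1D_abs t : `|expR t - 1| <= `|t| * expR `|t|.
Proof.
have h (u : R) : expR u - 1 <= u * expR u.
  have := expR_ge1Dx (- u) => h.
  have : (1 + - u) * expR u <= 1.
    rewrite (le_trans (ler_wpM2r (expR_ge0 _) h))// -expRD addNr expR0//.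
  by lra.
have [t0|t0] := leP 0 t.
  by rewrite !ger0_norm ?subr_ge0 ?expR_ge1r//; exact: h.
rewrite ltr0_norm ?subr_lt0 ?expR_lt1// ltr0_norm// opprB.
have := expR_ge1Dx t => h1.
apply: (@le_trans _ _ (- t)); first by lra.
by rewrite ler_peMr ?oppr_ge0 ?(ltW t0)// expR_ge1r// oppr_ge0 ltW.
Qed.

Lemma expR_ge1D_sqr t : `|expR t - 1 - t| <= t ^+ 2 * expR `|t|.
Proof.
have h0 : 0 <= expR t - 1 - t by have := expR_ge1Dx t; lra.
rewrite ger0_norm//.
have [t0|t0] := leP 0 t.
  have := expR_ge1Dx (- t) => h1.
  have h2 : (1 + - t) * expR t <= 1.
    by rewrite (le_trans (ler_wpM2r (expR_ge0 _) h1))// -expRD addNr expR0.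
  have h3 := expR_ge1Dx t.
  rewrite ger0_norm//.
  have : t * ((1 + - t) * expR t) <= t * 1 by rewrite ler_wpM2l.
  by lra.
have h3 : (1 - t) * expR t <= 1.
  have := expR_ge1Dx (- t) => h1.
  by rewrite (le_trans (ler_wpM2r (expR_ge0 _) h1))// -expRD addNr expR0.
have e1 : 1 <= expR `|t| by rewrite expR_ge1r.
have : t ^+ 2 * 1 <= t ^+ 2 * expR `|t| by rewrite ler_wpM2l ?sqr_ge0.
have := expR_ge1Dx t.
have : 0 < expR t by exact: expR_gt0.
nra.
Qed.

Lemma normr_sin_le t : `|sin t| <= `|t|.
Proof.
wlog t0 : t / 0 < t => [hw|].
  have [t0|t0|<-] := ltgtP 0 t; [exact: hw| |by rewrite sin0].
  by rewrite -normrN -sinN -(normrN t); apply: hw; rewrite oppr_gt0.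
have cs : {within `[0, t], continuous (@sin R)}.
  by apply: continuous_subspaceT => x; exact: continuous_sin.
have ds (x : R) : x \in `]0, t[ -> is_derive x 1 (@sin R) (cos x).
  by move=> _; exact: is_derive_sin.
have [c _] := MVT t0 ds cs.
by rewrite sin0 !subr0 => ->; rewrite normrM ler_piMl// ler_norml cos_geN1 cos_le1.
Qed.

Lemma normr_cosB1_le t : `|cos t - 1| <= `|t|.
Proof.
wlog t0 : t / 0 < t => [hw|].
  have [t0|t0|<-] := ltgtP 0 t; [exact: hw| |by rewrite cos0 subrr].
  by rewrite -(cosN t) -(normrN t); apply: hw; rewrite oppr_gt0.
have cs : {within `[0, t], continuous (@cos R)}.
  by apply: continuous_subspaceT => x; exact: continuous_cos.
have ds (x : R) : x \in `]0, t[ -> is_derive x 1 (@cos R) (- sin x).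
  by move=> _; exact: is_derive_cos.
have [c _] := MVT t0 ds cs.
by rewrite cos0 !subr0 => ->; rewrite normrM ler_piMl// normrN ler_norml sin_geN1 sin_le1.
Qed.

Lemma normr_sinB_le t : `|sin t - t| <= t ^+ 2.
Proof.
wlog t0 : t / 0 < t => [hw|].
  have [t0|t0|<-] := ltgtP 0 t; [exact: hw| |by rewrite sin0 subrr normr0 expr0n].
  rewrite -sqrrN -normrN opprB -[X in `|X|](_ : sin (- t) - - t = _); last first.
    by rewrite sinN opprK addrC.
  by apply: hw; rewrite oppr_gt0.
have cs : {within `[0, t], continuous (fun x : R => sin x - x : R)}.
  apply: continuous_subspaceT => x.
  by apply: cvgB; [exact: continuous_sin|exact: cvg_id].
have ds (x : R) : x \in `]0, t[ -> is_derive x 1 (fun x : R => sin x - x : R) (cos x - 1).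
  by move=> _; apply: is_deriveB.
have [c] := MVT t0 ds cs.
rewrite in_itv/= => /andP[c0 ct]; rewrite sin0 !subr0 => ->.
rewrite normrM (gtr0_norm t0) expr2 ler_wpM2r ?(ltW t0)//.
by rewrite (le_trans (normr_cosB1_le _))// gtr0_norm// ltW.
Qed.

Lemma normr_cosB1_le2 t : `|cos t - 1| <= t ^+ 2.
Proof.
have -> : cos t - 1 = - (2 * (sin (t / 2)) ^+ 2).
  have {1}-> : t = t / 2 *+ 2 by rewrite -mulr_natr divfK.
  by rewrite cos_mulr2n -[cos (t/2) ^+ 2](addrK (sin (t / 2) ^+ 2)) cos2Dsin2; ring.
rewrite normrN.
have h := normr_sin_le (t / 2).
have : `|sin (t / 2)| ^+ 2 <= `|t / 2| ^+ 2 by rewrite ler_pXn2r ?nnegrE.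
rewrite -!normrX !(ger0_norm (sqr_ge0 _)) => h2.
rewrite ger0_norm; last by rewrite mulr_ge0// sqr_ge0.
by rewrite (le_trans (ler_wpM2l _ h2))//; have := sqr_ge0 t; lra.
Qed.

(** The real and imaginary parts split into four terms, each at most r^2 exp r with r the modulus of
    [z]; the constant 6 leaves slack. This quadratic remainder stands in for the power series of
    [cexp] in all differentiations below. *)
Lemma cexp_expand z : cabs (cexp z - 1 - z) <= 6 * cabs z ^+ 2 * expR (cabs z).
Proof.
set r := cabs z; set u := Re z; set v := Im z.
have ur : `|u| <= r by exact: Re_le_cabs.
have vr : `|v| <= r by exact: Im_le_cabs.
have r0 : 0 <= r by exact: cabs_ge0.
have E1 : 1 <= expR r by rewrite expR_ge1r.
have uE : expR `|u| <= expR r by rewrite ler_expR.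
have u2 : u ^+ 2 <= r ^+ 2 by rewrite -real_normK ?num_real// ler_pXn2r ?nnegrE.
have v2 : v ^+ 2 <= r ^+ 2 by rewrite -real_normK ?num_real// ler_pXn2r ?nnegrE.
have rE : r <= expR r by rewrite (le_trans _ (expR_ge1Dx r))// lerDr.
have rr0 : 0 <= r ^+ 2 by exact: sqr_ge0.
have rrE : r ^+ 2 <= r ^+ 2 * expR r by rewrite ler_peMr.
have eE : expR u <= expR r by rewrite ler_expR (le_trans (ler_norm _)).
rewrite (le_trans (cabs_le_ReIm _))//.
have -> : Re (cexp z - 1 - z) = (expR u - 1 - u) + expR u * (cos v - 1).
  by rewrite !ReImE/= -/u -/v; ring.
have -> : Im (cexp z - 1 - z) = (expR u - 1) * sin v + (sin v - v).
  by rewrite !ReImE/= -/u -/v; ring.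
have h1 : `|expR u - 1 - u| <= r ^+ 2 * expR r.
  rewrite (le_trans (expR_ge1D_sqr _))//.
  by rewrite ler_pM ?sqr_ge0 ?expR_ge0.
have h2 : `|expR u * (cos v - 1)| <= r ^+ 2 * expR r.
  rewrite normrM ger0_norm ?expR_ge0// mulrC ler_pM ?expR_ge0//.
  by rewrite (le_trans (normr_cosB1_le2 _)).
have h3 : `|(expR u - 1) * sin v| <= r ^+ 2 * expR r.
  rewrite normrM expr2 mulrAC ler_pM ?(le_trans (normr_sin_le _))//.
  rewrite (le_trans (expR_ge1D_abs _))//.
  by rewrite ler_pM ?expR_ge0.
have h4 : `|sin v - v| <= r ^+ 2 * expR r.
  by rewrite (le_trans (normr_sinB_le _))// (le_trans v2).
have := ler_normD (expR u - 1 - u) (expR u * (cos v - 1)).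
have := ler_normD ((expR u - 1) * sin v) (sin v - v).
rewrite -(mulrA 6).
lra.
Qed.

End complex_numbers.

(** * Integration of complex-valued functions *)

Section complex_measurability.
Context {R : realType} {d} {T : measurableType d}.
Implicit Types (f g : T -> R[i]).

Definition cmeas f := measurable_fun setT (fun x => Re (f x)) /\
  measurable_fun setT (fun x => Im (f x)).

Lemma cmeasD f g : cmeas f -> cmeas g -> cmeas (fun x => f x + g x).
Proof.
move=> [f1 f2] [g1 g2]; split.
- by under eq_fun do rewrite ReD; exact: measurable_funD.
- by under eq_fun do rewrite ImD; exact: measurable_funD.
Qed.

Lemma cmeasN f : cmeas f -> cmeas (fun x => - f x).
Proof.
move=> [f1 f2]; split.
- by under eq_fun do rewrite ReN; exact: measurableT_comp.
- by under eq_fun do rewrite ImN; exact: measurableT_comp.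
Qed.

Lemma cmeasB f g : cmeas f -> cmeas g -> cmeas (fun x => f x - g x).
Proof. by move=> mf mg; apply: cmeasD => //; exact: cmeasN. Qed.

Lemma cmeasM f g : cmeas f -> cmeas g -> cmeas (fun x => f x * g x).
Proof.
move=> [f1 f2] [g1 g2]; split.
- under eq_fun do rewrite ReM.
  by apply: measurable_funB; exact: measurable_funM.
- under eq_fun do rewrite ImM.
  by apply: measurable_funD; exact: measurable_funM.
Qed.

Lemma cmeas_cst c : cmeas (fun=> c). Proof. by split; exact: measurable_cst. Qed.

Lemma cmeasJ f : cmeas f -> cmeas (fun x => conjc (f x)).
Proof.
move=> [f1 f2]; split; first by under eq_fun do rewrite ReJ.
by under eq_fun do rewrite ImJ; exact: measurableT_comp.
Qed.

Lemma cmeas_real (h : T -> R) : measurable_fun setT h -> cmeas (fun x => (h x)%:C).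
Proof. by move=> mh; split => //=; exact: measurable_cst. Qed.

Lemma cmeas_cexp f : cmeas f -> cmeas (fun x => cexp (f x)).
Proof.
move=> [f1 f2]; split => /=; apply: measurable_funM.
- exact: measurableT_comp.
- by apply: measurableT_comp => //; apply: continuous_measurable_fun; exact: continuous_cos.
- exact: measurableT_comp.
- by apply: measurableT_comp => //; apply: continuous_measurable_fun; exact: continuous_sin.
Qed.

Lemma measurable_cabs f : cmeas f -> measurable_fun setT (fun x => cabs (f x)).
Proof.
move=> [f1 f2]; under eq_fun do rewrite cabsE.
apply: (@measurableT_comp _ _ _ _ _ _ (@Num.sqrt R)).
  by apply: continuous_measurable_fun => x; exact: sqrt_continuous.
by apply: measurable_funD; exact: measurable_funX.
Qed.

Lemma cmeas_comp {d'} {T' : measurableType d'} f (h : T' -> T) :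
  cmeas f -> measurable_fun setT h ->
  measurable_fun setT (fun x => Re (f (h x))) /\
  measurable_fun setT (fun x => Im (f (h x))).
Proof.
move=> [f1 f2] mh; split.
- exact: (measurableT_comp f1 mh).
- exact: (measurableT_comp f2 mh).
Qed.

End complex_measurability.

Section complex_integral.
Context {R : realType}.
Local Notation C := R[i].
Local Notation mu := (@lebesgue_measure R).
Local Notation cint := (cintegral setT).
Implicit Types (f g : R -> C) (h : R -> R).

Local Notation rintegrable h := (mu.-integrable setT (fun x => (h x)%:E)).

Definition cintegrable f :=
  rintegrable (fun x => Re (f x)) /\ rintegrable (fun x => Im (f x)).

Lemma rintegrable_meas h : rintegrable h -> measurable_fun setT h.
Proof. by case/integrableP => /measurable_EFinP. Qed.

Lemma rintegrable_le h h' : measurable_fun setT h -> rintegrable h' ->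
  (forall x, `|h x| <= h' x) -> rintegrable h.
Proof.
move=> mh ih' hh'; apply: (le_integrable _ _ _ ih') => //; first exact/measurable_EFinP.
by move=> x _ /=; rewrite lee_fin (le_trans (hh' x))// ler_norm.
Qed.

Lemma cintegrable_cmeas f : cintegrable f -> cmeas f.
Proof. by move=> [f1 f2]; split; exact: rintegrable_meas. Qed.

Lemma cintegrable_le f h : cmeas f -> rintegrable h ->
  (forall x, cabs (f x) <= h x) -> cintegrable f.
Proof.
move=> [f1 f2] ih fh; split; apply: (rintegrable_le _ ih) => // x.
- by rewrite (le_trans (Re_le_cabs _)).
- by rewrite (le_trans (Im_le_cabs _)).
Qed.

Lemma rintegrableD h h' : rintegrable h -> rintegrable h' ->
  rintegrable (fun x => h x + h' x).
Proof. by move=> i1 i2; under eq_fun do rewrite EFinD; exact: integrableD. Qed.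

Lemma rintegrableZ (c : R) h : rintegrable h -> rintegrable (fun x => c * h x).
Proof. by move=> i1; under eq_fun do rewrite EFinM; exact: integrableZl. Qed.

Lemma rintegrable_norm h : rintegrable h -> rintegrable (fun x => `|h x|).
Proof. exact: integrable_norm. Qed.

Lemma cintegrable_abs f : cintegrable f -> rintegrable (fun x => cabs (f x)).
Proof.
move=> fi; have [f1 f2] := fi.
apply: (rintegrable_le (measurable_cabs (cintegrable_cmeas fi))
  (rintegrableD (rintegrable_norm f1) (rintegrable_norm f2))) => x.
by rewrite ger0_norm ?cabs_ge0//; exact: cabs_le_ReIm.
Qed.

Lemma cintegrableD f g : cintegrable f -> cintegrable g ->
  cintegrable (fun x => f x + g x).
Proof.
move=> [f1 f2] [g1 g2]; split.
- by under eq_fun do rewrite ReD; exact: rintegrableD.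
- by under eq_fun do rewrite ImD; exact: rintegrableD.
Qed.

Lemma cintegrableM f g (M : R) : cintegrable f -> cmeas g ->
  (forall x, cabs (g x) <= M) -> cintegrable (fun x => f x * g x).
Proof.
move=> fi mg gM.
apply: (cintegrable_le _ (rintegrableZ M (cintegrable_abs fi))).
  by apply: cmeasM => //; exact: cintegrable_cmeas.
by move=> x; rewrite cabsM mulrC ler_wpM2r ?cabs_ge0.
Qed.

Lemma cintegrableZ c f : cintegrable f -> cintegrable (fun x => c * f x).
Proof.
move=> fi; under eq_fun do rewrite mulrC.
by apply: (cintegrableM fi (cmeas_cst _)) => x; exact: lexx.
Qed.

Lemma cintegrableN f : cintegrable f -> cintegrable (fun x => - f x).
Proof. by move=> fi; under eq_fun do rewrite -mulN1r; exact: cintegrableZ. Qed.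

Lemma cintegrableB f g : cintegrable f -> cintegrable g ->
  cintegrable (fun x => f x - g x).
Proof. by move=> fi gi; apply: cintegrableD => //; exact: cintegrableN. Qed.

Lemma cintegrableJ f : cintegrable f -> cintegrable (fun x => conjc (f x)).
Proof.
move=> fi; apply: (cintegrable_le _ (cintegrable_abs fi)).
  by apply: cmeasJ; exact: cintegrable_cmeas.
by move=> x; rewrite cabsJ.
Qed.

Lemma cintD f g : cintegrable f -> cintegrable g ->
  cint (fun x => f x + g x) = cint f + cint g.
Proof.
move=> [f1 f2] [g1 g2]; apply: complex_ext; rewrite !ReImE/=.
- by under eq_Rintegral do rewrite ReD; rewrite RintegralD.
- by under eq_Rintegral do rewrite ImD; rewrite RintegralD.
Qed.

Lemma cintZ c f : cintegrable f -> cint (fun x => c * f x) = c * cint f.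
Proof.
move=> [f1 f2]; apply: complex_ext; rewrite !ReImE/=.
- under eq_Rintegral do rewrite ReM.
  by rewrite RintegralB ?RintegralZl//; exact: rintegrableZ.
- under eq_Rintegral do rewrite ImM.
  by rewrite RintegralD ?RintegralZl//; exact: rintegrableZ.
Qed.

Lemma cintN f : cintegrable f -> cint (fun x => - f x) = - cint f.
Proof.
by move=> fi; under [in LHS]eq_fun do rewrite -mulN1r; rewrite cintZ// mulN1r.
Qed.

Lemma cintB f g : cintegrable f -> cintegrable g ->
  cint (fun x => f x - g x) = cint f - cint g.
Proof. by move=> fi gi; rewrite cintD ?cintN//; exact: cintegrableN. Qed.

Lemma cint_real h : cint (fun x => (h x)%:C) = (\int[mu]_x h x)%:C.
Proof.
by apply: complex_ext => //=; rewrite Rintegral_cst//= mul0r.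
Qed.

Lemma cint0 : cint (fun=> 0) = 0 :> C.
Proof. by apply: complex_ext => /=; rewrite Rintegral_cst//= mul0r. Qed.

Lemma cintJ f : cintegrable f -> cint (fun x => conjc (f x)) = conjc (cint f).
Proof.
move=> [f1 f2]; apply: complex_ext; rewrite ?ReJ ?ImJ/=.
  by apply: eq_Rintegral => x _; rewrite ReJ.
under eq_Rintegral do rewrite ImJ -mulN1r.
by rewrite RintegralZl// mulN1r.
Qed.

(** Rotation by the conjugate phase [c] makes the integral real and equal to its modulus; it is then
    the integral of a real part, to which the real inequality applies. *)
Lemma le_cabs_cint f : cintegrable f -> cabs (cint f) <= \int[mu]_x cabs (f x).
Proof.
move=> fi; have [I0|I0] := eqVneq (cint f) 0.
  by rewrite I0 cabs0; apply: Rintegral_ge0 => x _; exact: cabs_ge0.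
set r := cabs (cint f).
have r0 : 0 < r.
  rewrite lt_neqAle cabs_ge0 andbT; apply: contra I0 => /eqP e.
  by apply/eqP/cabs0_eq0; rewrite -/r -e.
pose c := r^-1%:C * conjc (cint f).
have c1 : cabs c = 1.
  by rewrite cabsM cabs_real cabsJ gtr0_norm ?invr_gt0// mulVf// gt_eqF.
have cI : c * cint f = r%:C.
  rewrite /c -mulrA [conjc _ * _]mulrC mulJ -/r -real_complexM.
  by rewrite expr2 mulrA mulVf ?gt_eqF// mul1r.
have -> : r = Re (cint (fun x => c * f x)) by rewrite cintZ// cI.
rewrite /=; apply: le_Rintegral => //.
- by have [] := cintegrableZ c fi.
- exact: cintegrable_abs.
- by move=> x _; rewrite (le_trans (ler_norm _))// (le_trans (Re_le_cabs _))// cabsM c1 mul1r.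
Qed.

Lemma le_cabs_cint_bound f h : cmeas f -> rintegrable h ->
  (forall x, cabs (f x) <= h x) -> cabs (cint f) <= \int[mu]_x h x.
Proof.
move=> mf ih fh; have fi := cintegrable_le mf ih fh.
rewrite (le_trans (le_cabs_cint fi))// le_Rintegral//.
exact: cintegrable_abs.
Qed.

Lemma ae_mono (P Q : R -> Prop) : (forall x, P x -> Q x) ->
  {ae mu, forall x, P x} -> {ae mu, forall x, Q x}.
Proof. by move=> PQ; apply: (@filterS _ _ (ae_filter_ringOfSetsType mu)). Qed.

Lemma ae_and (P Q : R -> Prop) : {ae mu, forall x, P x} -> {ae mu, forall x, Q x} ->
  {ae mu, forall x, P x /\ Q x}.
Proof. by move=> p q; apply: (@filterI _ _ (ae_filter_ringOfSetsType mu)). Qed.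

Lemma ae_eq_Rintegral h h' : measurable_fun setT h -> measurable_fun setT h' ->
  {ae mu, forall x, h x = h' x} -> \int[mu]_x h x = \int[mu]_x h' x.
Proof.
move=> mh mh' hh'; congr fine; apply: ae_eq_integral => //; try exact/measurable_EFinP.
by apply: ae_mono hh' => x -> _.
Qed.

Lemma ae_eq_cint f g : cmeas f -> cmeas g ->
  {ae mu, forall x, f x = g x} -> cint f = cint g.
Proof.
move=> [f1 f2] [g1 g2] fg; apply: complex_ext => /=; apply: ae_eq_Rintegral => //.
- by apply: ae_mono fg => x ->.
- by apply: ae_mono fg => x ->.
Qed.

Lemma ae_rintegrable h h' : measurable_fun setT h' ->
  {ae mu, forall x, h x = h' x} -> rintegrable h -> rintegrable h'.
Proof.
move=> mh' hh' /integrableP[mh hoo]; apply/integrableP; split; first exact/measurable_EFinP.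
apply: le_lt_trans hoo; rewrite le_eqVlt; apply/orP; left; apply/eqP.
apply: ae_eq_integral => //; try by apply: measurableT_comp => //; exact/measurable_EFinP.
by apply: ae_mono hh' => x -> _.
Qed.

Lemma cvg_eq_lim (w : nat -> R) (l l' : R) : l = l' -> w n @[n --> \oo] --> l ->
  w n @[n --> \oo] --> l'.
Proof. by move=> ->. Qed.

(* Convergence of complex sequences through the real modulus, which avoids the
   topology of [R[i]^o]. *)
Definition ccvg (u : nat -> C) (l : C) := cabs (u n - l) @[n --> \oo] --> (0 : R).

Lemma ccvg_le (u : nat -> C) l (v : nat -> R) :
  v n @[n --> \oo] --> 0 -> (forall n, cabs (u n - l) <= v n) -> ccvg u l.
Proof.
move=> v0 uv; apply: (@squeeze_cvgr _ _ _ _ (cst 0) v) => //; last exact: cvg_cst.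
by near=> n; rewrite cabs_ge0 uv.
Unshelve. all: by end_near. Qed.

Lemma ccvg_unique u l l' : ccvg u l -> ccvg u l' -> l = l'.
Proof.
move=> ul ul'; apply/eqP; rewrite -subr_eq0; apply/eqP/cabs0_eq0.
apply/eqP; rewrite eq_le cabs_ge0 andbT.
have h : (cabs (u n - l) + cabs (u n - l')) @[n --> \oo] --> (0 + 0 : R) by exact: cvgD.
rewrite addr0 in h.
rewrite -(cvg_lim _ h)//; apply: limr_ge; first by apply/cvg_ex; exists 0.
near=> n; rewrite (cabsBC (u n) l) (le_trans _ (le_cabsD _ _))//.
by rewrite addrA subrK.
Unshelve. all: by end_near. Qed.

Lemma ccvg_cst l : ccvg (fun=> l) l.
Proof. by rewrite /ccvg subrr cabs0; exact: cvg_cst. Qed.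

Lemma ccvgD u v l m : ccvg u l -> ccvg v m -> ccvg (fun n => u n + v n) (l + m).
Proof.
move=> ul vm; have h : (cabs (u n - l) + cabs (v n - m)) @[n --> \oo] --> (0 + 0 : R) by exact:
  cvgD.
rewrite addr0 in h; apply: (ccvg_le h) => n.
by rewrite opprD addrACA le_cabsD.
Qed.

Lemma ccvgZ c u l : ccvg u l -> ccvg (fun n => c * u n) (c * l).
Proof.
move=> ul; have h : cabs c * cabs (u n - l) @[n --> \oo] --> (cabs c * 0 : R).
  by apply: cvgM => //; exact: cvg_cst.
by rewrite mulr0 in h; apply: (ccvg_le h) => n; rewrite -mulrBr cabsM.
Qed.

Lemma ccvgN u l : ccvg u l -> ccvg (fun n => - u n) (- l).
Proof. by move=> /(ccvgZ (-1)); rewrite mulN1r; under eq_fun do rewrite mulN1r. Qed.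

Lemma ccvgB u v l m : ccvg u l -> ccvg v m -> ccvg (fun n => u n - v n) (l - m).
Proof. by move=> ul /ccvgN; exact: ccvgD. Qed.

Lemma ccvg_ReIm u l : ccvg u l <->
  (Re (u n) @[n --> \oo] --> Re l /\ Im (u n) @[n --> \oo] --> Im l).
Proof.
split=> [ul|[u1 u2]].
- move/cvgrPdist_lt : ul => ul.
  split; apply/cvgrPdist_lt => e e0; apply: filterS (ul e e0) => n;
    rewrite sub0r normrN ger0_norm ?cabs_ge0//; apply: le_lt_trans.
  + by rewrite distrC -ReB Re_le_cabs.
  + by rewrite distrC -ImB Im_le_cabs.
- have h : (`|Re (u n) - Re l| + `|Im (u n) - Im l|) @[n --> \oo] --> (0 + 0 : R).
    by apply: cvgD; rewrite -(@normr0 _ R); apply: cvg_norm; apply/subr_cvg0.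
  rewrite addr0 in h; apply: (ccvg_le h) => n.
  by rewrite -ReB -ImB cabs_le_ReIm.
Unshelve. all: by end_near. Qed.

Lemma ccvg_real (u : nat -> R) (l : R) : u n @[n --> \oo] --> l ->
  ccvg (fun n => (u n)%:C) l%:C.
Proof. by move=> ul; apply/ccvg_ReIm; split => //; exact: cvg_cst. Qed.

Lemma ccvgM u v l m : ccvg u l -> ccvg v m -> ccvg (fun n => u n * v n) (l * m).
Proof.
move=> /ccvg_ReIm[u1 u2] /ccvg_ReIm[v1 v2]; apply/ccvg_ReIm; split.
- by under eq_fun do rewrite ReM; rewrite ReM; apply: cvgB; apply: cvgM.
- by under eq_fun do rewrite ImM; rewrite ImM; apply: cvgD; apply: cvgM.
Qed.

Lemma ccvg_le_lim u l (M : R) : ccvg u l -> (forall n, cabs (u n) <= M) -> cabs l <= M.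
Proof.
move=> ul uM; have h : (cabs (u n - l) + M) @[n --> \oo] --> (0 + M : R).
  by apply: cvgD => //; exact: cvg_cst.
rewrite add0r in h; rewrite -(cvg_lim _ h)//; apply: limr_ge; first by apply/cvg_ex; exists M.
near=> n; rewrite (le_trans _ (lerD (lexx _) (uM n)))// (cabsBC (u n)).
by rewrite (le_trans _ (le_cabsD _ _))// subrK.
Unshelve. all: by end_near. Qed.

Lemma Rintegral_dct (f_ : nat -> R -> R) h (g' : R -> R) :
  (forall n, measurable_fun setT (f_ n)) -> measurable_fun setT h ->
  {ae mu, forall x, f_ n x @[n --> \oo] --> h x} ->
  rintegrable g' -> (forall n x, `|f_ n x| <= g' x) ->
  \int[mu]_x f_ n x @[n --> \oo] --> \int[mu]_x h x.
Proof.
move=> mf mh fh ig fg.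
have [||||hi _ hc] := @dominated_convergence _ _ _ mu setT measurableT
  (fun n x => (f_ n x)%:E) (fun x => (h x)%:E) (fun x => (g' x)%:E) _ _ _ ig.
- by move=> n; apply/measurable_EFinP; exact: mf.
- exact/measurable_EFinP.
- by apply: ae_mono fh => x fx _; apply: cvg_EFin => //; exact: nearW.
- by apply: aeW => x n _; rewrite lee_fin.
by apply: fine_cvg; rewrite fineK//; exact: integrable_fin_num.
Qed.

Lemma cint_dct (f_ : nat -> R -> C) f (g' : R -> R) :
  (forall n, cmeas (f_ n)) -> cmeas f ->
  {ae mu, forall x, ccvg (f_^~ x) (f x)} ->
  rintegrable g' -> (forall n x, cabs (f_ n x) <= g' x) ->
  ccvg (fun n => cint (f_ n)) (cint f).
Proof.
move=> mf [m1 m2] ff ig fg; apply/ccvg_ReIm; split => /=.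
- apply: (Rintegral_dct _ _ _ ig) => //.
  + by move=> n; have [] := mf n.
  + by apply: ae_mono ff => x /ccvg_ReIm[].
  + by move=> n x; rewrite (le_trans (Re_le_cabs _)).
- apply: (Rintegral_dct _ _ _ ig) => //.
  + by move=> n; have [] := mf n.
  + by apply: ae_mono ff => x /ccvg_ReIm[].
  + by move=> n x; rewrite (le_trans (Im_le_cabs _)).
Qed.

(** The real integral is [fine] of the extended one, and the inner integrals are known to be finite
    only almost everywhere. [h1] and [h2] therefore pull [fine] out of each iterated integral up to
    a null set before Fubini is applied. *)
Lemma Rintegral_Fubini (k : R * R -> R) :
  (mu \x mu)%E.-integrable setT (fun p => (k p)%:E) ->
  \int[mu]_x \int[mu]_y k (x, y) = \int[mu]_y \int[mu]_x k (x, y).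
Proof.
move=> ik.
have h1 : \int[mu]_x \int[mu]_y k (x, y) = fine (\int[mu]_x \int[mu]_y (k (x, y))%:E)%E.
  congr fine; apply: ae_eq_integral => //.
  - have := measurable_fubini_F ik;
    move/(measurableT_comp (@fine_measurable R setT measurableT)) => mF.
    by apply/measurable_EFinP.
  - exact: (measurable_fubini_F ik).
  - have := integrable_ae measurableT (integrable_fubini_F ik).
    by apply: ae_mono => x /(_ I) xf _; rewrite /Rintegral fineK.
have h2 : \int[mu]_y \int[mu]_x k (x, y) = fine (\int[mu]_y \int[mu]_x (k (x, y))%:E)%E.
  congr fine; apply: ae_eq_integral => //.
  - have := measurable_fubini_G ik;
    move/(measurableT_comp (@fine_measurable R setT measurableT)) => mF.
    by apply/measurable_EFinP.
  - exact: (measurable_fubini_G ik).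
  - have := ae_integrable2 ik.
    by apply: ae_mono => x xf _; rewrite /Rintegral fineK//; exact: integrable_fin_num.
by rewrite h1 h2 (Fubini ik).
Qed.

Lemma integrable_prod (k : R * R -> R) (u v : R -> R) :
  measurable_fun setT k -> rintegrable u -> rintegrable v ->
  (forall x, 0 <= u x) -> (forall x, 0 <= v x) ->
  (forall x y, `|k (x, y)| <= u x * v y) ->
  (mu \x mu)%E.-integrable setT (fun p => (k p)%:E).
Proof.
move=> mk iu iv u0 v0 kuv; apply/integrable12ltyP; first exact/measurable_EFinP.
have mu' := rintegrable_meas iu; have mv := rintegrable_meas iv.
apply: (@le_lt_trans _ _ (\int[mu]_x ((u x)%:E * \int[mu]_y (v y)%:E))%E).
  apply: ge0_le_integral => //.
  - by move=> x _; exact: integral_ge0.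
  - apply: (@measurable_fun_fubini_tonelli_F _ _ _ _ _ mu (fun p => `|k p|%:E)) => //.
    by apply/measurable_EFinP; exact: measurableT_comp.
  - by apply: emeasurable_funM => //; exact/measurable_EFinP.
  - move=> x _; rewrite -ge0_integralZl//; last 3 first.
      exact/measurable_EFinP.
      by move=> y _; rewrite lee_fin.
      by rewrite lee_fin.
    apply: ge0_le_integral => //.
    + apply/measurable_EFinP; apply: measurableT_comp => //.
      exact: measurableT_comp.
    + by apply/measurable_EFinP/measurable_funM => //; exact: measurable_cst.
    + by move=> y _; rewrite lee_fin.
have vf : (\int[mu]_y (v y)%:E)%E \is a fin_num by exact: integrable_fin_num.
rewrite -(fineK vf) ge0_integralZr//; last 3 first.
  exact/measurable_EFinP.
  by move=> y _; rewrite lee_fin.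
  by rewrite lee_fin fine_ge0// integral_ge0// => y _; rewrite lee_fin.
have uf : (\int[mu]_y (u y)%:E)%E \is a fin_num by exact: integrable_fin_num.
by rewrite -(fineK uf) -EFinM ltry.
Qed.

Lemma cint_Fubini (k : R -> R -> C) (u v : R -> R) :
  cmeas (fun p : R * R => k p.1 p.2) -> rintegrable u -> rintegrable v ->
  (forall x, 0 <= u x) -> (forall x, 0 <= v x) ->
  (forall x y, cabs (k x y) <= u x * v y) ->
  cint (fun x => cint (k x)) = cint (fun y => cint (fun x => k x y)).
Proof.
move=> [m1 m2] iu iv u0 v0 kuv; apply: complex_ext => /=.
- apply: (@Rintegral_Fubini (fun p => Re (k p.1 p.2))).
  apply: (integrable_prod m1 iu iv) => // x y.
  by rewrite (le_trans (Re_le_cabs _)).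
- apply: (@Rintegral_Fubini (fun p => Im (k p.1 p.2))).
  apply: (integrable_prod m2 iu iv) => // x y.
  by rewrite (le_trans (Im_le_cabs _)).
Qed.

Lemma cintegral_setT (D : set R) f :
  cintegral D f = cint (fun x => (\1_D x)%:C * f x).
Proof.
apply: complex_ext => /=; rewrite Rintegral_mkcond; apply: eq_Rintegral => x _;
  rewrite patchE indicE ?ReM ?ImM/=; case: ifP => _;
  by rewrite ?mul1r ?mul0r ?subr0 ?addr0.
Qed.

End complex_integral.

(** * The space L^2 *)

Section L2_functions.
Context {R : realType}.
Local Notation C := R[i].
Local Notation mu := (@lebesgue_measure R).
Local Notation cint := (cintegral setT).
Local Notation rintegrable h := (mu.-integrable setT (fun x => (h x)%:E)).
Local Notation L2 := (@in_Lp R 2).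
Implicit Types (f g : R -> C) (h : R -> R).

Definition N2 f := fine (cLnorm 2 f).

Lemma N2_ge0 f : 0 <= N2 f. Proof. by rewrite fine_ge0// Lnorm_ge0. Qed.

Lemma cLnorm_poweR (p : R) f : p != 0 ->
  (cLnorm p f `^ p)%E = (\int[mu]_x (cabs (f x) `^ p)%:E)%E.
Proof.
move=> p0; rewrite /cLnorm (poweR_Lnorm _ _ p0); apply: eq_integral => x _.
by rewrite abse_EFin poweR_EFin ger0_norm// cabs_ge0.
Qed.

Lemma in_LpP (p : R) f : 0 < p -> in_Lp p f <->
  cmeas f /\ rintegrable (fun x => cabs (f x) `^ p).
Proof.
move=> p0; split=> -[mf h]; split => //.
- apply/integrableP; split.
    apply/measurable_EFinP; apply: (measurableT_comp (measurable_powR _)).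
    exact: measurable_cabs.
  under eq_integral do rewrite gee0_abs ?lee_fin ?powR_ge0//.
  by rewrite -cLnorm_poweR ?gt_eqF//; exact: poweR_lty.
- have /integrableP[_] := h.
  under eq_integral do rewrite gee0_abs ?lee_fin ?powR_ge0//.
  rewrite -cLnorm_poweR ?gt_eqF// => h1; rewrite ltey; apply/eqP => hy.
  by move: h1; rewrite hy poweRyr ?gt_eqF// ltxx.
Qed.

Lemma powR2 (x : R) : 0 <= x -> x `^ 2 = x ^+ 2.
Proof. by move=> x0; rewrite -powR_mulrn. Qed.

Lemma L2P f : L2 f <-> cmeas f /\ rintegrable (fun x => cabs (f x) ^+ 2).
Proof.
rewrite in_LpP//; under [X in _ <-> _ /\ mu.-integrable _ X]eq_fun do
  rewrite -powR2 ?cabs_ge0//.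
by [].
Qed.

Lemma L2_cmeas f : L2 f -> cmeas f. Proof. by case/L2P. Qed.

Lemma N2_sqr f : L2 f -> N2 f ^+ 2 = \int[mu]_x cabs (f x) ^+ 2.
Proof.
move=> Lf; have [_ foo] := Lf.
have n2 : (2 : R) != 0 by [].
rewrite -powR2 ?N2_ge0//; apply: EFin_inj; rewrite -poweR_EFin /N2 fineK; last first.
  by rewrite ge0_fin_numE// Lnorm_ge0.
rewrite cLnorm_poweR//.
have /L2P[_ i2] := Lf.
under eq_integral do rewrite powR2 ?cabs_ge0//.
by rewrite fineK//; exact: integrable_fin_num.
Qed.

Lemma L2_cLnorm f : L2 f -> cLnorm 2 f = (N2 f)%:E.
Proof. by move=> [_ foo]; rewrite /N2 fineK// ge0_fin_numE// Lnorm_ge0. Qed.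

Lemma N2_le f (M : R) : L2 f -> 0 <= M ->
  \int[mu]_x cabs (f x) ^+ 2 <= M ^+ 2 -> N2 f <= M.
Proof.
by move=> Lf M0; rewrite -N2_sqr// ler_pXn2r ?nnegrE ?N2_ge0.
Qed.

Lemma L2_le f g : cmeas f -> L2 g -> (forall x, cabs (f x) <= cabs (g x)) -> L2 f.
Proof.
move=> mf /L2P[mg ig] fg; apply/L2P; split => //.
apply: (rintegrable_le _ ig); first by apply: measurable_funX; exact: measurable_cabs.
by move=> x; rewrite ger0_norm ?sqr_ge0// ler_pXn2r ?nnegrE ?cabs_ge0.
Qed.

Lemma N2_mono f g : cmeas f -> L2 g -> (forall x, cabs (f x) <= cabs (g x)) ->
  N2 f <= N2 g.
Proof.
move=> mf Lg fg; have Lf := L2_le mf Lg fg.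
apply: N2_le => //; first exact: N2_ge0.
rewrite N2_sqr//; have /L2P[_ i1] := Lf; have /L2P[_ i2] := Lg.
apply: le_Rintegral => // x _.
by rewrite ler_pXn2r ?nnegrE ?cabs_ge0.
Qed.

Lemma L2_real h : measurable_fun setT h -> rintegrable (fun x => h x ^+ 2) ->
  L2 (fun x => (h x)%:C).
Proof.
move=> mh ih; apply/L2P; split; first exact: cmeas_real.
by under eq_fun do rewrite cabs_real real_normK ?num_real//.
Qed.

Lemma ae_N2 f g : cmeas g -> L2 f -> {ae mu, forall x, f x = g x} ->
  L2 g /\ N2 g = N2 f.
Proof.
move=> mg Lf fg; have /L2P[mf if2] := Lf.
have Lg : L2 g.
  apply/L2P; split => //; apply: ae_rintegrable if2.
    by apply: measurable_funX; exact: measurable_cabs.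
  by apply: ae_mono fg => x ->.
split => //; apply/eqP; rewrite -(@eqrXn2 _ 2)// ?N2_ge0// !N2_sqr//; apply/eqP.
apply: ae_eq_Rintegral.
- by apply: measurable_funX; exact: measurable_cabs.
- by apply: measurable_funX; exact: measurable_cabs.
- by apply: ae_mono fg => x ->.
Qed.

Lemma N2_eq0 f : L2 f -> N2 f = 0 -> {ae mu, forall x, f x = 0}.
Proof.
move=> Lf f0; have [mf _] := Lf.
have : cLnorm 2 f = 0%E by rewrite L2_cLnorm// f0.
move/Lnorm_eq0_eq0 => h.
have {h} : (fun x => (cabs (f x))%:E) = \0 %[ae mu].
  by apply: h => //; apply/measurable_EFinP; exact: measurable_cabs.
by apply: ae_mono => x /(_ I)[] /cabs0_eq0.
Qed.

Lemma L2Z c f : L2 f -> L2 (fun x => c * f x) /\ N2 (fun x => c * f x) = cabs c * N2 f.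
Proof.
move=> Lf; have /L2P[mf if2] := Lf.
have Lc : L2 (fun x => c * f x).
  apply/L2P; split; first by apply: cmeasM => //; exact: cmeas_cst.
  by under eq_fun do rewrite cabsM exprMn; exact: rintegrableZ.
split => //; apply/eqP; rewrite -(@eqrXn2 _ 2)// ?N2_ge0// ?mulr_ge0 ?cabs_ge0 ?N2_ge0//.
apply/eqP; rewrite exprMn !N2_sqr//.
by under eq_Rintegral do rewrite cabsM exprMn; rewrite RintegralZl.
Qed.

Lemma L2D f g : L2 f -> L2 g ->
  L2 (fun x => f x + g x) /\ N2 (fun x => f x + g x) <= N2 f + N2 g.
Proof.
move=> Lf Lg; have mf := L2_cmeas Lf; have mg := L2_cmeas Lg.
have m1 := measurable_cabs mf; have m2 := measurable_cabs mg.
have h : (cLnorm 2 (fun x => (cabs (f x) + cabs (g x))%:C) <= (N2 f + N2 g)%:E)%E.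
  rewrite EFinD -!L2_cLnorm//.
  apply: le_trans (minkowski_EFin mu m1 m2 _); last by rewrite ler1n.
  rewrite /cLnorm le_eqVlt; apply/orP; left; apply/eqP; congr Lnorm.
  by apply/funext => x; rewrite cabs_real ger0_norm// addr_ge0// cabs_ge0.
have Ls : L2 (fun x => (cabs (f x) + cabs (g x))%:C).
  by split; [apply: cmeas_real; exact: measurable_funD|rewrite (le_lt_trans h)// ltry].
have mD := cmeasD mf mg.
have fgs x : cabs (f x + g x) <= cabs (cabs (f x) + cabs (g x))%:C.
  by rewrite cabs_real ger0_norm ?addr_ge0 ?cabs_ge0// le_cabsD.
split; first exact: L2_le fgs.
rewrite (le_trans (N2_mono mD Ls fgs))//.
by rewrite -lee_fin -L2_cLnorm.
Qed.

Lemma L2N f : L2 f -> L2 (fun x => - f x) /\ N2 (fun x => - f x) = N2 f.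
Proof.
move=> /(L2Z (-1)); rewrite cabsN cabs1 mul1r.
by under eq_fun do rewrite mulN1r.
Qed.

Lemma L2B f g : L2 f -> L2 g ->
  L2 (fun x => f x - g x) /\ N2 (fun x => f x - g x) <= N2 f + N2 g.
Proof. by move=> Lf /L2N[Lg <-]; exact: L2D. Qed.

Lemma N2BC f g : N2 (fun x => f x - g x) = N2 (fun x => g x - f x).
Proof.
by congr fine; apply: eq_Lnorm => x; rewrite cabsBC.
Qed.

Lemma N2_dist f g k : L2 f -> L2 g -> L2 k ->
  N2 (fun x => f x - k x) <= N2 (fun x => f x - g x) + N2 (fun x => g x - k x).
Proof.
move=> Lf Lg Lk; have [L1 _] := L2B Lf Lg; have [L3 _] := L2B Lg Lk.
have [_] := L2D L1 L3.
by under [X in N2 X <= _ -> _]eq_fun do rewrite addrA subrK.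
Qed.

Lemma L2J f : L2 f -> L2 (fun x => conjc (f x)) /\ N2 (fun x => conjc (f x)) = N2 f.
Proof.
move=> Lf; have h x : cabs (conjc (f x)) = cabs (f x) by rewrite cabsJ.
split; last by congr fine; apply: eq_Lnorm => x; rewrite h.
by apply: (L2_le _ Lf) => [|x]; [apply: cmeasJ; exact: L2_cmeas|rewrite h].
Qed.

Lemma L2_zero : L2 (fun=> 0) /\ N2 (fun=> 0) = 0.
Proof.
have L0 : L2 (fun=> 0).
  apply/L2P; split; first exact: cmeas_cst.
  by under eq_fun do rewrite cabs0 expr0n; exact: integrable0.
split => //; apply/eqP; rewrite eq_le N2_ge0 andbT N2_le//.
by under eq_Rintegral do rewrite cabs0 expr0n; rewrite Rintegral_cst//= mul0r expr0n.
Qed.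

Lemma L2M f g : L2 f -> L2 g -> cintegrable (fun x => f x * g x) /\
  cabs (cint (fun x => f x * g x)) <= N2 f * N2 g.
Proof.
move=> Lf Lg; have mf := L2_cmeas Lf; have mg := L2_cmeas Lg.
have m1 := measurable_cabs mf; have m2 := measurable_cabs mg.
have h : ('N[mu]_1[EFin \o ((fun x => cabs (f x)) \* (fun x => cabs (g x)))%R] <=
    (N2 f * N2 g)%:E)%E.
  rewrite EFinM -!L2_cLnorm//.
  apply: (hoelder mu m1 m2) => //; lra.
have ifg : rintegrable (fun x => cabs (f x) * cabs (g x)).
  apply/integrableP; split; first exact/measurable_EFinP/measurable_funM.
  by rewrite -Lnorm1 (le_lt_trans h)// ltry.
have ci : cintegrable (fun x => f x * g x).
  by apply: (cintegrable_le (cmeasM mf mg) ifg) => x; rewrite cabsM.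
split => //.
rewrite (le_trans (le_cabs_cint_bound (cmeasM mf mg) ifg _))//.
  by move=> x; rewrite cabsM.
rewrite -lee_fin /Rintegral fineK; last exact: integrable_fin_num.
apply: le_trans h; rewrite Lnorm1 le_eqVlt; apply/orP; left; apply/eqP.
by apply: eq_integral => x _; rewrite /= ger0_norm// mulr_ge0 ?cabs_ge0.
Qed.

Lemma Rfatou (f_ : nat -> R -> R) h (E : R) :
  (forall n, rintegrable (f_ n)) -> measurable_fun setT h ->
  (forall n x, 0 <= f_ n x) ->
  {ae mu, forall x, f_ n x @[n --> \oo] --> h x} ->
  (forall n, \int[mu]_x f_ n x <= E) ->
  rintegrable h /\ \int[mu]_x h x <= E.
Proof.
move=> fi mh f0 fh fE.
have mf n : measurable_fun setT (f_ n) := rintegrable_meas (fi n).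
have h0 : {ae mu, forall x, 0 <= h x}.
  apply: ae_mono fh => x fx; rewrite -(cvg_lim _ fx)//; apply: limr_ge => //.
    by apply/cvg_ex; exists (h x).
  exact: nearW.
have H : (\int[mu]_x `|(h x)%:E| <= E%:E)%E.
  have -> : (\int[mu]_x `|(h x)%:E| = \int[mu]_x limn_einf (fun n => (f_ n x)%:E))%E.
    apply: ae_eq_integral => //.
    - by apply: measurableT_comp => //; exact/measurable_EFinP.
    (* Measurability of a lower limit is reduced to that of an upper limit by a change of sign. *)
    - rewrite (_ : (fun x => limn_einf _) =
          (fun x => - limn_esup (fun n => - (f_ n x)%:E))%E); last first.
        by apply/funext => x; rewrite -limn_einfN; congr limn_einf; apply/funext => n;
          rewrite /comp oppeK.
      apply: measurableT_comp => //.
      apply: (@measurable_fun_limn_esup _ _ _ _ (fun n x => (- (f_ n x)%:E)%E)) => n.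
      by apply: measurableT_comp => //; apply/measurable_EFinP; exact: mf.
    - apply: ae_mono (ae_and h0 fh) => x [hx fx] _.
      have cE : (fun n => (f_ n x)%:E) n @[n --> \oo] --> (h x)%:E.
        by apply: cvg_EFin => //; exact: nearW.
      by rewrite (cvg_limn_einf_sup cE).1 gee0_abs.
  apply: (le_trans (fatou _ _ _ _)) => //.
  - by move=> n; apply/measurable_EFinP; exact: mf.
  - by move=> n x _; rewrite lee_fin.
  rewrite limn_einf_lim; apply: lime_le; first exact: is_cvg_einfs.
  apply: nearW => n; apply: ereal_inf_le.
  exists (\int[mu]_x (f_ n x)%:E)%E; first by exists n => //=.
  by rewrite -(fineK (integrable_fin_num _ (fi n)))// lee_fin; exact: fE.
have ih : rintegrable h.
  by apply/integrableP; split; [exact/measurable_EFinP|rewrite (le_lt_trans H)// ltry].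
split => //; rewrite -lee_fin fineK; last exact: integrable_fin_num.
by rewrite (le_trans _ H)// (le_trans (lee_abs _))// le_abse_integral//; exact/measurable_EFinP.
Qed.

Lemma N2_fatou (u : nat -> R -> C) f (E : R) : (forall n, L2 (u n)) -> cmeas f -> 0 <= E ->
  {ae mu, forall x, ccvg (u^~ x) (f x)} -> (forall n, N2 (u n) <= E) ->
  L2 f /\ N2 f <= E.
Proof.
move=> Lu mf E0 uf uE.
have iu n : rintegrable (fun x => cabs (u n x) ^+ 2) by have /L2P[] := Lu n.
have [] := @Rfatou (fun n x => cabs (u n x) ^+ 2) (fun x => cabs (f x) ^+ 2) (E ^+ 2) iu.
- by apply: measurable_funX; exact: measurable_cabs.
- by move=> n x; exact: sqr_ge0.
- apply: ae_mono uf => x ux; have : cabs (u n x) @[n --> \oo] --> cabs (f x).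
    apply/cvgrPdist_lt => e e0; move/cvgrPdist_lt : ux => /(_ _ e0).
    apply: filterS => n; rewrite sub0r normrN ger0_norm ?cabs_ge0//; apply: le_lt_trans.
    by rewrite distrC cabs_dist.
  by move=> h; rewrite expr2; under eq_fun do rewrite expr2; exact: cvgM.
- by move=> n; rewrite -N2_sqr// ler_pXn2r ?nnegrE ?N2_ge0.
move=> ih hE; have Lf : L2 f by apply/L2P.
by split => //; exact: N2_le.
Qed.

Lemma geometric4_le n : \sum_(0 <= k < n) (4^-1 ^+ k : R) <= 2.
Proof.
suff : \sum_(0 <= k < n) (4^-1 ^+ k : R) <= 4 / 3 - 4 / 3 * 4^-1 ^+ n.
  have : (0 : R) <= 4^-1 ^+ n by rewrite exprn_ge0.
  lra.
elim: n => [|n IH]; first by rewrite big_geq// expr0; lra.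
by rewrite big_nat_recr//= exprS; lra.
Qed.

Lemma cvgn_geometric_increments (v : nat -> R) (A : R) :
  (forall k, `|v k.+1 - v k| <= A * 2^-1 ^+ k) -> cvgn v.
Proof.
move=> vA; have A0 : 0 <= A by have := vA 0%N; rewrite expr0 mulr1; apply: le_trans.
have cs : cvgn (series (telescope v)).
  apply: normed_cvg; apply: (@series_le_cvg _ _ (geometric A 2^-1)) => [n|n|n|].
  - exact: normr_ge0.
  - by rewrite /= mulr_ge0// exprn_ge0.
  - exact: vA.
  - by apply: is_cvg_geometric_series; rewrite ger0_norm// invf_lt1// ltr1n.
rewrite (_ : v = (fun n => v 0%N + series (telescope v) n)); last first.
  by apply/funext => n; exact: eq_sum_telescope.
by apply: is_cvgD => //; exact: is_cvg_cst.
Qed.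

(* If consecutive distances are at most 4^-k, then w = sum_k 4^k |v_(k+1) - v_k|^2
   is integrable, and w(x) < oo forces |v_(k+1) x - v_k x| <= sqrt(w x) 2^-k. *)
Lemma L2_fast_cauchy_cvg (v : nat -> R -> C) : (forall n, L2 (v n)) ->
  (forall k, N2 (fun x => v k.+1 x - v k x) <= 4^-1 ^+ k) ->
  exists2 g, cmeas g & {ae mu, forall x, ccvg (v^~ x) (g x)}.
Proof.
move=> Lv dv; have Ld k : L2 (fun x => v k.+1 x - v k x) by have [] := L2B (Lv k.+1) (Lv k).
pose a k x : R := 4 ^+ k * cabs (v k.+1 x - v k x) ^+ 2.
have a0 k x : 0 <= a k x by rewrite mulr_ge0 ?sqr_ge0// exprn_ge0.
have ia k : rintegrable (a k) by apply: rintegrableZ; have /L2P[] := Ld k.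
have ma k : measurable_fun setT (a k) := rintegrable_meas (ia k).
pose w x := (\sum_(0 <= k <oo) (a k x)%:E)%E.
have wint : (\int[mu]_x w x <= 2%:E)%E.
  rewrite /w integral_nneseries//; last 2 first.
  - by move=> k; apply/measurable_EFinP; exact: ma.
  - by move=> k x _; rewrite lee_fin.
  apply: lime_le; first by apply: is_cvg_nneseries => k _ _; apply: integral_ge0 => x _;
    rewrite lee_fin.
  apply: nearW => n.
  apply: le_trans (_ : (\sum_(0 <= k < n) (4^-1 ^+ k)%:E <= _)%E); last first.
    by rewrite sumEFin lee_fin geometric4_le.
  apply: lee_sum => k _.
  rewrite -(fineK (integrable_fin_num _ (ia k)))// lee_fin -/(Rintegral mu setT _).
  rewrite RintegralZl//; last by have /L2P[] := Ld k.
  rewrite -N2_sqr//.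
  have : N2 (fun x => v k.+1 x - v k x) ^+ 2 <= (4^-1 ^+ k) ^+ 2.
    by rewrite ler_pXn2r ?nnegrE ?N2_ge0 ?exprn_ge0.
  move=> /(ler_wpM2l (_ : 0 <= 4 ^+ k)) => /(_ (exprn_ge0 _ _)) h.
  apply: le_trans (h _) _ => //.
  by rewrite expr2 mulrA -exprMn divff// expr1n mul1r.
have mw : measurable_fun setT w.
  apply: ge0_emeasurable_sum => k; first by move=> x _ _; rewrite lee_fin.
  by move=> _; apply/measurable_EFinP; exact: ma.
have w0 x : (0 <= w x)%E by apply: nneseries_ge0 => k _ _; rewrite lee_fin.
have wfin : {ae mu, forall x, w x \is a fin_num}.
  have iw : mu.-integrable setT w.
    apply/integrableP; split => //.
    under eq_integral do rewrite gee0_abs//.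
    by rewrite (le_lt_trans wint)// ltry.
  by have := integrable_ae measurableT iw; apply: ae_mono => x; exact.
have wcvg x : w x \is a fin_num ->
    cvgn (fun n => Re (v n x)) /\ cvgn (fun n => Im (v n x)).
  move=> wf; set W := fine (w x).
  have W0 : 0 <= W by rewrite fine_ge0.
  have h k : cabs (v k.+1 x - v k x) <= Num.sqrt W * 2^-1 ^+ k.
    have : ((a k x)%:E <= w x)%E.
      have := @nneseries_lim_ge _ (fun k => (a k x)%:E) xpredT 0%N k.+1.
      move=> /(_ (fun n _ _ => _)) H; apply: le_trans (H _); last by move=> *; rewrite lee_fin.
      rewrite big_nat_recr//= leeDr// sume_ge0// => i _; rewrite lee_fin//.
    rewrite -(fineK wf) lee_fin -/W => aW.
    rewrite -(@ler_pXn2r _ 2)// ?nnegrE ?cabs_ge0 ?mulr_ge0 ?sqrtr_ge0 ?exprn_ge0//.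
    rewrite exprMn sqr_sqrtr// -exprM mulnC exprM.
    have -> : (2^-1 : R) ^+ 2 = 4^-1 by rewrite expr2 -invfM; congr (_^-1); ring.
    rewrite exprVn ler_pdivlMr ?exprn_gt0// mulrC; exact: aW.
  split; apply: (@cvgn_geometric_increments _ (Num.sqrt W)) => k.
  - by rewrite -ReB (le_trans (Re_le_cabs _)).
  - by rewrite -ImB (le_trans (Im_le_cabs _)).
(* The upper limit is defined and measurable at every point, including those where the sequence
   diverges, so it provides a globally defined limit function. *)
pose L (u : nat -> R) := fine (limn_esup (fun n => (u n)%:E)).
have LE u : cvgn u -> u n @[n --> \oo] --> L u.
  move=> cu; have : (u n)%:E @[n --> \oo] --> (limn u)%:E.
    by apply: cvg_EFin => //; exact: nearW.
  by move/cvg_limn_einf_sup => [_ e]; rewrite /L e.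
have mL (u : nat -> R -> R) : (forall n, measurable_fun setT (u n)) ->
    measurable_fun setT (fun x => L (u^~ x)).
  move=> mu'; apply: (measurableT_comp (@fine_measurable R setT measurableT)).
  apply: (@measurable_fun_limn_esup _ _ _ _ (fun n x => (u n x)%:E)) => n.
  by apply/measurable_EFinP; exact: mu'.
exists (fun x => L (fun n => Re (v n x)) +i* L (fun n => Im (v n x))).
  by split; apply: mL => n; have [] := L2_cmeas (Lv n).
apply: ae_mono wfin => x /wcvg[c1 c2].
by apply/ccvg_ReIm; split; exact: LE.
Qed.

(** Riesz-Fischer: a subsequence with geometric increments converges almost everywhere, Fatou turns
    this into convergence in norm, and the Cauchy condition carries it over to the whole
    sequence. *)
Lemma L2_complete (u : nat -> R -> C) : (forall n, L2 (u n)) ->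
  (forall e : R, 0 < e -> exists N : nat, forall m n : nat, (N <= m)%N -> (N <= n)%N ->
    N2 (fun x => u m x - u n x) < e) ->
  exists2 g, L2 g & N2 (fun x => u n x - g x) @[n --> \oo] --> (0 : R).
Proof.
move=> Lu uc.
have e0 k : (0 : R) < 4^-1 ^+ k by rewrite exprn_gt0.
have /choice[phi phiP] : forall k, exists N : nat, forall m n : nat, (N <= m)%N -> (N <= n)%N ->
    N2 (fun x => u m x - u n x) < 4^-1 ^+ k by move=> k; exact: uc.
(* A sum of the thresholds up to k dominates each of them, so no monotonicity of [phi] has to be
   arranged. *)
pose psi k := (\sum_(i < k.+1) phi i)%N.
have psi_ge k l : (k <= l)%N -> (phi k <= psi l)%N.
  move=> kl; have kl1 : (k < l.+1)%N by [].
  by rewrite /psi (bigD1 (Ordinal kl1))//= leq_addr.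
pose v k := u (psi k).
have Lv k : L2 (v k) by exact: Lu.
have [|g mg vg] := @L2_fast_cauchy_cvg v Lv.
  by move=> k; apply/ltW/phiP; apply: psi_ge.
have vgk k : L2 (fun x => v k x - g x) /\ N2 (fun x => v k x - g x) <= 4^-1 ^+ k.
  have mk : cmeas (v k) := L2_cmeas (Lv k).
  apply: (@N2_fatou (fun n x => v k x - v (n + k)%N x)).
  - by move=> n; have [] := L2B (Lv k) (Lv (n + k)%N).
  - exact: cmeasB.
  - exact: ltW.
  - apply: ae_mono vg => x vx; apply: ccvgB; first exact: ccvg_cst.
    by rewrite /ccvg (@cvg_shiftn _ _ (fun n => cabs (v n x - g x))).
  - by move=> n; apply/ltW/phiP; apply: psi_ge => //; exact: leq_addl.
have Lg : L2 g.
  have [Ld _] := vgk 0%N; have [L0 _] := L2B (Lv 0%N) Ld.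
  rewrite (_ : g = fun x => v 0%N x - (v 0%N x - g x))//.
  by apply/funext => x; rewrite opprB addrC subrK.
exists g => //; apply/cvgrPdist_lt => e e_gt0.
have [k ke] : exists k, 4^-1 ^+ k < e / 2.
  have h : (4^-1 ^+ k : R) @[k --> \oo] --> 0 by apply: cvg_expr;
    rewrite ger0_norm// invf_lt1// ltr1n.
  move/cvgrPdist_lt : h => /(_ (e / 2)); rewrite divr_gt0// => /(_ isT)[k _ hk].
  exists k; have := hk k (leqnn k); rewrite sub0r normrN ger0_norm// ltW//.
exists (phi k) => // n /= kn; rewrite sub0r normrN ger0_norm ?N2_ge0//.
rewrite (le_lt_trans (N2_dist (Lu n) (Lv k) Lg))// (splitr e) ltrD//.
- by rewrite (lt_trans _ ke)//; apply: phiP => //; exact: psi_ge.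
- by rewrite (le_lt_trans (vgk k).2).
Qed.

Lemma L2_mulJ_cvg (u v : nat -> R -> C) f g :
  (forall n, L2 (u n)) -> (forall n, L2 (v n)) -> L2 f -> L2 g ->
  N2 (fun x => u n x - f x) @[n --> \oo] --> (0 : R) ->
  N2 (fun x => v n x - g x) @[n --> \oo] --> (0 : R) ->
  ccvg (fun n => L2_inner (u n) (v n)) (L2_inner f g).
Proof.
move=> Lu Lv Lf Lg uf vg.
pose A n := N2 (fun x => u n x - f x); pose B n := N2 (fun x => v n x - g x).
have h : (A n * (B n + N2 g) + N2 f * B n) @[n --> \oo] --> (0 * (0 + N2 g) + N2 f * 0 : R).
  apply: cvgD; apply: cvgM => //; last exact: cvg_cst.
  by apply: cvgD => //; exact: cvg_cst.
rewrite mul0r mulr0 addr0 in h; apply: (ccvg_le h) => n.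
have [Ld _] := L2B (Lu n) Lf; have [Le _] := L2B (Lv n) Lg.
have [LvJ NvJ] := L2J (Lv n); have [LeJ NeJ] := L2J Le; have [LgJ NgJ] := L2J Lg.
have [i1 b1] := L2M Ld LvJ; have [i2 b2] := L2M Lf LeJ.
have [i3 _] := L2M (Lu n) LvJ; have [i4 _] := L2M Lf LgJ.
rewrite /L2_inner -cintB//.
have -> : (fun x => u n x * conjc (v n x) - f x * conjc (g x)) =
    (fun x => (u n x - f x) * conjc (v n x) + f x * conjc (v n x - g x)).
  by apply/funext => x; rewrite rmorphB; ring.
rewrite cintD// (le_trans (le_cabsD _ _))// lerD//.
  rewrite (le_trans b1)// NvJ ler_wpM2l ?N2_ge0//.
  have [_] := L2D Le Lg; by under eq_fun do rewrite subrK.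
by rewrite (le_trans b2)// NeJ.
Qed.

Lemma L2_inner_self f : L2 f -> L2_inner f f = (N2 f ^+ 2)%:C.
Proof.
by move=> Lf; rewrite /L2_inner N2_sqr// -cint_real; under eq_fun do rewrite mulJ.
Qed.

Lemma le_of_eq (x y : R) : x = y -> x <= y. Proof. by move=> ->. Qed.

Lemma N2_dct (u : nat -> R -> C) (g : R -> C) : (forall n, cmeas (u n)) -> L2 g ->
  (forall n x, cabs (u n x) <= cabs (g x)) ->
  {ae mu, forall x, ccvg (u^~ x) 0} ->
  N2 (u n) @[n --> \oo] --> (0 : R).
Proof.
move=> mu_ Lg ug u0; have /L2P[mg i2] := Lg.
have Lu n : L2 (u n) := L2_le (mu_ n) Lg (ug n).
have h : \int[mu]_x cabs (u n x) ^+ 2 @[n --> \oo] --> \int[mu]_x (cst 0 x : R).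
  apply: (Rintegral_dct _ _ _ i2).
  - by move=> n; apply: measurable_funX; exact: measurable_cabs.
  - exact: measurable_cst.
  - apply: ae_mono u0 => x cx; apply: (cvg_eq_lim (_ : 0 ^+ 2 = 0 :> R)); first by rewrite expr0n.
    rewrite expr2; under eq_fun do rewrite expr2; apply: cvgM;
      by move: cx; rewrite /ccvg; under eq_fun do rewrite subr0.
  - by move=> n x; rewrite ger0_norm ?sqr_ge0// ler_sqr ?nnegrE ?cabs_ge0.
rewrite Rintegral_cst// mul0r in h.
have := (@sqrt_continuous R 0); rewrite /continuous_at sqrtr0 => cs.
have := cvg_comp _ _ h cs; apply: cvg_trans.
rewrite (_ : (fun n => N2 _) = Num.sqrt \o (fun n => \int[mu]_x cabs (u n x) ^+ 2))//.
apply/funext => n /=; rewrite -N2_sqr//.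
by rewrite sqrtr_sqr ger0_norm// N2_ge0.
Qed.

Lemma L2real_abs (f : R -> C) : L2 f -> L2 (fun x => (cabs (f x))%:C) /\
  N2 (fun x => (cabs (f x))%:C) = N2 f.
Proof.
move=> Lf; have m : cmeas (fun x => (cabs (f x))%:C).
  by apply: cmeas_real; apply: measurable_cabs; exact: L2_cmeas.
have e x : cabs (cabs (f x))%:C = cabs (f x) by rewrite cabs_real ger0_norm ?cabs_ge0.
have L := L2_le m Lf (fun x => le_of_eq (e x)).
split=> //; apply/eqP; rewrite eq_le (N2_mono m Lf (fun x => le_of_eq (e x)))/=.
exact: N2_mono (L2_cmeas Lf) L (fun x => le_of_eq (esym (e x))).
Qed.

End L2_functions.

(** * Goursat, contour shifts and Gaussian integrals *)

Section holomorphic.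
Context {R : realType}.
Local Notation C := R[i].
Implicit Types (f g : C -> C) (z w : C).

(** Complex differentiability in epsilon-delta form with a real modulus. The next lemmas translate
    to and from [derivable] over [R[i]^o], so that all estimates can stay in [R]. *)
Definition cderiv f z (l : C) := forall e : R, 0 < e -> exists2 d : R, 0 < d &
  forall h : C, cabs h < d -> cabs (f (z + h) - f z - l * h) <= e * cabs h.

Lemma normCE (z : C) : `|z| = (cabs z)%:C.
Proof. by rewrite normc_def cabsE. Qed.

Lemma posC_real (e : C) : 0 < e -> exists2 r : R, 0 < r & e = r%:C.
Proof. by case: e => a b; rewrite ltcE/= => /andP[/eqP -> a0]; exists a. Qed.

Lemma derivable_cderiv f z : derivable (f : C^o -> C^o) z 1 -> exists l, cderiv f z l.
Proof.
move=> /cvg_ex[/= l fl]; exists l => e e0.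
move/cvgrPdist_lt : fl => /(_ e%:C); rewrite ltcR => /(_ e0).
case=> r /= /posC_real[d d0 ->] H; exists d => // h hd.
have [->|h0] := eqVneq h 0; first by rewrite addr0 subrr mulr0 subr0 cabs0 mulr0.
have := H h; rewrite /ball_/= sub0r normrN normCE ltcR => /(_ hd h0).
rewrite normCE ltcR => /ltW h1.
rewrite [X in cabs X](_ : _ = h * - (l - h^-1 *: ((f (h *: 1 + z) : C) - f z))); last first.
  rewrite opprB mulrBr [h *: 1]mulr1 [h^-1 *: _]/(h^-1 * _) mulrA divff// mul1r.
  by rewrite [z + h]addrC [l * h]mulrC.
by rewrite cabsM cabsN mulrC ler_wpM2r ?cabs_ge0.
Qed.

Lemma cderiv_derivable f z l : cderiv f z l -> derivable (f : C^o -> C^o) z 1.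
Proof.
move=> fl; apply/cvg_ex; exists (l : C^o); apply/cvgrPdist_le => /= e /posC_real[r r0 ->].
have [d d0 H] := fl r r0.
exists d%:C => /=; first by rewrite ltcR.
move=> h; rewrite /ball_/= sub0r normrN normCE ltcR => /H hd h0.
rewrite normCE lecR.
rewrite [X in cabs X](_ : _ = - (h^-1 * (f (z + h) - f z - l * h))); last first.
  rewrite [h *: 1]mulr1 [h^-1 *: _]/(h^-1 * _) [z + h]addrC mulrBr.
  by rewrite [h^-1 * (l * h)]mulrCA mulVf// mulr1 opprB.
rewrite cabsN cabsM Normc.normcV mulrC ler_pdivrMr//.
by rewrite lt_neqAle cabs_ge0 andbT eq_sym; apply: contra h0 => /eqP/cabs0_eq0 ->.
Qed.

Lemma cderiv_cont f z l : cderiv f z l -> forall e : R, 0 < e -> exists2 d : R, 0 < d &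
  forall h, cabs h < d -> cabs (f (z + h) - f z) < e.
Proof.
move=> fl e e0; have [d d0 H] := fl 1 ltr01.
pose M := 1 + cabs l; have M0 : 0 < M by rewrite ltr_pwDl ?cabs_ge0.
exists (Num.min d (e / M)); first by rewrite lt_min d0 divr_gt0.
move=> h; rewrite lt_min => /andP[hd he].
rewrite -[f (z + h) - f z](subrK (l * h)) (le_lt_trans (le_cabsD _ _))//.
rewrite (le_lt_trans (lerD (H h hd) (lexx _)))// cabsM -mulrDl -ltr_pdivlMl// mulrC//.
Qed.

Lemma entireD f g : entire f -> entire g -> entire (fun z => f z + g z).
Proof. by move=> ef eg z; apply: (@derivableD _ _ _ (f : C^o -> C^o) (g : C^o -> C^o)). Qed.

Lemma entireM f g : entire f -> entire g -> entire (fun z => f z * g z).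
Proof. by move=> ef eg z; apply: (@derivableM _ _ (f : C^o -> C^o) (g : C^o -> C^o)). Qed.

Lemma entire_cst c : entire (fun=> c : C).
Proof. by move=> z; exact: derivable_cst. Qed.

Lemma entire_id : entire (fun z : C => z).
Proof. by move=> z; exact: derivable_id. Qed.

Lemma entireB f g : entire f -> entire g -> entire (fun z => f z - g z).
Proof. by move=> ef eg z; apply: (@derivableB _ _ _ (f : C^o -> C^o) (g : C^o -> C^o)). Qed.

Lemma entire_cexp : entire (@cexp R).
Proof.
move=> z; apply: (@cderiv_derivable _ _ (cexp z)) => e e0.
pose K := 6 * expR 1 * cabs (cexp z) + 1.
have K0 : 0 < K by rewrite ltr_wpDl// !mulr_ge0 ?expR_ge0 ?cabs_ge0.
exists (Num.min 1 (e / K)); first by rewrite lt_min ltr01 divr_gt0.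
move=> h; rewrite lt_min => /andP[h1 he].
rewrite cexpD (_ : _ - _ - _ = cexp z * (cexp h - 1 - h)); last by ring.
rewrite cabsM (le_trans (ler_wpM2l (cabs_ge0 _) (cexp_expand h)))//.
have e1 : expR (cabs h) <= expR 1 by rewrite ler_expR ltW.
have h0 := cabs_ge0 h; have c0 := cabs_ge0 (cexp z).
apply: (@le_trans _ _ (K * cabs h * cabs h)); last first.
  by rewrite ler_wpM2r// mulrC -ler_pdivlMr// ltW.
rewrite expr2 mulrC -!mulrA mulrA -(mulrA 6) [_ * (expR _ * _)]mulrC mulrA.
rewrite -[K * _]mulrC.
rewrite (_ : 6 * _ * _ = (cabs h * cabs h) * (6 * expR (cabs h) * cabs (cexp z))); last by ring.
rewrite ler_wpM2l ?mulr_ge0//.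
rewrite /K ler_wpDr// ler_wpM2r// ler_wpM2l//.
Qed.

Lemma entire_comp f g : entire f -> entire g -> entire (fun z => f (g z)).
Proof.
move=> ef eg z; apply/derivable1_diffP.
apply: (@differentiable_comp _ _ _ _ (g : C^o -> C^o) (f : C^o -> C^o)).
- by apply/derivable1_diffP; exact: eg.
- by apply/derivable1_diffP; exact: ef.
Qed.

Definition rcont (u : R -> C) := continuous (fun x => Re (u x)) /\ continuous (fun x => Im (u x)).

Lemma rcontP (u : R -> C) : (forall x (e : R), 0 < e -> exists2 d : R, 0 < d &
   forall t, `|t| < d -> cabs (u (x + t) - u x) < e) -> rcont u.
Proof.
move=> H; split=> x; apply/cvgrPdist_lt => e e0; have [d d0 Hd] := H x e e0.
- exists d => //= t; rewrite /ball_/= => xt.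
  rewrite distrC -ReB (le_lt_trans (Re_le_cabs _))//.
  by rewrite -[t in u t](subrKC x t) Hd// distrC.
- exists d => //= t; rewrite /ball_/= => xt.
  rewrite distrC -ImB (le_lt_trans (Im_le_cabs _))//.
  by rewrite -[t in u t](subrKC x t) Hd// distrC.
Qed.

Lemma entire_rcont f (p q : C) : entire f -> rcont (fun x => f (p + q * x%:C)).
Proof.
move=> ef; apply: rcontP => x e e0.
have [l fl] := derivable_cderiv (ef (p + q * x%:C)).
have [d d0 H] := cderiv_cont fl e0.
have K0 : 0 < cabs q + 1 by rewrite ltr_wpDl ?cabs_ge0.
exists (d / (cabs q + 1)); first by rewrite divr_gt0.
move=> t td; rewrite real_complexD mulrDr addrA; apply: H.
rewrite cabsM cabs_real (le_lt_trans (_ : _ <= (cabs q + 1) * `|t|))//.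
  by rewrite ler_wpM2r// lerDl.
by rewrite mulrC -ltr_pdivlMr.
Qed.

Lemma rcont_cmeas (u : R -> C) : rcont u -> cmeas u.
Proof. by move=> [u1 u2]; split; exact: continuous_measurable_fun. Qed.

End holomorphic.

(** * Boundary integrals of rectangles and Goursat's theorem *)

Section rectangles.
Context {R : realType}.
Local Notation C := R[i].
Local Notation mu := (@lebesgue_measure R).
Local Notation cint := (cintegral setT).
Local Notation rintegrable h := (mu.-integrable setT (fun x => (h x)%:E)).
Implicit Types (u v : R -> C) (f g h : C -> C).

Lemma ae_neq (b : R) : {ae mu, forall x, x <> b}.
Proof.
exists [set b]; split => //; first exact: lebesgue_measure_set1.
by move=> x /= /contrapT.
Qed.

Lemma rintegrable_indic (a b : R) : rintegrable (fun x => \1_`[a, b] x : R).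
Proof. exact: (integrable_indic_itv a b true false). Qed.

Lemma Rintegral_indic (a b : R) : a <= b -> \int[mu]_x (\1_`[a, b] x : R) = b - a.
Proof.
move=> ab; rewrite /Rintegral integral_indic//= setIT lebesgue_measure_itv/= lte_fin.
by case: ltP => //= ba; apply/eqP; rewrite eq_sym subr_eq0 eq_le ab ba.
Qed.

(** An indicator over the whole line is used in place of a domain of integration, so that the lemmas
    on [cint] apply unchanged. *)
Definition seg (a b : R) u := cint (fun x => (\1_`[a, b] x)%:C * u x).

Lemma seg_cintegrable a b u : rcont u -> cintegrable (fun x => (\1_`[a, b] x : R)%:C * u x).
Proof.
have H (w : R -> R) : continuous w -> rintegrable (fun x => \1_`[a, b] x * w x).
  move=> cw.
  have := @continuous_compact_integrable R w `[a, b] (@segment_compact R a b)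
    (continuous_subspaceT cw).
  move/(integrable_mkcond _ _).1 => /(_ (measurable_itv _)).
  apply: eq_integrable => // x _ /=; rewrite restrict_EFin /= patchE indicE.
  by case: ifP; rewrite ?mul1r ?mul0r.
move=> [u1 u2]; split.
- by under eq_fun do rewrite ReM/= mul0r subr0; exact: H.
- by under eq_fun do rewrite ImM/= mul0r addr0; exact: H.
Qed.

Lemma seg_split a b c u : rcont u -> a <= b -> b <= c ->
  seg a c u = seg a b u + seg b c u.
Proof.
move=> cu ab bc.
have i1 := seg_cintegrable a b cu; have i2 := seg_cintegrable b c cu.
have i3 := seg_cintegrable a c cu.
rewrite /seg -cintD//; apply: ae_eq_cint.
- exact: cintegrable_cmeas.
- by apply: cmeasD; exact: cintegrable_cmeas.
apply: ae_mono (ae_neq b) => x /eqP xb; rewrite -mulrDl -real_complexD; congr (_%:C * _).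
rewrite !indicE !mem_setE !in_itv/=.
by case: (leP a x) (leP x b) (leP b x) (leP x c) xb => ? [] ? [] ? [] ? //=;
  rewrite ?addr0 ?add0r//; lra.
Qed.

Lemma segD a b u v : rcont u -> rcont v ->
  seg a b (fun x => u x + v x) = seg a b u + seg a b v.
Proof.
move=> cu cv; rewrite /seg -cintD; [|exact: seg_cintegrable..].
by under eq_fun do rewrite mulrDr.
Qed.

Lemma segZ a b c u : rcont u -> seg a b (fun x => c * u x) = c * seg a b u.
Proof.
move=> cu; rewrite /seg -cintZ; last exact: seg_cintegrable.
by under eq_fun do rewrite mulrCA.
Qed.

Lemma seg_bound a b u (M : R) : rcont u -> a <= b ->
  (forall x, a <= x <= b -> cabs (u x) <= M) -> cabs (seg a b u) <= M * (b - a).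
Proof.
move=> cu ab uM; rewrite -Rintegral_indic// -RintegralZl//; last exact: rintegrable_indic.
apply: le_cabs_cint_bound.
- exact: cintegrable_cmeas (seg_cintegrable a b cu).
- exact: rintegrableZ (rintegrable_indic a b).
- move=> x; rewrite cabsM cabs_real indicE mem_setE in_itv/= mulrC.
  have [xab|_] := boolP (_ && _); last by rewrite normr0 !mulr0.
  by rewrite normr1 !mulr1 uM.
Qed.

Lemma seg_cst a b (c : C) : a <= b -> seg a b (fun=> c) = c * (b - a)%:C.
Proof.
move=> ab; rewrite /seg -Rintegral_indic// -cint_real -cintZ; last first.
  have /rintegrable_meas mi := rintegrable_indic a b.
  by apply: (cintegrable_le (cmeas_real mi) (rintegrable_indic a b)) => x;
    rewrite cabs_real ger0_norm// indicE.
by under eq_fun do rewrite mulrC.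
Qed.

Lemma rcont_id : rcont (fun x : R => x%:C).
Proof. by split => x /=; [exact: cvg_id|exact: cvg_cst]. Qed.

Lemma rcont_cst (c : C) : rcont (fun _ : R => c).
Proof. by split => x /=; exact: cvg_cst. Qed.

Lemma rcontZ (c : C) : rcont (fun x : R => c * x%:C).
Proof.
split => x /=.
- rewrite /continuous_at ReM/= mulr0 subr0; under eq_fun do rewrite ReM/= mulr0 subr0.
  by apply: cvgM; [exact: cvg_cst|exact: cvg_id].
- rewrite /continuous_at ImM/= mulr0 add0r; under eq_fun do rewrite ImM/= mulr0 add0r.
  by apply: cvgM; [exact: cvg_cst|exact: cvg_id].
Qed.

Lemma seg_id a b : a <= b -> seg a b (fun x => x%:C) = ((b ^+ 2 - a ^+ 2) / 2)%:C.
Proof.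
move=> ab; rewrite /seg; under eq_fun do rewrite -real_complexM.
rewrite cint_real; congr (_%:C).
have -> : \int[mu]_x (\1_`[a, b] x * x) = \int[mu]_(x in `[a, b]) x.
  rewrite [RHS]Rintegral_mkcond; apply: eq_Rintegral => x _.
  by rewrite patchE indicE; case: ifP; rewrite ?mul1r ?mul0r.
move: ab; rewrite le_eqVlt => /predU1P[<-|ab].
  by rewrite set_itv1 Rintegral_set1 subrr mul0r.
rewrite /Rintegral (@continuous_FTC2 _ (fun x : R => x) (fun x : R => x ^+ 2 / 2) a b ab).
- by rewrite /= mulrBl.
- by apply: continuous_subspaceT => x; exact: cvg_id.
- have H (x : R) : derivable (fun x : R => x ^+ 2 / 2 : R) x 1 by exact: ex_derive.
  have cH (x : R) : {for x, continuous (fun x : R => x ^+ 2 / 2 : R)}.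
    by apply: differentiable_continuous; exact/derivable1_diffP.
  split => //; first exact: cvg_at_right_filter (cH a).
  exact: cvg_at_left_filter (cH b).
- move=> x _; rewrite derive1E.
  rewrite (@derive_val _ _ _ _ _ _ _ (_ : is_derive x 1 (fun x : R => x ^+ 2 / 2 : R) _)).
  by rewrite /GRing.scale/=; field; rewrite ?pnatr_eq0.
Qed.

(** The contour integral along the boundary, counterclockwise: bottom and right side minus top and
    left side, with dz = i dy on the vertical sides. *)
Definition rect_int h (x1 x2 y1 y2 : R) :=
  (seg x1 x2 (fun x => h (x +i* y1)) + 'i%C * seg y1 y2 (fun y => h (x2 +i* y)))
  - (seg x1 x2 (fun x => h (x +i* y2)) + 'i%C * seg y1 y2 (fun y => h (x1 +i* y))).

Lemma entire_rcont_h h y : entire h -> rcont (fun x => h (x +i* y)).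
Proof.
move=> eh; have := entire_rcont (0 +i* y) 1 eh.
rewrite (_ : (fun x => h (0 +i* y + _)) = (fun x => h (x +i* y)))//.
by apply/funext => x; congr h; apply: complex_ext; rewrite !ReImE/=; ring.
Qed.

Lemma entire_rcont_v h x : entire h -> rcont (fun y => h (x +i* y)).
Proof.
move=> eh; have := entire_rcont (x +i* 0) 'i%C eh.
rewrite (_ : (fun y => h (x +i* 0 + _)) = (fun y => h (x +i* y)))//.
by apply/funext => y; congr h; apply: complex_ext; rewrite !ReImE/=; ring.
Qed.

Lemma rect_intD f g x1 x2 y1 y2 : entire f -> entire g ->
  rect_int (fun z => f z + g z) x1 x2 y1 y2 = rect_int f x1 x2 y1 y2 + rect_int g x1 x2 y1 y2.
Proof.
move=> ef eg; rewrite /rect_int !segD; try exact: entire_rcont_h; try exact: entire_rcont_v.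
repeat match goal with |- context [seg ?a ?b ?u] => move: (seg a b u) => ? end; ring.
Qed.

Lemma rect_int_split h x1 x2 x3 y1 y2 y3 : entire h ->
  x1 <= x2 -> x2 <= x3 -> y1 <= y2 -> y2 <= y3 ->
  rect_int h x1 x3 y1 y3 = rect_int h x1 x2 y1 y2 + rect_int h x2 x3 y1 y2 +
    rect_int h x1 x2 y2 y3 + rect_int h x2 x3 y2 y3.
Proof.
move=> eh x12 x23 y12 y23; rewrite /rect_int.
have ch y := entire_rcont_h y eh; have cv x := entire_rcont_v x eh.
rewrite (seg_split (ch y1) x12 x23) (seg_split (ch y3) x12 x23).
rewrite (seg_split (cv x1) y12 y23) (seg_split (cv x3) y12 y23).
repeat match goal with |- context [seg ?a ?b ?u] => move: (seg a b u) => ? end; ring.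
Qed.

(** The case of Cauchy's theorem that is evaluated explicitly, from the integrals of 1 and of x;
    Goursat's argument reduces every entire function to its affine part. *)
Lemma rect_int_affine (p l : C) x1 x2 y1 y2 : x1 <= x2 -> y1 <= y2 ->
  rect_int (fun z => p + l * z) x1 x2 y1 y2 = 0.
Proof.
move=> x12 y12.
have H y : seg x1 x2 (fun x => p + l * (x +i* y)) =
    (p + l * (0 +i* y)) * (x2 - x1)%:C + l * ((x2 ^+ 2 - x1 ^+ 2) / 2)%:C.
  rewrite -seg_cst// -seg_id// -segZ; last exact: rcont_id.
  rewrite -segD; [|exact: rcont_cst|]; last first.
    exact: rcontZ.
  congr (seg _ _ _); apply/funext => x.
  by rewrite -addrA -mulrDr; congr (_ + _ * _); apply: complex_ext; rewrite !ReImE/=; ring.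
have V x : seg y1 y2 (fun y => p + l * (x +i* y)) =
    (p + l * x%:C) * (y2 - y1)%:C + l * 'i%C * ((y2 ^+ 2 - y1 ^+ 2) / 2)%:C.
  rewrite -seg_cst// -seg_id// -segZ; last exact: rcont_id.
  rewrite -segD; [|exact: rcont_cst|]; last first.
    exact: rcontZ.
  congr (seg _ _ _); apply/funext => y.
  by rewrite -addrA -mulrA -mulrDr; congr (_ + _ * _); apply: complex_ext; rewrite !ReImE/=; ring.
rewrite /rect_int !H !V; apply: complex_ext; rewrite !ReImE/=; ring.
Qed.

Lemma rect_int_bound h x1 x2 y1 y2 (M : R) : entire h -> x1 <= x2 -> y1 <= y2 ->
  (forall x y, x1 <= x <= x2 -> y1 <= y <= y2 -> cabs (h (x +i* y)) <= M) ->
  cabs (rect_int h x1 x2 y1 y2) <= 2 * M * ((x2 - x1) + (y2 - y1)).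
Proof.
move=> eh x12 y12 hM.
have H y : y1 <= y <= y2 -> cabs (seg x1 x2 (fun x => h (x +i* y))) <= M * (x2 - x1).
  by move=> yy; apply: seg_bound => // [|x xx]; [exact: entire_rcont_h|exact: hM].
have V x : x1 <= x <= x2 -> cabs ('i%C * seg y1 y2 (fun y => h (x +i* y))) <= M * (y2 - y1).
  move=> xx; rewrite cabsM cabs_i mul1r.
  by apply: seg_bound => // [|y yy]; [exact: entire_rcont_v|exact: hM].
rewrite /rect_int (le_trans (le_cabsD _ _))// cabsN.
have := le_cabsD (seg x1 x2 (fun x => h (x +i* y1))) ('i%C * seg y1 y2 (fun y => h (x2 +i* y))).
have := le_cabsD (seg x1 x2 (fun x => h (x +i* y2))) ('i%C * seg y1 y2 (fun y => h (x1 +i* y))).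
have := H y1; have := H y2; have := V x1; have := V x2.
rewrite !lexx x12 y12/= => /(_ isT) ? /(_ isT) ? /(_ isT) ? /(_ isT) ?.
lra.
Qed.

Lemma rect_intE h x1 x2 y1 y2 : rect_int h x1 x2 y1 y2 =
  (seg x1 x2 (fun x => h (x +i* y1)) + 'i%C * seg y1 y2 (fun y => h (x2 +i* y)))
  - (seg x1 x2 (fun x => h (x +i* y2)) + 'i%C * seg y1 y2 (fun y => h (x1 +i* y))).
Proof. by []. Qed.

Opaque rect_int seg entire.

Lemma normrB_itv (c w x y : R) : c <= x -> x <= c + w -> c <= y -> y <= c + w -> `|x - y| <= w.
Proof. by move=> *; rewrite ler_norml; apply/andP; split; lra. Qed.

(** Separated from the rectangle integrals so that the linear arithmetic runs on plain reals: four
    quarters each below r / 4 cannot add up to r, even through the chain of triangle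
    inequalities. *)
Lemma pigeonhole4 (r a b c d t1 t2 : R) : 4 * a < r -> 4 * b < r -> 4 * c < r -> 4 * d < r ->
  t1 <= a + b -> t2 <= t1 + c -> r <= t2 + d -> False.
Proof. by lra. Qed.

Section Goursat.
Variables (h : C -> C) (x0 y0 W H : R).
Hypotheses (eh : entire h) (W0 : 0 <= W) (H0 : 0 <= H).

Let half n : R := 2^-1 ^+ n.
Let rect n (p : R * R) :=
  rect_int h p.1 (p.1 + W * half n) p.2 (p.2 + H * half n).
Let quarters n (p : R * R) : seq (R * R) :=
  [:: p; (p.1 + W * half n.+1, p.2); (p.1, p.2 + H * half n.+1);
      (p.1 + W * half n.+1, p.2 + H * half n.+1)].
(** Chooses the first quarter that retains at least a fourth of the boundary integral;
    [rect_quarters] ensures that the default value [p] of [nth] is never reached. *)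
Let step n p := nth p (quarters n p)
  (find (fun q => cabs (rect n p) <= 4 * cabs (rect n.+1 q)) (quarters n p)).
Fixpoint corner n := if n is m.+1 then step m (corner m) else (x0, y0).

Let half_ge0 n : 0 <= half n. Proof. by rewrite exprn_ge0. Qed.

Let halfS n : half n = half n.+1 + half n.+1.
Proof. by rewrite /half exprS; lra. Qed.

Let rect_quarters n p : has (fun q => cabs (rect n p) <= 4 * cabs (rect n.+1 q)) (quarters n p).
Proof.
apply/negPn/negP => /hasPn bad.
have wn : 0 <= W * half n.+1 by rewrite mulr_ge0.
have hn : 0 <= H * half n.+1 by rewrite mulr_ge0.
have e : rect n p = rect n.+1 p + rect n.+1 (p.1 + W * half n.+1, p.2) +
    rect n.+1 (p.1, p.2 + H * half n.+1) +
    rect n.+1 (p.1 + W * half n.+1, p.2 + H * half n.+1).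
  rewrite /rect/= (halfS n) !mulrDr (addrA p.1 (W * _)) (addrA p.2 (H * _)).
  by apply: rect_int_split => //; rewrite lerDl.
have b q : q \in quarters n p -> 4 * cabs (rect n.+1 q) < cabs (rect n p).
  by move=> qin; rewrite ltNge; exact: bad.
have := b p; rewrite !inE eqxx => /(_ isT) b1.
have := b (p.1 + W * half n.+1, p.2); rewrite !inE eqxx orbT => /(_ isT) b2.
have := b (p.1, p.2 + H * half n.+1); rewrite !inE eqxx !orbT => /(_ isT) b3.
have := b (p.1 + W * half n.+1, p.2 + H * half n.+1); rewrite !inE eqxx !orbT => /(_ isT) b4.
have t1 := le_cabsD (rect n.+1 p) (rect n.+1 (p.1 + W * half n.+1, p.2)).
have t2 := le_cabsD (rect n.+1 p + rect n.+1 (p.1 + W * half n.+1, p.2))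
  (rect n.+1 (p.1, p.2 + H * half n.+1)).
have t3 := le_cabsD (rect n.+1 p + rect n.+1 (p.1 + W * half n.+1, p.2) +
  rect n.+1 (p.1, p.2 + H * half n.+1)) (rect n.+1 (p.1 + W * half n.+1, p.2 + H * half n.+1)).
rewrite -e in t3; exact: pigeonhole4 b1 b2 b3 b4 t1 t2 t3.
Qed.

Let step_in n p : step n p \in quarters n p.
Proof. by apply: mem_nth; rewrite -has_find; exact: rect_quarters. Qed.

Let step_rect n p : cabs (rect n p) <= 4 * cabs (rect n.+1 (step n p)).
Proof. exact: (nth_find p (rect_quarters n p)). Qed.

Let corner_rect n : cabs (rect 0 (x0, y0)) <= 4 ^+ n * cabs (rect n (corner n)).
Proof.
elim: n => [|n IH]; first by rewrite expr0 mul1r.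
apply: (le_trans IH); rewrite exprSr -mulrA; apply: ler_wpM2l; first exact: exprn_ge0.
exact: step_rect.
Qed.

Let corner1 n : (corner n).1 <= (corner n.+1).1 <= (corner n).1 + W * half n.+1.
Proof.
have w0 : 0 <= W * half n.+1 by rewrite mulr_ge0.
have := step_in n (corner n).
rewrite -[step n (corner n)]/(corner n.+1) !inE => /or4P[] /eqP -> /=;
  by rewrite ?lexx ?lerDl ?w0.
Qed.

Let corner2 n : (corner n).2 <= (corner n.+1).2 <= (corner n).2 + H * half n.+1.
Proof.
have w0 : 0 <= H * half n.+1 by rewrite mulr_ge0.
have := step_in n (corner n).
rewrite -[step n (corner n)]/(corner n.+1) !inE => /or4P[] /eqP -> /=;
  by rewrite ?lexx ?lerDl ?w0.
Qed.

(** The left ends increase and the right ends decrease, so the limit of the left ends lies in every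
    interval. It is used separately for the two coordinates of the corners. *)
Let nested (u : nat -> R) (K : R) : (forall n, u n <= u n.+1 <= u n + K * half n.+1) ->
  0 <= K -> exists l, forall n, u n <= l <= u n + K * half n.
Proof.
move=> uK K0.
have nd : {homo u : n m / (n <= m)%N >-> n <= m}.
  by apply/nondecreasing_seqP => n; have /andP[] := uK n.
have ni : {homo (fun n => u n + K * half n) : n m / (n <= m)%N >-> m <= n}.
  apply/nonincreasing_seqP => n; have /andP[_ h1] := uK n.
  by rewrite (halfS n) mulrDr addrA lerD2r.
have ub n m : u m <= u n + K * half n.
  have [nm|mn] := leqP n m.
    by rewrite (le_trans _ (ni _ _ nm))// lerDl mulr_ge0.
  by rewrite (le_trans (nd _ _ (ltnW mn)))// lerDl mulr_ge0.
have cu : cvgn u.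
  by apply: nondecreasing_is_cvgn => //; exists (u 0%N + K * half 0) => _ [m _ <-].
exists (limn u) => n; rewrite nondecreasing_cvgn_le//=.
by apply: limr_le => //; exact: nearW.
Qed.

(** Subtracting the tangent affine map at the limit point of the bisection leaves the boundary
    integrals unchanged. The remainder is small compared with the diameter and the perimeter is
    another multiple of the diameter; the resulting factor 4^-n cancels the 4^n of [corner_rect]. *)
Lemma rect_int_eq0 : rect_int h x0 (x0 + W) y0 (y0 + H) = 0.
Proof.
have [X XP] := nested corner1 W0; have [Y YP] := nested corner2 H0.
have [l hl] := derivable_cderiv (@eh (X +i* Y)).
apply: cabs0_eq0; apply/eqP; rewrite eq_le cabs_ge0 andbT; apply/ler_addgt0Pl => e e0.
(* The final estimate is e times 2 (W + H)^2 / K; the added 1 keeps K positive for a degenerate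
   rectangle. *)
pose K := 2 * (W + H) ^+ 2 + 1.
have K0 : 0 < K by rewrite ltr_wpDl// mulr_ge0// sqr_ge0.
have [d d0 Hd] := hl (e / K) (divr_gt0 e0 K0).
have [n nd] : exists n, (W + H) * half n < d.
  have c : (W + H) * half n @[n --> \oo] --> ((W + H) * 0 : R).
    apply: cvgM; first exact: cvg_cst.
    by apply: cvg_expr; rewrite ger0_norm// invf_lt1// ltr1n.
  rewrite mulr0 in c; move/cvgrPdist_lt : c => /(_ _ d0)[n _ hn].
  exists n; have := hn n (leqnn n); rewrite sub0r normrN ger0_norm//.
  by rewrite mulr_ge0// addr_ge0.
have := corner_rect n; rewrite {1}/rect /half expr0 !mulr1 => hr.
rewrite (le_trans hr)//.
pose rho z := h z - (h (X +i* Y) - l * (X +i* Y) + l * z).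
have erho : entire rho.
  apply: entireB; first exact: eh.
  apply: entireD; [exact: entire_cst|apply: entireM; [exact: entire_cst|exact: entire_id]].
have wn : 0 <= W * half n by rewrite mulr_ge0.
have hn : 0 <= H * half n by rewrite mulr_ge0.
have -> : rect n (corner n) = rect_int rho (corner n).1 ((corner n).1 + W * half n)
    (corner n).2 ((corner n).2 + H * half n).
  rewrite /rect [X in rect_int X](_ : h =
      (fun z => rho z + (h (X +i* Y) - l * (X +i* Y) + l * z))); last first.
    by apply/funext => z; rewrite subrK.
  rewrite rect_intD; [by rewrite rect_int_affine ?addr0 ?lerDl|exact: erho|].
  apply: entireD; [exact: entire_cst|apply: entireM; [exact: entire_cst|exact: entire_id]].
have D0 : 0 <= (W + H) * half n by rewrite mulr_ge0// addr_ge0.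
have b := @rect_int_bound rho (corner n).1 ((corner n).1 + W * half n)
    (corner n).2 ((corner n).2 + H * half n) (e / K * ((W + H) * half n)) erho.
apply: le_trans (ler_wpM2l _ (b _ _ _)) _; rewrite ?exprn_ge0 ?lerDl//.
- move=> x y /andP[x1 x2] /andP[y1 y2].
  have /andP[X1 X2] := XP n; have /andP[Y1 Y2] := YP n.
  have dl : cabs ((x - X) +i* (y - Y)) <= (W + H) * half n.
    apply: (le_trans (cabs_le_ReIm _)); rewrite /= mulrDl; apply: lerD.
      exact: normrB_itv x1 x2 X1 X2.
    exact: normrB_itv y1 y2 Y1 Y2.
  have -> : rho (x +i* y) = h ((X +i* Y) + ((x - X) +i* (y - Y))) - h (X +i* Y) -
      l * ((x - X) +i* (y - Y)).
    have -> : (X +i* Y) + ((x - X) +i* (y - Y)) = x +i* y.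
      by apply: complex_ext; rewrite !ReImE/=; ring.
    have -> : (x - X) +i* (y - Y) = (x +i* y) - (X +i* Y) by [].
    by rewrite /rho; ring.
  rewrite (le_trans (Hd _ (le_lt_trans dl nd)))// ler_wpM2l// divr_ge0 ?ltW//.
rewrite addr0 ![_ + _ - _]addrAC !subrr !add0r -mulrDl.
have -> : 4 ^+ n * (2 * (e / K * ((W + H) * half n)) * ((W + H) * half n)) =
    e * (2 * (W + H) ^+ 2 / K) * (4 ^+ n * (half n) ^+ 2).
  by rewrite !expr2; field; rewrite gt_eqF.
have -> : 4 ^+ n * (half n) ^+ 2 = 1.
  rewrite /half -exprM mulnC exprM -exprMn (_ : 4 * _ = 1) ?expr1n//.
  by rewrite expr2; field; rewrite ?pnatr_eq0.
rewrite mulr1 ler_piMr ?(ltW e0)// ler_pdivrMr// mul1r /K lerDl//.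
Qed.

End Goursat.

End rectangles.

Lemma ler_sqr_norm (K : realDomainType) (x y : K) : `|x| <= `|y| -> x ^+ 2 <= y ^+ 2.
Proof.
by move=> xy; rewrite -real_normK ?num_real// -(real_normK (num_real y)) ler_pXn2r ?nnegrE.
Qed.

(** * Contour shifts and Gaussian integrals with a complex linear term *)

Section gaussian_integrals.
Context {R : realType}.
Local Notation C := R[i].
Local Notation mu := (@lebesgue_measure R).
Local Notation cint := (cintegral setT).
Local Notation rintegrable h := (mu.-integrable setT (fun x => (h x)%:E)).

Lemma gauss_integral (c m : R) : 0 < c ->
  rintegrable (fun x => expR (- (c * (x - m) ^+ 2))) /\
  \int[mu]_x expR (- (c * (x - m) ^+ 2)) = Num.sqrt (pi / c).
Proof.
(* The standard deviation of the normal law whose density is proportional to this Gaussian; the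
   integral is then read off from the total mass of [normal_pdf]. *)
move=> c0; pose s : R := Num.sqrt (2 * c)^-1.
have s2 : s ^+ 2 = (2 * c)^-1 by rewrite sqr_sqrtr// invr_ge0 mulr_ge0// ltW.
have s0 : s != 0 by rewrite gt_eqF// sqrtr_gt0 invr_gt0 mulr_gt0.
have e x : expR (- (c * (x - m) ^+ 2)) = Num.sqrt (pi / c) * normal_pdf m s x.
  rewrite normal_pdfE// /normal_peak /normal_fun s2.
  have -> : (2 * c)^-1 * pi *+ 2 = pi / c.
    by rewrite -mulr_natr; field; rewrite gt_eqF.
  have p0 : 0 < Num.sqrt (pi / c) by rewrite sqrtr_gt0 divr_gt0// pi_gt0.
  rewrite mulVKf ?gt_eqF//; congr expR.
  by rewrite -mulr_natr; field; rewrite gt_eqF.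
have i := integrable_normal_pdf m s; split.
  under eq_fun do rewrite e; exact: rintegrableZ.
under eq_Rintegral do rewrite e.
by rewrite RintegralZl// /Rintegral integral_normal_pdf mulr1.
Qed.

Lemma gauss_integral0 (c : R) : 0 < c -> rintegrable (fun x => expR (- (c * x ^+ 2))).
Proof.
by move=> c0; have [+ _] := @gauss_integral c 0 c0; under eq_fun do rewrite subr0.
Qed.

Lemma cvg_gauss_seq (c : R) : 0 < c -> expR (- (c * n%:R ^+ 2)) @[n --> \oo] --> (0 : R).
Proof.
move=> c0; apply: (@squeeze_cvgr _ _ _ _ (cst 0) (fun n => expR (- c) ^+ n)).
- apply: nearW => n; rewrite expR_ge0/= -expRM_natr ler_expR mulNr lerN2 ler_pM2l//.
  by rewrite -natrX ler_nat; case: n => // n; rewrite expnS expn1 leq_pmulr.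
- exact: cvg_cst.
- by apply: cvg_expr; rewrite ger0_norm ?expR_ge0// expR_lt1 oppr_lt0.
Qed.

Lemma segE (a b : R) (u : R -> C) : seg a b u = cint (fun x => (\1_`[a, b] x)%:C * u x).
Proof. by []. Qed.

Lemma seg_cvg (u : R -> C) (g' : R -> R) : rcont u -> rintegrable g' ->
  (forall x, cabs (u x) <= g' x) -> ccvg (fun n : nat => seg (- n%:R) n%:R u) (cint u).
Proof.
move=> cu ig ug; apply: (cint_dct _ _ _ ig).
- by move=> n; exact: cintegrable_cmeas (seg_cintegrable _ _ cu).
- exact: rcont_cmeas.
- apply: aeW => x; rewrite /ccvg; apply: cvg_near_cst; near=> n.
  have xn : `|x| <= n%:R by near: n; exact: nbhs_infty_ger.
  by rewrite indicE mem_setE in_itv/= -ler_norml xn mul1r subrr cabs0.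
- move=> n x; rewrite cabsM cabs_real indicE.
  by case: (_ \in _); rewrite ?normr1 ?mul1r// normr0 mul0r (le_trans _ (ug x))// cabs_ge0.
Unshelve. all: by end_near. Qed.

(** The boundary integral of the rectangle of half-width n between the two heights vanishes by
    Goursat, and the Gaussian bound makes its two vertical sides tend to 0. *)
Lemma contour_shift (h : C -> C) (Y M c : R) : entire h -> 0 < c ->
  (forall x y, `|y| <= `|Y| -> cabs (h (x +i* y)) <= M * expR (- (c * x ^+ 2))) ->
  cint (fun x => h x%:C) = cint (fun x => h (x +i* Y)).
Proof.
move=> eh c0.
(* Goursat is available for ordered heights; a negative [Y] is then handled by exchanging the two
   lines. *)
have ord y1 y2 : y1 <= y2 ->
    (forall x y, y1 <= y <= y2 -> cabs (h (x +i* y)) <= M * expR (- (c * x ^+ 2))) ->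
    cint (fun x => h (x +i* y1)) = cint (fun x => h (x +i* y2)).
  move=> y12 hM.
  have ig := rintegrableZ M (gauss_integral0 c0).
  have h1 : ccvg (fun n : nat => seg (- n%:R) n%:R (fun x => h (x +i* y1)))
      (cint (fun x => h (x +i* y1))).
    apply: (seg_cvg (entire_rcont_h y1 eh) ig) => x; apply: hM; by rewrite lexx.
  have h2 : ccvg (fun n : nat => seg (- n%:R) n%:R (fun x => h (x +i* y2)))
      (cint (fun x => h (x +i* y2))).
    apply: (seg_cvg (entire_rcont_h y2 eh) ig) => x; apply: hM; by rewrite lexx andbT.
  have h3 : ccvg (fun n : nat => seg (- n%:R) n%:R (fun x => h (x +i* y1)) -
      seg (- n%:R) n%:R (fun x => h (x +i* y2))) 0.
    have c3 : 2 * M * (y2 - y1) * expR (- (c * n%:R ^+ 2)) @[n --> \oo] -->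
        (2 * M * (y2 - y1) * 0 : R) by apply: cvgM; [exact: cvg_cst|exact: cvg_gauss_seq].
    rewrite mulr0 in c3; apply: (ccvg_le c3) => n; rewrite subr0.
    have V x : x ^+ 2 = n%:R ^+ 2 -> cabs (seg y1 y2 (fun y => h (x +i* y))) <=
        M * expR (- (c * n%:R ^+ 2)) * (y2 - y1).
      move=> xn; apply: seg_bound => //; first exact: entire_rcont_v.
      by move=> y yy; rewrite -xn hM.
    have := @rect_int_eq0 _ h (- n%:R) y1 (2 * n%:R) (y2 - y1) eh.
    rewrite mulr_ge0// subr_ge0 => /(_ isT y12).
    have -> : - n%:R + 2 * n%:R = n%:R :> R by ring.
    rewrite addrC subrK => r0.
    have -> : seg (- n%:R) n%:R (fun x => h (x +i* y1)) -
        seg (- n%:R) n%:R (fun x => h (x +i* y2)) =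
        'i%C * (seg y1 y2 (fun y => h (- n%:R +i* y)) - seg y1 y2 (fun y => h (n%:R +i* y))).
      move: r0; rewrite rect_intE => /eqP.
      rewrite subr_eq0 => /eqP r0; rewrite mulrBr; apply/eqP.
      by rewrite subr_eq addrAC -subr_eq opprK; apply/eqP; rewrite r0 addrC.
    rewrite cabsM cabs_i mul1r (le_trans (le_cabsD _ _))// cabsN.
    have := V (- n%:R); rewrite sqrrN => /(_ erefl); have := V n%:R erefl; lra.
  by apply/eqP; rewrite -subr_eq0; apply/eqP; exact: ccvg_unique (ccvgB h1 h2) h3.
move=> hM; have [Y0|Y0] := leP 0 Y.
  apply: (ord 0 Y Y0) => x y /andP[y0 yY]; apply: hM.
  by rewrite !ger0_norm.
apply/esym; apply: (ord Y 0 (ltW Y0)) => x y /andP[y0 yY]; apply: hM.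
by rewrite (ltr0_norm Y0) ler0_norm// lerN2.
Qed.

Lemma gauss_shift_le (c m x : R) : 0 < c ->
  expR (- (c * (x - m) ^+ 2)) <= expR (c * m ^+ 2) * expR (- (c / 2 * x ^+ 2)).
Proof.
move=> c0; rewrite -expRD ler_expR.
have : 0 <= c / 2 * (x - 2 * m) ^+ 2 by rewrite mulr_ge0 ?sqr_ge0// divr_ge0// ltW.
by rewrite !expr2; lra.
Qed.

(** Completing the square gives a Gaussian centred at the complex point b / (2 d) = m + i q. The
    shift by the height q is undone by moving the contour, which leaves the real Gaussian centred at
    m. *)
Lemma cgauss_integral (d : R) (b : C) : 0 < d ->
  cintegrable (fun x => cexp (b * x%:C - (d * x ^+ 2)%:C)) /\
  cint (fun x => cexp (b * x%:C - (d * x ^+ 2)%:C)) =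
  (Num.sqrt (pi / d))%:C * cexp (b * b * ((4 * d)^-1)%:C).
Proof.
move=> d0; pose m := Re b / (2 * d); pose q := Im b / (2 * d).
pose h (z : C) := cexp (- d%:C * ((z - m%:C) * (z - m%:C))).
have eh : entire h.
  apply: (entire_comp (@entire_cexp R)); apply: entireM; first exact: entire_cst.
  by apply: entireM; apply: entireB; [exact: entire_id|exact: entire_cst|
    exact: entire_id|exact: entire_cst].
have hE x : h (x +i* - q) = cexp (- (b * b * ((4 * d)^-1)%:C)) * cexp (b * x%:C - (d * x ^+ 2)%:C).
  rewrite -cexpD /h; congr cexp; apply: complex_ext; rewrite !ReImE/= /m /q;
    by case: b {m q h eh} => b1 b2 /=; field; rewrite gt_eqF.
have habs x y : cabs (h (x +i* y)) = expR (- (d * (x - m) ^+ 2)) * expR (d * y ^+ 2).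
  rewrite cabs_cexp -expRD; congr expR; rewrite !ReImE/=; ring.
have := @contour_shift h (- q) (expR (d * q ^+ 2) * expR (d * m ^+ 2)) (d / 2) eh.
rewrite divr_gt0// => /(_ isT) H.
have [gi gE] := gauss_integral m d0.
have h0 : cint (fun x => h x%:C) = (Num.sqrt (pi / d))%:C.
  rewrite -gE -cint_real; congr (cintegral _ _); apply/funext => x.
  rewrite -cexp_real /h; congr cexp; apply: complex_ext; rewrite !ReImE/=; ring.
have ih : cintegrable (fun x => h (x +i* - q)).
  apply: (cintegrable_le _ (rintegrableZ (expR (d * q ^+ 2)) gi)).
    by apply: rcont_cmeas; exact: entire_rcont_h.
  by move=> x; rewrite habs sqrrN mulrC.
have E x : cexp (b * x%:C - (d * x ^+ 2)%:C) = cexp (b * b * ((4 * d)^-1)%:C) * h (x +i* - q).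
  by rewrite hE mulrA -cexpD subrr cexp0 mul1r.
split; first by under eq_fun do rewrite E; exact: cintegrableZ.
under eq_fun do rewrite E.
rewrite cintZ// mulrC -h0 H// => x y yq.
rewrite habs mulrC -!mulrA ler_pM ?expR_ge0 ?mulr_ge0 ?expR_ge0//.
  by rewrite ler_expR ler_pM2l//; apply: ler_sqr_norm; rewrite -(normrN q).
by rewrite mulrA; exact: gauss_shift_le.
Qed.

End gaussian_integrals.

(** * Gaussian approximate identities and the Plancherel theorem *)

Section gauss_kernel.
Context {R : realType}.
Local Notation C := R[i].
Local Notation mu := (@lebesgue_measure R).
Local Notation cint := (cintegral setT).
Local Notation rintegrable h := (mu.-integrable setT (fun x => (h x)%:E)).

(** An approximate identity of total mass 1. Convolution with it is what multiplication by [damp n]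
    becomes under the Fourier transform, see [fourier_damp]. *)
Definition gk (n : nat) (u : R) : R :=
  Num.sqrt (n.+1%:R / pi) * expR (- (n.+1%:R * u ^+ 2)).

Lemma gk_ge0 n u : 0 <= gk n u. Proof. by rewrite mulr_ge0// expR_ge0. Qed.

Lemma gkBC n x y : gk n (x - y) = gk n (y - x).
Proof. by rewrite /gk -sqrrN opprB. Qed.

Lemma gk_integral n m : rintegrable (fun x => gk n (x - m)) /\ \int[mu]_x gk n (x - m) = 1.
Proof.
have n0 : (0 : R) < n.+1%:R by [].
have [i e] := gauss_integral m n0.
split; first exact: rintegrableZ.
rewrite RintegralZl// e -sqrtrM ?divr_ge0 ?pi_ge0//.
by rewrite mulrA divfK ?gt_eqF ?pi_gt0// divff ?gt_eqF// sqrtr1.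
Qed.

Lemma gk_integralC n m : rintegrable (fun x => gk n (m - x)) /\ \int[mu]_x gk n (m - x) = 1.
Proof.
rewrite (_ : (fun x => gk n (m - x)) = (fun x => gk n (x - m))).
  exact: gk_integral.
by apply/funext => x; rewrite gkBC.
Qed.

Lemma measurable_gk n : measurable_fun setT (gk n).
Proof.
by have [/rintegrable_meas + _] := gk_integral n 0; under eq_fun do rewrite subr0.
Qed.

Lemma sqrt_peak_le n : Num.sqrt (n.+1%:R / pi) <= n.+1%:R :> R.
Proof.
have n1 : (1 : R) <= n.+1%:R by rewrite ler1n.
have p1 : 1 <= pi :> R by rewrite (le_trans _ (pi_ge2 _))// ler1n.
rewrite -[leRHS]ger0_norm// -sqrtr_sqr ler_wsqrtr// expr2 ler_pdivrMr ?pi_gt0//.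
by rewrite -mulrA ler_peMr// mulr_ege1.
Qed.

Lemma gk_le n u : gk n u <= n.+1%:R.
Proof.
rewrite -[leRHS]mulr1 ler_pM ?expR_ge0 ?sqrt_peak_le//.
by rewrite expR_le1 oppr_le0 mulr_ge0// sqr_ge0.
Qed.

Lemma cabs_gk_le n u : cabs (gk n u)%:C <= n.+1%:R.
Proof. by rewrite cabs_real ger0_norm ?gk_ge0// gk_le. Qed.

Lemma indic_ge0 (A : set R) (x : R) : 0 <= \1_A x :> R.
Proof. by rewrite indicE. Qed.

Lemma cabs_indic_gk_le n (A : set R) (x u : R) (z : C) :
  cabs ((\1_A x)%:C * (z * (gk n u)%:C)) <= \1_A x * (n.+1%:R * cabs z).
Proof.
have := indic_ge0 A x; move: (\1_A x) => i i0.
rewrite cabsM cabs_real (ger0_norm i0) cabsM.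
apply: ler_wpM2l i0 _ _ _; rewrite [leRHS]mulrC.
exact: ler_wpM2l (cabs_ge0 z) _ _ (cabs_gk_le n u).
Qed.

Lemma expRN_le1 (x : R) : 0 <= x -> x * expR (- x) <= 1.
Proof.
move=> x0; have h : x <= expR x by rewrite (le_trans _ (expR_ge1Dx x))// lerDr.
by rewrite expRN ler_pdivrMr ?expR_gt0// mul1r.
Qed.

Lemma expRN_le2 (x : R) : 0 <= x -> x ^+ 2 * expR (- x) <= 4.
Proof.
move=> x0; have h := expRN_le1 (divr_ge0 x0 (ler0n R 2)).
have h0 : 0 <= x / 2 * expR (- (x / 2)) by rewrite mulr_ge0 ?expR_ge0// divr_ge0.
have : (x / 2 * expR (- (x / 2))) ^+ 2 <= 1 by rewrite expr_le1.
rewrite exprMn expr_div_n -expRM_natr (_ : - (x / 2) * 2 = - x); last by field.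
by rewrite -natrX mulrAC ler_pdivrMr// mul1r.
Qed.

Lemma gk_le_inv2 n u : u ^+ 2 * gk n u <= 1.
Proof.
have := expRN_le1 (mulr_ge0 (ler0n R n.+1) (sqr_ge0 u)).
rewrite /gk; apply: le_trans; rewrite mulrCA mulrA ler_wpM2r ?expR_ge0//.
by rewrite ler_wpM2r ?sqr_ge0 ?sqrt_peak_le.
Qed.

(** This is x^2 exp (-x) <= 4 at x = (n + 1) u^2. In contrast to the bound for the second power it
    tends to 0 with n, which [gk_tail_cvg] and [gconv_far] rely on. *)
Lemma gk_le_inv4 n u : u ^+ 4 * gk n u <= 4 / n.+1%:R.
Proof.
rewrite ler_pdivlMr//.
have := expRN_le2 (mulr_ge0 (ler0n R n.+1) (sqr_ge0 u)).
apply: le_trans; rewrite /gk exprMn -exprM mulrAC [leLHS]mulrA ler_wpM2r ?expR_ge0//.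
rewrite -mulrA [leRHS]mulrC ler_wpM2l ?exprn_even_ge0//.
by rewrite expr2 ler_wpM2l// sqrt_peak_le.
Qed.

Lemma gk_tail_cvg (d : R) : 0 < d -> gk n d @[n --> \oo] --> (0 : R).
Proof.
move=> d0; have d4 : 0 < d ^+ 4 by rewrite exprn_gt0.
have h : 4 / d ^+ 4 * harmonic n @[n --> \oo] --> (4 / d ^+ 4 * 0 : R).
  by apply: cvgM; [exact: cvg_cst|exact: cvg_harmonic].
rewrite mulr0 in h; apply: (@squeeze_cvgr _ _ _ _ (cst 0) (fun n => 4 / d ^+ 4 * harmonic n)) => //.
  apply: nearW => n; rewrite gk_ge0/= mulrAC ler_pdivlMr// mulrC.
  exact: gk_le_inv4.
exact: cvg_cst.
Qed.

(* Away from x0 the kernel is at most (its value at distance d, rescaled) times a fixed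
   Gaussian, which absorbs the exponential growth of k. *)
Lemma gk_split n d A u : 0 < d -> d <= `|u| ->
  expR (A * `|u|) * gk n u <= gk n d * expR (d ^+ 2 + A ^+ 2) * expR (- (2^-1 * u ^+ 2)).
Proof.
move=> d0 du; rewrite /gk mulrCA -!mulrA ler_wpM2l// -!expRD ler_expR.
have u2 : d ^+ 2 <= u ^+ 2 by apply: ler_sqr_norm; rewrite ger0_norm// ltW.
have n1 : (1 : R) <= n.+1%:R by rewrite ler1n.
have : 0 <= (`|u| / 2 - A) ^+ 2 by exact: sqr_ge0.
have -> : (`|u| / 2 - A) ^+ 2 = u ^+ 2 / 4 - A * `|u| + A ^+ 2.
  by rewrite -[u ^+ 2]real_normK ?num_real//; field.
have : 0 <= (n.+1%:R - 1) * (u ^+ 2 - d ^+ 2) by rewrite mulr_ge0// subr_ge0.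
have : 0 <= u ^+ 2 by exact: sqr_ge0.
nra.
Qed.

Lemma gk_approx (k : R -> C) (x0 A B : R) : cmeas k -> 0 <= B ->
  (forall x, cabs (k x) <= B * expR (A * `|x - x0|)) -> 0 <= A ->
  (forall e : R, 0 < e -> exists2 d : R, 0 < d &
     forall x, `|x - x0| < d -> cabs (k x - k x0) < e) ->
  (forall n, cintegrable (fun x => k x * (gk n (x - x0))%:C)) ->
  ccvg (fun n => cint (fun x => k x * (gk n (x - x0))%:C)) (k x0).
Proof.
move=> mk B0 kB A0 ck ik.
pose B2 := B + cabs (k x0).
have dB x : cabs (k x - k x0) <= B2 * expR (A * `|x - x0|).
  rewrite (le_trans (le_cabsD _ _))// cabsN mulrDl lerD// ler_peMr ?cabs_ge0//.
  by rewrite expR_ge1r// mulr_ge0.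
have B20 : 0 <= B2 by rewrite addr_ge0 ?cabs_ge0.
have E n : cint (fun x => k x * (gk n (x - x0))%:C) - k x0 =
    cint (fun x => (k x - k x0) * (gk n (x - x0))%:C).
  have [gi g1] := gk_integral n x0.
  have ci : cintegrable (fun x => (gk n (x - x0))%:C).
    apply: (cintegrable_le (cmeas_real (rintegrable_meas gi)) gi) => x.
    by rewrite cabs_real ger0_norm// gk_ge0.
  under [in RHS]eq_fun do rewrite mulrBl.
  rewrite cintB//; last exact: cintegrableZ.
  by rewrite cintZ// cint_real g1 mulr1.
apply/cvgrPdist_lt => e e0.
have [d d0 Hd] := ck (e / 2) (divr_gt0 e0 (ltr0Sn R 1)).
have half0 : (0 : R) < 2^-1 by rewrite invr_gt0.
have [hi hE] := gauss_integral x0 half0.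
pose S := \int[mu]_x expR (- (2^-1 * (x - x0) ^+ 2)).
have S0 : 0 <= S by rewrite /S hE.
pose K := B2 * expR (d ^+ 2 + A ^+ 2) * S.
have hc : (gk n d * K) @[n --> \oo] --> (0 * K : R).
  by apply: cvgM; [exact: gk_tail_cvg|exact: cvg_cst].
rewrite mul0r in hc; move/cvgrPdist_lt : hc => /(_ (e / 2) (divr_gt0 e0 (ltr0Sn R 1))).
apply: filterS => n; rewrite !sub0r !normrN !ger0_norm ?cabs_ge0 ?mulr_ge0 ?gk_ge0 ?expR_ge0//.
move=> hn; rewrite E.
have [gi g1] := gk_integral n x0.
(* The first summand comes from continuity within distance d and has integral e / 2. The second
   comes from [gk_split] at larger distance and has integral [gk n d * K], which tends to 0. *)
pose bnd x := e / 2 * gk n (x - x0) +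
  B2 * (gk n d * expR (d ^+ 2 + A ^+ 2)) * expR (- (2^-1 * (x - x0) ^+ 2)).
have ib : rintegrable bnd by apply: rintegrableD; exact: rintegrableZ.
apply: le_lt_trans (le_cabs_cint_bound _ ib _) _.
- apply: cmeasM; first by apply: cmeasB => //; exact: cmeas_cst.
  exact: cmeas_real (rintegrable_meas gi).
- move=> x; rewrite cabsM cabs_real ger0_norm ?gk_ge0//.
  have [xd|dx] := ltP `|x - x0| d.
    rewrite (le_trans (ler_wpM2r (gk_ge0 _ _) (ltW (Hd x xd))))// lerDl.
    by rewrite !mulr_ge0 ?gk_ge0 ?expR_ge0.
  rewrite (le_trans (ler_wpM2r (gk_ge0 _ _) (dB x)))// -mulrA.
  rewrite (le_trans (ler_wpM2l B20 (gk_split n A d0 dx)))// /bnd !mulrA lerDr.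
  by rewrite !mulr_ge0 ?gk_ge0 ?invr_ge0// ltW.
- rewrite RintegralD//; try exact: rintegrableZ.
  rewrite (RintegralZl _ measurableT gi) (RintegralZl _ measurableT hi) g1 mulr1 -/S
    [ltRHS]splitr ltrD2l.
  apply: le_lt_trans hn; rewrite /K le_eqVlt; apply/orP; left; apply/eqP; ring.
Qed.

Lemma cintegrable_gk (k : R -> C) (x0 A B : R) n : cmeas k -> 0 <= B -> 0 <= A ->
  (forall x, cabs (k x) <= B * expR (A * `|x - x0|)) ->
  cintegrable (fun x => k x * (gk n (x - x0))%:C).
Proof.
move=> mk B0 A0 kB.
have half0 : (0 : R) < 2^-1 by rewrite invr_gt0.
have [hi _] := gauss_integral x0 half0.
have [gi g1] := gk_integral n x0.
apply: (cintegrable_le _ (rintegrableZ (B * (n.+1%:R * expR (A ^+ 2))) hi)).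
  by apply: cmeasM => //; exact: cmeas_real (rintegrable_meas gi).
move=> x; rewrite cabsM cabs_real ger0_norm ?gk_ge0//.
rewrite (le_trans (ler_wpM2r (gk_ge0 _ _) (kB x)))// -!mulrA ler_wpM2l//.
rewrite mulrCA; apply: ler_pM; rewrite ?sqrt_peak_le ?mulr_ge0 ?expR_ge0//.
rewrite -!expRD ler_expR; move: (x - x0) => u.
have n1 : (1 : R) <= n.+1%:R by rewrite ler1n.
have : 0 <= (`|u| / 2 - A) ^+ 2 by exact: sqr_ge0.
have -> : (`|u| / 2 - A) ^+ 2 = u ^+ 2 / 4 - A * `|u| + A ^+ 2.
  by rewrite -[u ^+ 2]real_normK ?num_real//; field.
have : 0 <= (n.+1%:R - 1) * u ^+ 2 by rewrite mulr_ge0// ?subr_ge0// sqr_ge0.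
have : 0 <= u ^+ 2 by exact: sqr_ge0.
lra.
Qed.

(** At an endpoint of a proper interval only half of the mass falls inside in the limit, so the
    endpoints are excluded; they form a null set in the applications. *)
Lemma gk_indic (a b x : R) : x != a -> x != b ->
  ccvg (fun n => cint (fun t => (\1_`[a, b] t)%:C * (gk n (t - x))%:C)) (\1_`[a, b] x)%:C.
Proof.
move=> xa xb.
have mi := rintegrable_meas (rintegrable_indic a b).
have i1 t : cabs (\1_`[a, b] t)%:C <= 1 * expR (0 * `|t - x|) :> R.
  by rewrite cabs_real mul0r expR0 mulr1 indicE; case: (_ \in _); rewrite ?normr1 ?normr0.
have mc : cmeas (fun t => (\1_`[a, b] t)%:C : C) := cmeas_real mi.
apply: (@gk_approx (fun t => (\1_`[a, b] t)%:C) x 0 1) => //.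
- move=> e e0; exists (Num.min `|x - a| `|x - b|).
    by rewrite lt_min !normr_gt0 !subr_eq0 xa.
  move=> t; rewrite lt_min !ltr_norml => /andP[ta tb].
  suff -> : \1_`[a, b] t = \1_`[a, b] x :> R by rewrite subrr cabs0.
  rewrite !indicE !mem_setE !in_itv/=; congr ((nat_of_bool _)%:R); congr andb.
    move: ta; case: (ltP x a) => h.
      by rewrite ltr0_norm ?subr_lt0// => /andP[? ?]; apply/idP/idP; lra.
    rewrite ger0_norm ?subr_ge0// => /andP[? ?]; apply/idP/idP; lra.
  move: tb; case: (ltP b x) => h.
    rewrite gtr0_norm ?subr_gt0// => /andP[? ?]; apply/idP/idP; lra.
  rewrite ler0_norm ?subr_le0// => /andP[? ?]; apply/idP/idP; lra.
- by move=> n; apply: (cintegrable_gk _ mc _ _ i1).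
Qed.

Lemma indic_gk_le1 (a b x : R) n :
  cabs (cint (fun t => (\1_`[a, b] t)%:C * (gk n (t - x))%:C)) <= 1.
Proof.
have [gi g1] := gk_integral n x; rewrite -g1.
apply: le_cabs_cint_bound => //.
- apply: cmeasM; apply: cmeas_real; last exact: rintegrable_meas gi.
  exact: rintegrable_meas (rintegrable_indic a b).
- move=> t; rewrite cabsM !cabs_real (ger0_norm (gk_ge0 _ _)) indicE.
  by case: (_ \in _); rewrite ?normr1 ?mul1r// normr0 mul0r gk_ge0.
Qed.

(** Lebesgue differentiation: the primitive is locally constant, so its derivative, equal to [u]
    almost everywhere, vanishes. Together with Gaussian smoothing, this turns weak identities into
    pointwise ones throughout. *)
Lemma ae_eq0_of_primitive (u : R -> R) (a b : R) :
  rintegrable (fun x => \1_`[a, b] x * u x) ->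
  (forall x, a < x < b -> \int[mu]_t (\1_`[a, x] t * u t) = 0) ->
  {ae mu, forall x, a < x < b -> u x = 0}.
Proof.
move=> iu u0; pose k x := \1_`[a, b] x * u x.
have ik y : mu.-integrable [set` Interval (BLeft a) (BRight y)] (EFin \o k).
  by apply: integrableS iu => //.
have lk : locally_integrable setT k.
  by apply: open_integrable_locally => //; exact: openT.
apply: ae_mono (FTC1 ik lk) => x H /andP[ax xb].
have [_ ] : derivable (fun x => \int[mu]_(t in `[a, x]) k t) x 1 /\
    (fun x => \int[mu]_(t in `[a, x]) k t)^`()%classic x = k x by apply: H; rewrite /= lte_fin.
have -> : k x = u x by rewrite /k indicE mem_setE in_itv/= !ltW// mul1r.
move=> <-; rewrite derive1E.
have nz : \forall y \near x, \int[mu]_(t in `[a, y]) k t = cst 0 y.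
  near=> y.
  have ay : a < y by near: y; exact: lt_nbhsr.
  have yb : y < b by near: y; exact: lt_nbhsl.
  transitivity (\int[mu]_t (\1_`[a, y] t * u t)); last by rewrite u0// ay yb.
  rewrite Rintegral_mkcond; apply: eq_Rintegral => t _.
  rewrite patchE /k indicE; case: ifPn => ty.
    move: ty; rewrite mem_setE in_itv/= => /andP[a_t ty].
    by rewrite !indicE !mem_setE !in_itv/= a_t ty (le_trans ty (ltW yb)).
  by rewrite indicE (negbTE ty) mul0r.
by rewrite (@near_eq_derive R R^o R^o _ (cst 0) _ _ nz) derive_cst.
Unshelve. all: by end_near. Qed.

Lemma ae_eq0_itv (u : R -> C) (a b : R) :
  cintegrable (fun x => (\1_`[a, b] x)%:C * u x) ->
  (forall x, a < x < b -> cint (fun t => (\1_`[a, x] t)%:C * u t) = 0) ->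
  {ae mu, forall x, a < x < b -> u x = 0}.
Proof.
move=> [i1 i2] u0.
have h1 : {ae mu, forall x, a < x < b -> Re (u x) = 0}.
  apply: ae_eq0_of_primitive => [|x xab].
    by move: i1; under eq_fun do rewrite ReM/= mul0r subr0.
  transitivity (Re (cint (fun t => (\1_`[a, x] t)%:C * u t))); last by rewrite u0.
  by apply: eq_Rintegral => t _; rewrite ReM/= mul0r subr0.
have h2 : {ae mu, forall x, a < x < b -> Im (u x) = 0}.
  apply: ae_eq0_of_primitive => [|x xab].
    by move: i2; under eq_fun do rewrite ImM/= mul0r addr0.
  transitivity (Im (cint (fun t => (\1_`[a, x] t)%:C * u t))); last by rewrite u0.
  by apply: eq_Rintegral => t _; rewrite ImM/= mul0r addr0.
by apply: ae_mono (ae_and h1 h2) => x [r i] xab; apply: complex_ext; [exact: r|exact: i].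
Qed.

End gauss_kernel.

(** * The multiplication formula, Bessel's inequality and Plancherel's identity *)

Section fourier_transform.
Context {R : realType}.
Local Notation C := R[i].
Local Notation mu := (@lebesgue_measure R).
Local Notation cint := (cintegral setT).
Local Notation rintegrable h := (mu.-integrable setT (fun x => (h x)%:E)).
Local Notation L2 := (@in_Lp R 2).
Local Notation c0 := ((Num.sqrt (2 * pi : R))^-1).
Implicit Types (h k : R -> C).

Let invF := @inv_fourier R.

Lemma cabs_cis (t : R) : cabs (cexp ('i%C * t%:C)) = 1.
Proof. by rewrite cabs_cexp !ReImE/= mul0r mul1r subr0 expR0. Qed.

Lemma c0_ge0 : 0 <= c0 :> R. Proof. by rewrite invr_ge0. Qed.

Lemma c0_gt0 : 0 < c0 :> R.
Proof. by rewrite invr_gt0 sqrtr_gt0 mulr_gt0// pi_gt0. Qed.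

Lemma c0C_neq0 : c0%:C != 0 :> C.
Proof.
apply/eqP => /(congr1 (@complex.Re R)) /= /eqP; apply/negP.
exact: lt0r_neq0 c0_gt0.
Qed.

Lemma c0_sqr : c0 * c0 = (2 * pi)^-1 :> R.
Proof. by rewrite -invfM -expr2 sqr_sqrtr// mulr_ge0// pi_ge0. Qed.

Lemma c0_peak (N : R) : 0 < N -> c0 * (c0 * Num.sqrt (pi / (4 * N)^-1)) = Num.sqrt (N / pi).
Proof.
move=> N0; have p0 := pi_gt0 R.
rewrite mulrA c0_sqr -[(2 * pi)^-1]ger0_norm ?invr_ge0 ?mulr_ge0 ?(ltW p0)//.
rewrite -sqrtr_sqr -sqrtrM ?sqr_ge0// invrK; congr Num.sqrt.
by move: pi p0 => p p0; field; rewrite gt_eqF.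
Qed.

Lemma cmeas_cis (t : R) : cmeas (fun x : R => cexp ('i%C * (t * x)%:C)).
Proof.
apply: cmeas_cexp; apply: cmeasM; first exact: cmeas_cst.
by apply: cmeas_real; apply: measurable_funM => //; exact: measurable_cst.
Qed.

Lemma cintegrable_cis h (t : R) : cintegrable h ->
  cintegrable (fun x => h x * cexp ('i%C * (t * x)%:C)).
Proof. by move=> ih; apply: (cintegrableM ih (cmeas_cis t)) => x; rewrite cabs_cis. Qed.

Lemma invF_bound h x : cintegrable h -> cabs (invF h x) <= c0 * \int[mu]_t cabs (h t).
Proof.
move=> ih; rewrite cabsM cabs_real ger0_norm ?c0_ge0// ler_wpM2l ?c0_ge0//.
have /le_cabs_cint := cintegrable_cis x ih.
by under eq_Rintegral do rewrite cabsM cabs_cis mulr1.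
Qed.

(** Continuity under the integral sign, with |Re h| + |Im h| as dominating function; its use is to
    make the transform measurable. *)
Lemma invF_rcont h : cintegrable h -> rcont (invF h).
Proof.
move=> ih; have mh := cintegrable_cmeas ih.
have cc (w z : R) : (continuous (fun x : R => z * cos (x * w)) /\
    continuous (fun x : R => z * sin (x * w))).
  split=> x; (apply: cvgM; [exact: cvg_cst|]).
  - by apply: (cvg_comp _ (@cos R)); [exact: mulrr_continuous|exact: continuous_cos].
  - by apply: (cvg_comp _ (@sin R)); [exact: mulrr_continuous|exact: continuous_sin].
have ci x : cint (fun xi => h xi * cexp ('i%C * (x * xi)%:C)) =
  (\int[mu]_xi (Re (h xi) * cos (x * xi) - Im (h xi) * sin (x * xi))) +i*
  (\int[mu]_xi (Re (h xi) * sin (x * xi) + Im (h xi) * cos (x * xi))).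
  apply: complex_ext => /=; apply: eq_Rintegral => xi _;
    by rewrite !ReImE/= !mul0r !mul1r subr0 expR0 ?add0r ?addr0 !mul1r.
have dom (w z x xi : R) : `|w * cos (x * xi) - z * sin (x * xi)| <= `|w| + `|z| /\
    `|w * sin (x * xi) + z * cos (x * xi)| <= `|w| + `|z|.
  have cl (y : R) : `|cos y| <= 1 by rewrite ler_norml cos_geN1 cos_le1.
  have sl (y : R) : `|sin y| <= 1 by rewrite ler_norml sin_geN1 sin_le1.
  by split; [rewrite (le_trans (ler_normB _ _))//|rewrite (le_trans (ler_normD _ _))//];
    rewrite lerD// normrM ler_piMr.
have [i1 i2] := ih.
have id := rintegrableD (rintegrable_norm i1) (rintegrable_norm i2).
have sub (w : R -> R) : (forall u v x : R, u < x < v -> {for x, continuous w}) -> continuous w.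
  by move=> H x; apply: (H (x - 1) (x + 1)); rewrite ltrBlDr !ltrDl ltr01.
have icx x := cintegrable_cis x ih.
have [K1 K2] : continuous (fun x : R => \int[mu]_xi (Re (h xi) * cos (x * xi) - Im (h xi) * sin
  (x * xi)) : R) /\
    continuous (fun x : R => \int[mu]_xi (Re (h xi) * sin (x * xi) + Im (h xi) * cos (x * xi)) : R).
  split; apply: sub => u v x xuv.
  - apply: (@continuity_under_integral _ _ _ mu
      (fun x xi => Re (h xi) * cos (x * xi) - Im (h xi) * sin (x * xi)) setT measurableT u v _ _
        _ id).
    + move=> y _; have [+ _] := icx y.
      by under eq_fun do rewrite !ReImE/= !mul0r !mul1r subr0 expR0 ?add0r ?addr0 !mul1r.
    + by apply: aeW => xi _ y _; apply: cvgB; [exact: (cc _ _).1|exact: (cc _ _).2].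
    + by move=> y _; apply: aeW => xi _; exact: (dom _ _ _ _).1.
    + by rewrite inE.
  - apply: (@continuity_under_integral _ _ _ mu
      (fun x xi => Re (h xi) * sin (x * xi) + Im (h xi) * cos (x * xi)) setT measurableT u v _ _
        _ id).
    + move=> y _; have [_ +] := icx y.
      by under eq_fun do rewrite !ReImE/= !mul0r !mul1r subr0 expR0 ?add0r ?addr0 !mul1r.
    + by apply: aeW => xi _ y _; apply: cvgD; [exact: (cc _ _).2|exact: (cc _ _).1].
    + by move=> y _; apply: aeW => xi _; exact: (dom _ _ _ _).2.
    + by rewrite inE.
have rE x : Re (invF h x) = c0 * \int[mu]_xi (Re (h xi) * cos (x * xi) - Im (h xi) * sin (x * xi)).
  by rewrite /invF /inv_fourier ci ReM/= mul0r subr0.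
have iE x : Im (invF h x) = c0 * \int[mu]_xi (Re (h xi) * sin (x * xi) + Im (h xi) * cos (x * xi)).
  by rewrite /invF /inv_fourier ci ImM/= mul0r addr0.
split=> x; rewrite /continuous_at.
- rewrite rE; under eq_fun do rewrite rE.
  by apply: cvgM; [exact: cvg_cst|exact: K1].
- rewrite iE; under eq_fun do rewrite iE.
  by apply: cvgM; [exact: cvg_cst|exact: K2].
Qed.

Lemma invF_cmeas h : cintegrable h -> cmeas (invF h).
Proof. by move=> /invF_rcont; exact: rcont_cmeas. Qed.

Lemma cmeas_fst h : cmeas h -> cmeas (fun p : R * R => h p.1).
Proof. by move=> mh; exact: (cmeas_comp mh measurable_fst). Qed.

Lemma cmeas_snd h : cmeas h -> cmeas (fun p : R * R => h p.2).
Proof. by move=> mh; exact: (cmeas_comp mh measurable_snd). Qed.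

(** The multiplication formula: both sides are the double integral of h(y) k(x) exp (i x y), taken
    in the two orders. Every identity between a function and its transform below comes from it. *)
Lemma invF_mult h k : cintegrable h -> cintegrable k ->
  cint (fun x => invF h x * k x) = cint (fun x => h x * invF k x).
Proof.
move=> ih ik.
have E1 x : invF h x * k x = c0%:C * cint (fun y => k x * (h y * cexp ('i%C * (x * y)%:C))).
  by rewrite /invF /inv_fourier -mulrA [cint _ * _]mulrC cintZ//; exact: cintegrable_cis.
have E2 y : h y * invF k y = c0%:C * cint (fun x => k x * (h y * cexp ('i%C * (x * y)%:C))).
  rewrite /invF /inv_fourier mulrCA -cintZ; last exact: cintegrable_cis.
  by congr (_ * cint _); apply/funext => x; rewrite mulrCA [y * x]mulrC.
have mu0 : cmeas (fun p : R * R => k p.1 * (h p.2 * cexp ('i%C * (p.1 * p.2)%:C))).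
  apply: cmeasM; first exact/cmeas_fst/cintegrable_cmeas.
  apply: cmeasM; first exact/cmeas_snd/cintegrable_cmeas.
  apply: cmeas_cexp; apply: cmeasM; first exact: cmeas_cst.
  by apply: cmeas_real; exact: measurable_funM.
have F := @cint_Fubini _ (fun x y => k x * (h y * cexp ('i%C * (x * y)%:C)))
  (fun x => cabs (k x)) (fun x => cabs (h x)) mu0 (cintegrable_abs ik) (cintegrable_abs ih)
  (fun x => cabs_ge0 _) (fun x => cabs_ge0 _).
have i1 : cintegrable (fun x => invF h x * k x).
  under eq_fun do rewrite mulrC.
  by apply: (cintegrableM ik (invF_cmeas ih)) => x; exact: invF_bound.
have i2 : cintegrable (fun x => h x * invF k x).
  by apply: (cintegrableM ih (invF_cmeas ik)) => x; exact: invF_bound.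
have c0n := c0C_neq0.
have e1 : (fun x => cint (fun y => k x * (h y * cexp ('i%C * (x * y)%:C)))) =
    (fun x => (c0%:C)^-1 * (invF h x * k x)) by apply/funext => x; rewrite E1 mulKf.
have e2 : (fun y => cint (fun x => k x * (h y * cexp ('i%C * (x * y)%:C)))) =
    (fun y => (c0%:C)^-1 * (h y * invF k y)) by apply/funext => y; rewrite E2 mulKf.
rewrite e1 e2 (cintZ _ i1) (cintZ _ i2) in F; apply: (mulfI (invr_neq0 c0n)); apply: F => x y.
by rewrite !cabsM cabs_cis mulr1.
Qed.

Lemma fourierJ h x : cintegrable h -> fourier h x = conjc (invF (fun y => conjc (h y)) x).
Proof.
move=> ih; rewrite /invF /inv_fourier /fourier conjcM conjc_real -cintJ; last first.
  by apply: cintegrable_cis; exact: cintegrableJ.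
congr (_ * cint _); apply/funext => y; rewrite conjcM conjcK -cexpJ.
congr (_ * cexp _); apply: complex_ext; rewrite !ReImE/=; ring.
Qed.

Lemma fourier_cmeas h : cintegrable h -> cmeas (fourier h).
Proof.
move=> ih; rewrite (_ : fourier h = fun x => conjc (invF (fun y => conjc (h y)) x)).
  by apply: cmeasJ; apply: invF_cmeas; exact: cintegrableJ.
by apply/funext => x; rewrite fourierJ.
Qed.

Lemma fourier_mult h k : cintegrable h -> cintegrable k ->
  cint (fun x => fourier h x * k x) = cint (fun x => h x * fourier k x).
Proof.
move=> ih ik; have := invF_mult (cintegrableJ ih) (cintegrableJ ik).
move=> /(congr1 (@conjc R)); rewrite -!cintJ; last 2 first.
- apply: (cintegrableM (cintegrableJ ih) (invF_cmeas (cintegrableJ ik))) => x.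
  by apply: invF_bound; exact: cintegrableJ.
- under eq_fun do rewrite mulrC.
  apply: (cintegrableM (cintegrableJ ik) (invF_cmeas (cintegrableJ ih))) => x.
  by apply: invF_bound; exact: cintegrableJ.
move=> E; rewrite (_ : (fun x => fourier h x * k x) =
    (fun x => conjc (invF (fun y => conjc (h y)) x * conjc (k x)))); last first.
  by apply/funext => x; rewrite conjcM conjcK fourierJ.
rewrite E; congr cint; apply/funext => x.
by rewrite conjcM conjcK fourierJ.
Qed.

Lemma fourier_invF h x : fourier h x = invF h (- x).
Proof.
rewrite /fourier /invF /inv_fourier; congr (_ * cint _); apply/funext => y.
by congr (_ * cexp _); apply: complex_ext; rewrite !ReImE/=; ring.
Qed.

Lemma invFD h k x : cintegrable h -> cintegrable k ->
  invF (fun y => h y + k y) x = invF h x + invF k x.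
Proof.
move=> ih ik; rewrite /invF /inv_fourier -mulrDr -cintD; try exact: cintegrable_cis.
by congr (_ * cint _); apply/funext => y; rewrite mulrDl.
Qed.

Lemma invFZ c h x : cintegrable h -> invF (fun y => c * h y) x = c * invF h x.
Proof.
move=> ih; rewrite /invF /inv_fourier [RHS]mulrCA -(cintZ _ (cintegrable_cis x ih)).
by congr (_ * cint _); apply/funext => y; rewrite mulrA.
Qed.

Lemma invFB h k x : cintegrable h -> cintegrable k ->
  invF (fun y => h y - k y) x = invF h x - invF k x.
Proof.
move=> ih ik; rewrite -[- invF k x]mulN1r -invFZ// -invFD//; last exact: cintegrableZ.
by congr (invF _ x); apply/funext => y; rewrite mulN1r.
Qed.

Lemma fourierB h k x : cintegrable h -> cintegrable k ->
  fourier (fun y => h y - k y) x = fourier h x - fourier k x.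
Proof. by move=> ih ik; rewrite !fourier_invF invFB. Qed.

(** Up to normalisation the Fourier transform of [gk n], which dictates the coefficient 1 / (4 (n +
    1)). *)
Definition damp (n : nat) (x : R) : R := expR (- ((4 * n.+1%:R)^-1 * x ^+ 2)).
Definition gconv h n (xi : R) := cint (fun eta => h eta * (gk n (xi - eta))%:C).

Lemma damp_ge0 n x : 0 <= damp n x. Proof. exact: expR_ge0. Qed.

Lemma damp_le1 n x : damp n x <= 1.
Proof. by rewrite expR_le1 oppr_le0 mulr_ge0// sqr_ge0. Qed.

Lemma rintegrable_damp n : rintegrable (damp n).
Proof. by apply: gauss_integral0; rewrite invr_gt0. Qed.

Lemma cvg_damp x : damp n x @[n --> \oo] --> (1 : R).
Proof.
rewrite -expR0; apply: (cvg_comp _ expR); last exact: continuous_expR.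
rewrite -oppr0; apply: cvgN.
have : 4^-1 * x ^+ 2 * harmonic n @[n --> \oo] --> (4^-1 * x ^+ 2 * 0 : R).
  by apply: cvgM; [exact: cvg_cst|exact: cvg_harmonic].
by rewrite mulr0; under eq_fun do rewrite mulrAC -invfM.
Qed.

Lemma cintegrable_damp (f : R -> C) n (M : R) : cmeas f -> (forall x, cabs (f x) <= M) ->
  cintegrable (fun x => f x * (damp n x)%:C).
Proof.
move=> mf fM; under eq_fun do rewrite mulrC.
apply: (cintegrableM _ mf fM).
have id := rintegrable_damp n.
apply: (cintegrable_le (cmeas_real (rintegrable_meas id)) id) => x.
by rewrite cabs_real ger0_norm// damp_ge0.
Qed.

(** The multiplication formula moves the transform from [h] to the modulated damping factor, whose
    transform is a Gaussian centred at [xi] by [cgauss_integral]. This is inversion up to smoothing,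
    before any inversion theorem is available. *)
Lemma fourier_damp h n xi : cintegrable h ->
  fourier (fun x => invF h x * (damp n x)%:C) xi = gconv h n xi.
Proof.
move=> ih; rewrite /fourier.
have d0 : (0 : R) < (4 * n.+1%:R)^-1 by rewrite invr_gt0.
have KE eta : invF (fun x => (damp n x)%:C * cexp (- ('i%C * (x * xi)%:C))) eta =
    (c0 * Num.sqrt (pi / (4 * n.+1%:R)^-1) * expR (- (n.+1%:R * (xi - eta) ^+ 2)))%:C.
  have [_ E] := cgauss_integral ('i%C * (eta - xi)%:C) d0.
  rewrite /invF /inv_fourier -mulrA !real_complexM; congr (_ * _).
  rewrite (_ : cint _ = cint (fun x => cexp ('i%C * (eta - xi)%:C * x%:C -
      ((4 * n.+1%:R)^-1 * x ^+ 2)%:C))); last first.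
    congr cint; apply/funext => x; rewrite /damp -cexp_real -!cexpD; congr cexp.
    by apply: complex_ext; rewrite !ReImE/=; ring.
  rewrite E -cexp_real; congr (_ * cexp _).
  by apply: complex_ext; rewrite !ReImE/=; field; rewrite ?pnatr_eq0.
have ik : cintegrable (fun x => (damp n x)%:C * cexp (- ('i%C * (x * xi)%:C))).
  under eq_fun do rewrite mulrC.
  apply: (@cintegrable_damp _ n 1).
  - by apply: cmeas_cexp; apply: cmeasN; apply: cmeasM; [exact: cmeas_cst|apply: cmeas_real;
      apply: measurable_funM => //; exact: measurable_cst].
  - by move=> x; rewrite -mulrN -real_complexN cabs_cis.
under eq_fun do rewrite -mulrA.
rewrite (invF_mult ih ik) -cintZ; last first.
  by apply: (cintegrableM ih (invF_cmeas ik)) => x; exact: invF_bound.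
congr cint; apply/funext => eta; rewrite KE mulrCA -real_complexM; congr (_ * _%:C).
rewrite /gk !mulrA; congr (_ * _).
by rewrite -mulrA c0_peak.
Qed.

Lemma gconv_cmeas h n : cintegrable h -> cmeas (gconv h n).
Proof.
move=> ih; rewrite (_ : gconv h n = fourier (fun x => invF h x * (damp n x)%:C)).
  apply: fourier_cmeas; apply: (cintegrable_damp _ (invF_cmeas ih)) => x.
  exact: invF_bound.
by apply/funext => xi; rewrite fourier_damp.
Qed.

Lemma cintegrable_gconv h n x : cintegrable h ->
  cintegrable (fun eta => h eta * (gk n (x - eta))%:C).
Proof.
move=> ih; apply: (@cintegrableM _ _ _ n.+1%:R) => //.
  exact: cmeas_real (rintegrable_meas (gk_integralC n x).1).
by move=> eta; rewrite cabs_real ger0_norm ?gk_ge0// gk_le.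
Qed.

Lemma damp_L2 (f : R -> C) n : L2 f ->
  L2 (fun x => f x * (damp n x)%:C) /\ L2 (fun x => f x * (damp n x)%:C - f x).
Proof.
move=> Lf; have mf := L2_cmeas Lf.
have Ld : L2 (fun x => f x * (damp n x)%:C).
  apply: (L2_le _ Lf); first exact: (cmeasM mf (cmeas_real (rintegrable_meas (rintegrable_damp
    n)))).
  by move=> x; rewrite cabsM cabs_real ger0_norm ?damp_ge0// ler_piMr ?cabs_ge0// damp_le1.
by split => //; have [] := L2B Ld Lf.
Qed.

Lemma damp_cvg (f : R -> C) : L2 f ->
  N2 (fun x => f x * (damp n x)%:C - f x) @[n --> \oo] --> (0 : R).
Proof.
move=> Lf; have E n x : f x * (damp n x)%:C - f x = f x * (damp n x - 1)%:C.
  by rewrite real_complexD real_complexN mulrDr mulrN mulr1.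
apply: (N2_dct _ Lf) => [n|n x|]; first exact: L2_cmeas (damp_L2 n Lf).2.
  rewrite E cabsM cabs_real ler_piMr ?cabs_ge0//.
  by rewrite distrC ger0_norm ?subr_ge0 ?damp_le1// lerBlDr lerDl damp_ge0.
apply: aeW => x; rewrite -(subrr (f x)); apply: ccvgB; last exact: ccvg_cst.
rewrite -[X in ccvg _ X]mulr1; apply: ccvgM; first exact: ccvg_cst.
by apply: ccvg_real; exact: cvg_damp.
Qed.

(** Young's inequality for a kernel of mass 1: |h(a) h(b)| is at most the mean of |h(a)|^2 and
    |h(b)|^2. Each half, [p] and [q], integrates to half the squared norm, the second after
    exchanging the order by Tonelli. *)
Lemma gconv_young h n : cintegrable h -> L2 h ->
  cabs (cint (fun x => h x * conjc (gconv h n x))) <= N2 h ^+ 2.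
Proof.
move=> ih Lh; have /L2P[mh i2] := Lh.
have mgp : measurable_fun setT (fun p : R * R => gk n (p.1 - p.2)).
  apply: (measurableT_comp (measurable_gk n)); apply: measurable_funB => //.
have ihg x := cintegrable_gconv n x ih.
have mG := gconv_cmeas n ih.
have Gb x : cabs (gconv h n x) <= n.+1%:R * \int[mu]_eta cabs (h eta).
  have ih' := rintegrableZ n.+1%:R (cintegrable_abs ih).
  rewrite -RintegralZl//; last exact: cintegrable_abs.
  apply: le_cabs_cint_bound => //; first exact: cintegrable_cmeas (ihg x).
  by move=> eta; rewrite cabsM cabs_real ger0_norm ?gk_ge0// mulrC ler_wpM2r ?cabs_ge0// gk_le.
have iG : cintegrable (fun x => h x * conjc (gconv h n x)).
  by apply: (cintegrableM ih (cmeasJ mG)) => x; rewrite cabsJ; exact: Gb.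
rewrite (le_trans (le_cabs_cint iG))// N2_sqr//.
rewrite -lee_fin /Rintegral !fineK; try exact: integrable_fin_num => //; last first.
  by apply: integrable_fin_num => //; exact: cintegrable_abs.
pose p (a b : R) : R := 2^-1 * (cabs (h a) ^+ 2 * gk n (a - b)).
pose q (a b : R) : R := 2^-1 * (cabs (h b) ^+ 2 * gk n (a - b)).
have p0 a b : 0 <= p a b by rewrite mulr_ge0 ?invr_ge0// mulr_ge0 ?sqr_ge0 ?gk_ge0.
have q0 a b : 0 <= q a b by rewrite mulr_ge0 ?invr_ge0// mulr_ge0 ?sqr_ge0 ?gk_ge0.
have m2 : measurable_fun setT (fun x => cabs (h x) ^+ 2).
  by apply: measurable_funX; exact: measurable_cabs.
have mp : measurable_fun setT (fun z : R * R => p z.1 z.2).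
  apply: measurable_funM; first exact: measurable_cst.
  by apply: measurable_funM => //; exact: (measurableT_comp m2 measurable_fst).
have mq : measurable_fun setT (fun z : R * R => q z.1 z.2).
  apply: measurable_funM; first exact: measurable_cst.
  by apply: measurable_funM => //; exact: (measurableT_comp m2 measurable_snd).
have mpx a : measurable_fun setT (p a).
  by apply: (measurableT_comp mp (f := fun z => p z.1 z.2) (g := fun b => (a, b)));
    exact: measurable_pair1.
have mqx a : measurable_fun setT (q a).
  by apply: (measurableT_comp mq (f := fun z => q z.1 z.2) (g := fun b => (a, b)));
    exact: measurable_pair1.
apply: (@le_trans _ _ (\int[mu]_a \int[mu]_b (p a b + q a b)%:E)%E).
  apply: ge0_le_integral => //.
  - by move=> a _; rewrite lee_fin cabs_ge0.
  - by apply/measurable_EFinP; exact: measurable_cabs (cintegrable_cmeas iG).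
  - apply: (@measurable_fun_fubini_tonelli_F _ _ _ _ _ mu (fun z => (p z.1 z.2 + q z.1 z.2)%:E)).
      by apply/measurable_EFinP; exact: measurable_funD.
    by move=> z; rewrite lee_fin addr_ge0.
  move=> a _; rewrite cabsM cabsJ.
  apply: (@le_trans _ _ (\int[mu]_b (cabs (h a) * cabs (h b * (gk n (a - b))%:C))%:E)%E).
    have ia := cintegrable_abs (ihg a).
    under eq_integral do rewrite EFinM.
    rewrite integralZl//.
    rewrite EFinM lee_wpmul2l ?lee_fin ?cabs_ge0//.
    rewrite -(fineK (integrable_fin_num _ ia))// lee_fin.
    exact: le_cabs_cint (ihg a).
  apply: ge0_le_integral => //.
  - by move=> b _; rewrite lee_fin mulr_ge0// cabs_ge0.
  - apply/measurable_EFinP; apply: measurable_funM; first exact: measurable_cst.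
    exact: measurable_cabs (cintegrable_cmeas (ihg a)).
  - by apply/measurable_EFinP; apply: measurable_funD; [exact: mpx|exact: mqx].
  move=> b _; rewrite lee_fin /p /q -mulrDr -mulrDl cabsM cabs_real ger0_norm ?gk_ge0//.
  move: (gk_ge0 n (a - b)); move: (gk n (a - b)) => g g0.
  rewrite !mulrA ler_wpM2r//.
  by have := sqr_ge0 (cabs (h a) - cabs (h b)); rewrite sqrrB; lra.
have -> : (\int[mu]_a \int[mu]_b (p a b + q a b)%:E =
    \int[mu]_a \int[mu]_b (p a b)%:E + \int[mu]_a \int[mu]_b (q a b)%:E)%E.
  rewrite -ge0_integralD//; last 4 first.
  - by move=> a _; apply: integral_ge0 => b _; rewrite lee_fin.
  - apply: (@measurable_fun_fubini_tonelli_F _ _ _ _ _ mu (fun z => (p z.1 z.2)%:E)).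
      exact/measurable_EFinP.
    by move=> z; rewrite lee_fin.
  - by move=> a _; apply: integral_ge0 => b _; rewrite lee_fin.
  - apply: (@measurable_fun_fubini_tonelli_F _ _ _ _ _ mu (fun z => (q z.1 z.2)%:E)).
      exact/measurable_EFinP.
    by move=> z; rewrite lee_fin.
  apply: eq_integral => a _; under eq_integral do rewrite EFinD.
  by rewrite ge0_integralD//; try (by move=> b _; rewrite lee_fin);
    apply/measurable_EFinP; first [exact: mpx|exact: mqx].
rewrite [X in (_ + X)%E](@fubini_tonelli _ _ _ _ _ mu mu (fun z => (q z.1 z.2)%:E)); last 2 first.
- exact/measurable_EFinP.
- by move=> z; rewrite lee_fin.
have P a : (\int[mu]_b (p a b)%:E = (2^-1 * cabs (h a) ^+ 2)%:E)%E.
  have [g1 g2] := gk_integralC n a.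
  under eq_integral do rewrite /p mulrA EFinM.
  rewrite integralZl//; rewrite -[RHS]mule1; congr (_ * _)%E.
  by rewrite -(fineK (integrable_fin_num _ g1))//; congr (_%:E); exact: g2.
have Q b : (\int[mu]_a (q a b)%:E = (2^-1 * cabs (h b) ^+ 2)%:E)%E.
  have [g1 g2] := gk_integral n b.
  under eq_integral do rewrite /q mulrA EFinM.
  rewrite integralZl//; rewrite -[RHS]mule1; congr (_ * _)%E.
  by rewrite -(fineK (integrable_fin_num _ g1))//; congr (_%:E); exact: g2.
rewrite [X in (X + _)%E](_ : _ = \int[mu]_a (2^-1 * cabs (h a) ^+ 2)%:E)%E; last first.
  by apply: eq_integral => a _; exact: P.
rewrite [X in (_ + X)%E](_ : _ = \int[mu]_b (2^-1 * cabs (h b) ^+ 2)%:E)%E; last first.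
  by apply: eq_integral => b _; exact: Q.
rewrite -ge0_integralD//; try (by move=> x _; rewrite lee_fin mulr_ge0 ?sqr_ge0// invr_ge0);
  try by apply/measurable_EFinP; apply: measurable_funM => //; exact: measurable_cst.
apply: ge0_le_integral => //.
- by move=> x _; rewrite -EFinD lee_fin addr_ge0// mulr_ge0 ?sqr_ge0// invr_ge0.
- by under eq_fun do rewrite -EFinD; apply/measurable_EFinP; apply: measurable_funD;
    apply: measurable_funM => //; exact: measurable_cst.
- exact/measurable_EFinP.
- by move=> x _; rewrite -EFinD lee_fin; lra.
Qed.

(** By the multiplication formula the damped energy of the transform is the pairing of [h] with
    [gconv h n], bounded uniformly in n by [gconv_young]; Fatou removes the damping. Equality has to
    wait for [gconv_cvg], whose proof uses this inequality. *)
Lemma bessel h : cintegrable h -> L2 h -> L2 (invF h) /\ N2 (invF h) <= N2 h.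
Proof.
move=> ih Lh; have mF := invF_cmeas ih.
have Fb x := invF_bound x ih.
have iFd n := cintegrable_damp n mF Fb.
have E n : cint (fun x => (cabs (invF h x) ^+ 2 * damp n x)%:C) =
    cint (fun x => h x * conjc (gconv h n x)).
  rewrite (_ : (fun x => (cabs (invF h x) ^+ 2 * damp n x)%:C) =
      (fun x => invF h x * conjc (invF h x * (damp n x)%:C))); last first.
    by apply/funext => x; rewrite conjcM conjc_real mulrA mulJ -real_complexM.
  rewrite invF_mult//; last exact: cintegrableJ.
  congr cint; apply/funext => x; congr (_ * _).
  by rewrite -fourier_damp// fourierJ// conjcK.
have i2 n : rintegrable (fun x => cabs (invF h x) ^+ 2 * damp n x).
  have := cintegrable_abs (cintegrableM (iFd n) mF Fb).
  under eq_fun => x do rewrite (cabsM (_ * _) (invF h x)) (cabsM (invF h x) (damp n x)%:C)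
    cabs_real (ger0_norm (damp_ge0 _ _)) mulrAC -expr2.
  by [].
have m2 : measurable_fun setT (fun x => cabs (invF h x) ^+ 2).
  by apply: measurable_funX; exact: measurable_cabs.
have [|||i3 le3] := @Rfatou _ (fun n x => cabs (invF h x) ^+ 2 * damp n x) _ (N2 h ^+ 2) i2 m2.
- by move=> n x; rewrite mulr_ge0 ?sqr_ge0 ?damp_ge0.
- apply: aeW => x; rewrite -[X in _ --> X]mulr1.
  by apply: cvgM; [exact: cvg_cst|exact: cvg_damp].
- move=> n; have := gconv_young n ih Lh; rewrite -E cint_real cabs_real.
  exact: le_trans (ler_norm _).
have LF : L2 (invF h) by apply/L2P.
by split => //; apply: N2_le => //; exact: N2_ge0.
Qed.

Lemma bessel_fourier h : cintegrable h -> L2 h -> L2 (fourier h) /\ N2 (fourier h) <= N2 h.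
Proof.
move=> ih Lh; have [LJ NJ] := L2J Lh.
have [LF NF] := bessel (cintegrableJ ih) LJ.
have [LFJ NFJ] := L2J LF.
rewrite (_ : fourier h = fun x => conjc (invF (fun y => conjc (h y)) x)).
  by rewrite NFJ -NJ.
by apply/funext => x; rewrite fourierJ.
Qed.

(* h * gk n is the transform of [invF h] damped by a Gaussian, so it is Cauchy in L2 by
   Bessel; its limit has the same integrals as h over every interval. *)
Lemma gconv_cvg h : cintegrable h -> L2 h ->
  (forall n, L2 (gconv h n)) /\ N2 (fun x => gconv h n x - h x) @[n --> \oo] --> (0 : R).
Proof.
move=> ih Lh; have [LF NF] := bessel ih Lh; set F := invF h in LF NF.
have mF := invF_cmeas ih; have Fb x := invF_bound x ih.
have iFd n := cintegrable_damp n mF Fb.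
have LFd n := (damp_L2 n LF).1.
have gE n : gconv h n = fourier (fun x => F x * (damp n x)%:C).
  by apply/funext => xi; rewrite -fourier_damp.
have Lg n : L2 (gconv h n) by rewrite gE; exact: (bessel_fourier (iFd n) (LFd n)).1.
split => //.
pose a n := N2 (fun x => F x * (damp n x)%:C - F x).
have a0 : a n @[n --> \oo] --> (0 : R) := damp_cvg LF.
have gd n m : N2 (fun x => gconv h n x - gconv h m x) <= a n + a m.
  have -> : (fun x => gconv h n x - gconv h m x) =
      fourier (fun x => F x * (damp n x)%:C - F x * (damp m x)%:C).
    by apply/funext => x; rewrite !gE -fourierB.
  have iB := cintegrableB (iFd n) (iFd m).
  have [LB _] := L2B (LFd n) (LFd m).
  rewrite (le_trans (bessel_fourier iB LB).2)//.
  rewrite (le_trans (N2_dist (LFd n) LF (LFd m)))// lerD//.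
  by rewrite N2BC.
have [|u Lu gu] := @L2_complete _ (gconv h) Lg.
  move=> e e0; move/cvgrPdist_lt : a0 => /(_ (e / 2) (divr_gt0 e0 (ltr0Sn R 1)))[N _ HN].
  exists N => m n mN nN; rewrite (le_lt_trans (gd m n))// [ltRHS]splitr.
  have := HN m mN; have := HN n nN; rewrite !sub0r !normrN !ger0_norm ?N2_ge0// => h1 h2.
  exact: ltrD.
suff uh : {ae mu, forall x, u x = h x}.
  have [mh _] := Lh.
  rewrite (_ : (fun n => N2 _) = (fun n => N2 (fun x => gconv h n x - u x)))//.
  apply/funext => n; have [L1 _] := L2B (Lg n) Lu; have [L3 _] := L2B (Lg n) Lh.
  have [] // := @ae_N2 _ _ (fun x => gconv h n x - h x) (L2_cmeas L3) L1.
  by apply: ae_mono uh => x ->.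
have Li (s t : R) : L2 (fun x => (\1_`[s, t] x)%:C : C).
  apply: L2_real; first exact: rintegrable_meas (rintegrable_indic s t).
  rewrite (_ : (fun x => _) = (fun x => (\1_`[s, t] x)%:E)); first exact: rintegrable_indic.
  by apply/funext => x; rewrite indicE; case: (_ \in _); rewrite ?expr1n ?expr0n.
have key (s t : R) : cint (fun x => (\1_`[s, t] x)%:C * u x) = cint (fun x => (\1_`[s, t] x)%:C *
  h x).
  have c1 : ccvg (fun n => cint (fun x => (\1_`[s, t] x)%:C * gconv h n x))
      (cint (fun x => (\1_`[s, t] x)%:C * u x)).
    have c : N2 (fun x => (\1_`[s, t] x)%:C) * N2 (fun x => gconv h n x - u x) @[n --> \oo] -->
        (N2 (fun x => (\1_`[s, t] x)%:C) * 0 : R) by apply: cvgM => //; exact: cvg_cst.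
    rewrite mulr0 in c; apply: (ccvg_le c) => n.
    have [L1 _] := L2B (Lg n) Lu.
    have [i1 _] := L2M (Li s t) (Lg n); have [i3 _] := L2M (Li s t) Lu.
    rewrite -cintB//; have [_] := L2M (Li s t) L1.
    by under eq_fun do rewrite mulrBr.
  apply: (ccvg_unique c1).
  have mi := rintegrable_meas (rintegrable_indic s t).
  (* Fubini moves the smoothing from [h] to the indicator, where it converges boundedly and almost
     everywhere, so that [h] itself serves as the dominating function. *)
  pose J n eta := cint (fun x => (\1_`[s, t] x)%:C * (gk n (x - eta))%:C) : C.
  have E n : cint (fun x => (\1_`[s, t] x)%:C * gconv h n x) = cint (fun eta => h eta * J n eta).
    have mk : cmeas (fun p : R * R => (\1_`[s, t] p.1)%:C * (h p.2 * (gk n (p.1 - p.2))%:C)).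
      apply: cmeasM; first exact: (cmeas_fst (cmeas_real mi)).
      apply: cmeasM; first exact/cmeas_snd/cintegrable_cmeas.
      by apply: cmeas_real; apply: (measurableT_comp (measurable_gk n)); exact: measurable_funB.
    have Fub := @cint_Fubini _ (fun x eta => (\1_`[s, t] x)%:C * (h eta * (gk n (x - eta))%:C))
      (fun x => \1_`[s, t] x) (fun eta => n.+1%:R * cabs (h eta)) mk (rintegrable_indic s t)
      (rintegrableZ _ (cintegrable_abs ih)) .
    transitivity (cint (fun x => cint (fun eta => (\1_`[s, t] x)%:C * (h eta * (gk n (x -
      eta))%:C)))).
      congr cint; apply/funext => x; rewrite /gconv.
      by rewrite (cintZ _ (cintegrable_gconv n x ih)).
    rewrite Fub.
    - congr cint; apply/funext => eta; rewrite /J -cintZ.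
        by congr cint; apply/funext => x; rewrite mulrCA.
      apply: (@cintegrableM _ _ _ n.+1%:R).
      + have ii := rintegrable_indic s t.
        by apply: (cintegrable_le (cmeas_real mi) ii) => x; rewrite cabs_real ger0_norm// indicE.
      + exact: cmeas_real (rintegrable_meas (gk_integral n eta).1).
      + by move=> x; exact: cabs_gk_le.
    - by move=> x; exact: indic_ge0.
    - by move=> x; exact: mulr_ge0 (ler0n _ _) (cabs_ge0 _).
    - move=> x eta; exact: cabs_indic_gk_le.
  under eq_fun do rewrite E.
  have mJ n : cmeas (J n).
    rewrite (_ : J n = gconv (fun x => (\1_`[s, t] x)%:C) n).
      apply: gconv_cmeas; have ii := rintegrable_indic s t.
      by apply: (cintegrable_le (cmeas_real mi) ii) => x; rewrite cabs_real ger0_norm// indicE.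
    by apply/funext => eta; rewrite /J /gconv; congr cint; apply/funext => x; rewrite gkBC.
  apply: (cint_dct _ _ _ (cintegrable_abs ih)).
  - by move=> n; apply: cmeasM => //; exact: cintegrable_cmeas.
  - by apply: cmeasM; [exact: cmeas_real|exact: cintegrable_cmeas].
  - apply: ae_mono (ae_and (ae_neq s) (ae_neq t)) => x [/eqP xs /eqP xt].
    by rewrite [X in ccvg _ X]mulrC; apply: ccvgM; [exact: ccvg_cst|exact: gk_indic].
  - by move=> n x; rewrite cabsM ler_piMr ?cabs_ge0// indic_gk_le1.
have van N : {ae mu, forall x, - (N%:R : R) < x < N%:R -> u x - h x = 0}.
  have iu := (L2M (Li (- N%:R) N%:R) Lu).1; have ih2 := (L2M (Li (- N%:R) N%:R) Lh).1.
  apply: ae_eq0_itv.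
    by under eq_fun do rewrite mulrBr; exact: cintegrableB.
  move=> x _; under eq_fun do rewrite mulrBr; rewrite cintB ?key ?subrr//.
    exact: (L2M (Li (- N%:R) x) Lu).1.
  exact: (L2M (Li (- N%:R) x) Lh).1.
have := ae_foralln van; apply: ae_mono => x H; apply/eqP; rewrite -subr_eq0; apply/eqP.
apply: (H (Num.bound `|x|)); rewrite -ltr_norml; exact: archi_boundP.
Qed.

(** Damping the transform of [k] on one side corresponds to smoothing [k] on the other, again by the
    multiplication formula. Both modifications disappear in L^2, by [damp_cvg] and [gconv_cvg]. *)
Lemma plancherel h k : cintegrable h -> L2 h -> cintegrable k -> L2 k ->
  L2_inner (invF h) (invF k) = L2_inner h k.
Proof.
move=> ih Lh ik Lk.
have [LF _] := bessel ih Lh; have [LG _] := bessel ik Lk.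
have [Lg gk0] := gconv_cvg ik Lk.
have LGd n := (damp_L2 n LG).1.
have c0' (f : R -> C) : L2 f -> N2 (fun x => (fun=> f) tt x - f x) @[n --> \oo] --> (0 : R).
  move=> Lf; have -> : (fun x => (fun=> f) tt x - f x) = (fun=> 0).
    by apply/funext => x; rewrite subrr.
  by rewrite (@L2_zero R).2; exact: cvg_cst.
have c1 := @L2_mulJ_cvg _ (fun=> invF h) (fun n x => invF k x * (damp n x)%:C) _ _
  (fun=> LF) LGd LF LG (c0' _ LF) (damp_cvg LG).
have c2 := @L2_mulJ_cvg _ (fun=> h) (gconv k) _ _ (fun=> Lh) Lg Lh Lk (c0' _ Lh) gk0.
apply: (ccvg_unique c1); move: c2; congr (ccvg _ _); apply/funext => n.
have iGd := cintegrable_damp n (invF_cmeas ik) (fun x => invF_bound x ik).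
rewrite /L2_inner (invF_mult ih (cintegrableJ iGd)).
congr cint; apply/funext => x; congr (_ * _).
by rewrite -fourier_damp// fourierJ// conjcK.
Qed.

Lemma plancherel_norm h : cintegrable h -> L2 h -> N2 (invF h) = N2 h.
Proof.
move=> ih Lh; have := plancherel ih Lh ih Lh; have [LF _] := bessel ih Lh.
rewrite !L2_inner_self// => /complexI/eqP; rewrite eqrXn2 ?N2_ge0// => /eqP.
by [].
Qed.

End fourier_transform.

(** * Schwartz functions and the Fourier-Laplace transform *)

Section schwartz_functions.
Context {R : realType}.
Local Notation C := R[i].
Local Notation mu := (@lebesgue_measure R).
Local Notation cint := (cintegral setT).
Local Notation rintegrable h := (mu.-integrable setT (fun x => (h x)%:E)).
Local Notation L2 := (@in_Lp R 2).
Implicit Types (f : R -> C) (u v : R -> R).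

Lemma rintegrable_oneDsqrV : rintegrable (fun x => (oneDsqr x)^-1).
Proof.
have mf : measurable_fun setT (fun x : R => (oneDsqr x)^-1).
  by apply: continuous_measurable_fun; exact: continuous_oneDsqrV.
have f0 (x : R) : 0 <= (oneDsqr x)^-1 by rewrite invr_ge0 (le_trans _ (oneDsqr_ge1 x)).
apply/integrableP; split; first exact/measurable_EFinP.
under eq_integral do rewrite gee0_abs ?lee_fin//.
rewrite ge0_symfun_integralT//; first last.
- by move=> x; rewrite /oneDsqr/= sqrrN.
- exact: continuous_oneDsqrV.
by rewrite -set_itvcy integral0y_oneDsqr -EFinM ltry.
Qed.

Lemma oneDsqrV_L2 : L2 (fun x => ((oneDsqr x)^-1)%:C).
Proof.
have mf := rintegrable_meas rintegrable_oneDsqrV.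
apply: L2_real => //; apply: (rintegrable_le _ rintegrable_oneDsqrV).
  by apply: measurable_funX.
move=> x; have := oneDsqr_ge1 x; move: (oneDsqr x) => t t1.
have t0 : 0 <= t^-1 by rewrite invr_ge0 (le_trans _ t1).
have t1' : t^-1 <= 1 by rewrite invf_le1// (lt_le_trans _ t1).
by rewrite ger0_norm ?exprn_ge0// expr2 ler_piMr.
Qed.

Lemma schwartz_real_derive u (x : R) : schwartz_real u -> is_derive x 1 u (derive1 u x).
Proof. by move=> [d _]; rewrite derive1E; apply: derivableP; exact: (d 0%N). Qed.

Lemma schwartz_real_derive1 u : schwartz_real u -> schwartz_real (derive1 u).
Proof.
by move=> [d b]; split=> [n x|k n]; rewrite -derive1Sn; [exact: d|exact: b].
Qed.

Lemma schwartz_real_cont u : schwartz_real u -> continuous u.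
Proof.
move=> [d _] x; apply: differentiable_continuous; exact/derivable1_diffP/(d 0%N).
Qed.

Lemma schwartz_real_bound u : schwartz_real u ->
  exists M, forall x, `|u x| <= M * (oneDsqr x)^-1.
Proof.
move=> [_ b]; have [M0 b0] := b 0%N 0%N; have [M2 b2] := b 2%N 0%N.
exists (M0 + M2) => x; have := oneDsqr_ge1 x; rewrite /oneDsqr => t1.
rewrite ler_pdivlMr ?(lt_le_trans _ t1)// mulrDr mulr1 lerD//.
  by have := b0 x; rewrite expr0 mul1r.
by have := b2 x; rewrite normrM (ger0_norm (sqr_ge0 _)) mulrC.
Qed.

Lemma integral_derive_eq0 u v M : (forall x : R, is_derive x 1 u (v x)) ->
  continuous v -> rintegrable v -> (forall x, `|u x| <= M * (oneDsqr x)^-1) ->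
  \int[mu]_x v x = 0.
Proof.
move=> d cv iv bu.
have rv : rcont (fun x => (v x)%:C) by split=> //= x; exact: cvg_cst.
have := seg_cvg rv (rintegrable_norm iv) (fun x => _ : cabs (v x)%:C <= `|v x|).
under eq_fun do rewrite segE -cintegral_setT.
rewrite cint_real => c; apply: complexI; apply: (ccvg_unique (c _)).
  by move=> x; rewrite cabs_real.
apply: (@ccvg_le _ _ _ (fun n => M * (n%:R)^-1 + M * (n%:R)^-1)).
  rewrite -(cvg_shiftS (fun n => M * (n%:R)^-1 + M * (n%:R)^-1)).
  have h : M * (n.+1%:R)^-1 @[n --> \oo] --> M * 0.
    by apply: cvgM; [exact: cvg_cst|exact: cvg_harmonic].
  have e : M * 0 + M * 0 = 0 by rewrite mulr0 addr0.
  exact: (cvg_eq_lim e (cvgD h h)).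
move=> n; rewrite subr0.
(* For n = 0 the claimed bound is 0, since the inverse of 0 is 0, and the interval is a single
   point. *)
have [->|n0] := posnP n.
  rewrite oppr0 set_itv1 /cintegral !Rintegral_set1.
  by rewrite (cabs0 : cabs (0 +i* 0 : C) = 0) invr0 !mulr0 addr0.
have nn : (0 : R) < n%:R by rewrite ltr0n.
have -> : cintegral `[- n%:R, n%:R] (fun x => (v x)%:C) = (u n%:R - u (- n%:R))%:C.
  congr (_ +i* _) => /=; last by rewrite Rintegral_cst// mul0r.
  rewrite /Rintegral (@continuous_FTC2 _ _ u)//.
  - by rewrite gtrN.
  - by apply: continuous_in_subspaceT => x _; exact: cv.
  - have cu x : u t @[t --> x] --> u x.
      apply: differentiable_continuous; apply/derivable1_diffP; exact: ex_derive.
    by split; [move=> x _; exact: ex_derive|exact: cvg_at_right_filter|exact: cvg_at_left_filter].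
  - by move=> x _; rewrite derive1E; exact: derive_val.
have b x : `|x| = n%:R -> `|u x| <= M * n%:R^-1.
  move=> xn; rewrite (le_trans (bu x))// ler_wpM2l//.
    by have := le_trans (normr_ge0 _) (bu 0); rewrite /oneDsqr expr0n addr0 invr1 mulr1.
  rewrite lef_pV2 ?posrE ?(lt_le_trans _ (oneDsqr_ge1 x))// /oneDsqr.
  rewrite -real_normK ?num_real// xn; have : 0 <= (n%:R - 1 : R) ^+ 2 := sqr_ge0 _.
  by rewrite sqrrB1; lra.
rewrite (cabs_real (u n%:R - u (- n%:R))) (le_trans (ler_normB _ _))// lerD// b//.
  by rewrite ger0_norm.
by rewrite normrN ger0_norm.
Qed.

Lemma schwartz_real_integrable u : schwartz_real u -> rintegrable u.
Proof.
move=> su; have [M b] := schwartz_real_bound su.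
apply: (rintegrable_le _ (rintegrableZ M rintegrable_oneDsqrV) b).
by apply: continuous_measurable_fun; exact: schwartz_real_cont.
Qed.

Lemma schwartz_cintegrable f : schwartz f -> cintegrable f.
Proof. by move=> [sr si]; split; exact: schwartz_real_integrable. Qed.

Definition cderive f (x : R) : C := derive1 (fun t => Re (f t)) x +i* derive1 (fun t => Im (f t)) x.

Lemma schwartz_cderive f : schwartz f -> schwartz (cderive f).
Proof. by move=> [sr si]; split=> /=; exact: schwartz_real_derive1. Qed.

Lemma cexpNi (t : R) : cexp (- ('i%C * t%:C)) = cos t -i* sin t.
Proof.
have -> : - ('i%C * t%:C) = 0 -i* t.
  by apply: complex_ext; rewrite !ReImE/= !(mul0r, mulr0, mul1r, subr0, addr0, add0r) ?oppr0.
by rewrite /cexp/= expR0 cosN sinN !mul1r.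
Qed.

(** Integration by parts without boundary terms. The factor [w] will be the cosine or the sine of
    [x * xi], which is bounded together with its derivative. *)
Lemma integral_deriveM u (w : R -> R) (w' : R -> R) : schwartz_real u ->
  (forall x : R, is_derive x 1 w (w' x)) -> continuous w' ->
  (forall x, `|w x| <= 1) -> (exists B : R, forall x, `|w' x| <= B) ->
  rintegrable (fun x => derive1 u x * w x + u x * w' x) /\
  \int[mu]_x (derive1 u x * w x + u x * w' x) = 0.
Proof.
move=> su dw cw' w1 [B wB]; have [M b] := schwartz_real_bound su.
have cu := schwartz_real_cont su.
have cu' := schwartz_real_cont (schwartz_real_derive1 su).
have cw : continuous w.
  by move=> x; apply: differentiable_continuous; apply/derivable1_diffP; exact: ex_derive.
suff i : rintegrable (fun x => derive1 u x * w x + u x * w' x).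
  split=> //; apply: (@integral_derive_eq0 (fun x => u x * w x) _ M) => //.
  - move=> x; have du := schwartz_real_derive x su.
    by have := is_deriveM du (dw x); rewrite /GRing.scale/= addrC (mulrC (w x)).
  - by move=> x; apply: cvgD; apply: cvgM; [exact: cu'|exact: cw|exact: cu|exact: cw'].
  - by move=> x; rewrite normrM (le_trans _ (b x))// ler_piMr.
have mw := continuous_measurable_fun cw; have mw' := continuous_measurable_fun cw'.
have mu' := continuous_measurable_fun cu; have mu'' := continuous_measurable_fun cu'.
apply: rintegrableD.
  apply: (rintegrable_le _ (rintegrable_norm (schwartz_real_integrable (schwartz_real_derive1
    su)))).
    exact: measurable_funM.
  by move=> x; rewrite normrM ler_piMr.
apply: (rintegrable_le _ (rintegrableZ B (rintegrable_norm (schwartz_real_integrable su)))).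
  exact: measurable_funM.
by move=> x; rewrite normrM mulrC ler_wpM2r.
Qed.

Lemma cmeas_cisN (xi : R) : cmeas (fun x : R => cexp (- ('i%C * (x * xi)%:C))).
Proof.
apply/cmeas_cexp/cmeasN/cmeasM; first exact: cmeas_cst.
by apply: cmeas_real; exact: measurable_funM.
Qed.

Lemma cabs_cisN (t : R) : cabs (cexp (- ('i%C * t%:C))) = 1.
Proof. by rewrite cabs_cexp ReN ReM/= !(mul0r, mulr0, subr0, oppr0) expR0. Qed.

Lemma cintegrable_cisN f (xi : R) : cintegrable f ->
  cintegrable (fun x => f x * cexp (- ('i%C * (x * xi)%:C))).
Proof.
by move=> i; apply: (cintegrableM i (cmeas_cisN xi)) => x; rewrite cabs_cisN.
Qed.

Lemma fourier_cderive f xi : schwartz f ->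
  fourier (cderive f) xi = 'i%C * xi%:C * fourier f xi.
Proof.
move=> sf; have [sr si] := sf; rewrite /fourier mulrCA; congr (_ * _).
have sf' := schwartz_cderive sf.
have i1 := cintegrable_cisN xi (schwartz_cintegrable sf').
have i2 := cintegrable_cisN xi (schwartz_cintegrable sf).
rewrite -cintZ//; apply/eqP; rewrite -subr_eq0 -cintB//; last exact: cintegrableZ.
apply/eqP.
pose cs x := cos (x * xi) : R; pose sn x := sin (x * xi) : R.
have dc (x : R) : is_derive x 1 cs (- xi * sn x).
  apply: is_derive_eq; rewrite /GRing.scale/= /sn; lra.
have ds (x : R) : is_derive x 1 sn (xi * cs x).
  apply: is_derive_eq; rewrite /GRing.scale/= /cs; lra.
have cc : continuous (fun x => - xi * sn x).
  move=> x; apply: cvgM; first exact: cvg_cst.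
  apply: differentiable_continuous; apply/derivable1_diffP; exact: ex_derive.
have cs' : continuous (fun x => xi * cs x).
  move=> x; apply: cvgM; first exact: cvg_cst.
  apply: differentiable_continuous; apply/derivable1_diffP; exact: ex_derive.
have c1 x : `|cs x| <= 1 by rewrite ler_norml cos_geN1 cos_le1.
have s1 x : `|sn x| <= 1 by rewrite ler_norml sin_geN1 sin_le1.
have cB : exists B : R, forall x, `|- xi * sn x| <= B.
  by exists `|xi| => x; rewrite normrM normrN ler_piMr.
have sB : exists B : R, forall x, `|xi * cs x| <= B.
  by exists `|xi| => x; rewrite normrM ler_piMr.
(* The real part pairs Re f with the cosine and Im f with the sine, the imaginary part pairs them
   crosswise; hence four integrations by parts. *)
have [ia Ia] := integral_deriveM sr dc cc c1 cB; have [ib Ib] := integral_deriveM si ds cs' s1 sB.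
have [ic Ic] := integral_deriveM si dc cc c1 cB; have [id Id] := integral_deriveM sr ds cs' s1 sB.
under eq_fun do rewrite cexpNi.
apply: complex_ext.
  transitivity (\int[mu]_x ((derive1 (fun t => Re (f t)) x * cs x + Re (f x) * (- xi * sn x)) +
      (derive1 (fun t => Im (f t)) x * sn x + Im (f x) * (xi * cs x)))).
    apply: eq_Rintegral => x _; rewrite !ReImE/= /cs /sn; ring.
  by rewrite RintegralD// Ia Ib addr0.
transitivity (\int[mu]_x ((derive1 (fun t => Im (f t)) x * cs x + Im (f x) * (- xi * sn x)) -
      (derive1 (fun t => Re (f t)) x * sn x + Re (f x) * (xi * cs x)))).
  apply: eq_Rintegral => x _; rewrite !ReImE/= /cs /sn; ring.
by rewrite RintegralB// Ic Id subr0.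
Qed.

Lemma fourier_bound f xi : cintegrable f ->
  cabs (fourier f xi) <= (Num.sqrt (2 * pi))^-1 * \int[mu]_t cabs (f t).
Proof. by move=> i; rewrite fourier_invF; exact: invF_bound. Qed.

Lemma schwartz_fourier_sqr f : schwartz f ->
  exists M, forall xi, cabs (fourier f xi) * oneDsqr xi <= M.
Proof.
move=> sf; have sf1 := schwartz_cderive sf; have sf2 := schwartz_cderive sf1.
exists ((Num.sqrt (2 * pi))^-1 * \int[mu]_t cabs (f t) +
  (Num.sqrt (2 * pi))^-1 * \int[mu]_t cabs (cderive (cderive f) t)) => xi.
have b0 := fourier_bound xi (schwartz_cintegrable sf).
have b2 := fourier_bound xi (schwartz_cintegrable sf2).
rewrite /oneDsqr mulrDr mulr1; apply: lerD => //; apply: le_trans b2.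
rewrite !fourier_cderive// !cabsM cabs_i cabs_real !mul1r mulrA mulrC.
by rewrite -[in leLHS]real_normK ?num_real// expr2.
Qed.

(** The quadratic decay is applied to f and to its second derivative. Two factors are wanted because
    multiplication by |xi|^s may cost one of them, and the remaining one is integrable and square
    integrable. *)
Lemma schwartz_fourier_decay f : schwartz f ->
  exists M, forall xi, cabs (fourier f xi) <= M * (oneDsqr xi)^-1 * (oneDsqr xi)^-1.
Proof.
move=> sf; have sf1 := schwartz_cderive sf; have sf2 := schwartz_cderive sf1.
have [M b0] := schwartz_fourier_sqr sf; have [N b2] := schwartz_fourier_sqr sf2.
exists (M + N) => xi; have := oneDsqr_ge1 xi => t1; have t0 := lt_le_trans ltr01 t1.
have E : cabs (fourier (cderive (cderive f)) xi) = xi ^+ 2 * cabs (fourier f xi).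
  rewrite !fourier_cderive//; move: (fourier f xi) => z.
  rewrite !cabsM cabs_i cabs_real !mul1r mulrA; congr (_ * _).
  by rewrite -expr2 real_normK ?num_real.
rewrite !ler_pdivlMr//; apply: le_trans (lerD (b0 xi) (b2 xi)); rewrite E.
rewrite le_eqVlt; apply/orP; left; apply/eqP; rewrite /oneDsqr; ring.
Qed.

Lemma powR_le_oneDsqr (s x : R) : 0 <= s <= 1 -> `|x| `^ s <= oneDsqr x.
Proof.
move=> /andP[s0 s1]; rewrite /oneDsqr; have [x1|x1] := leP `|x| 1.
  rewrite (le_trans (_ : _ <= 1))//; last by rewrite lerDl sqr_ge0.
  rewrite -[leRHS](powRr1 ler01) (le_trans (_ : _ <= 1 `^ s))//; last by rewrite !powR1.
  by rewrite ge0_ler_powR// ?nnegrE.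
rewrite (le_trans (_ : _ <= `|x| `^ 1))//; first by rewrite ler_powR// ltW.
rewrite powRr1// -[in leRHS]real_normK ?num_real// (le_trans (_ : _ <= `|x| ^+ 2))//.
  by rewrite expr2 ler_peMr// ltW.
by rewrite lerDr.
Qed.

Lemma measurable_abs_powR (s : R) : measurable_fun setT (fun x : R => `|x| `^ s).
Proof. exact: (measurableT_comp (@measurable_powR R s) (@normr_measurable R setT)). Qed.

Lemma schwartz_weighted_fourier (s : R) f : 0 <= s <= 1 -> schwartz f ->
  cintegrable (fun xi => (`|xi| `^ s)%:C * fourier f xi) /\
  L2 (fun xi => (`|xi| `^ s)%:C * fourier f xi).
Proof.
move=> s01 sf; have [M b] := schwartz_fourier_decay sf.
have m : cmeas (fun xi : R => (`|xi| `^ s)%:C * fourier f xi).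
  apply: cmeasM; first exact: (cmeas_real (measurable_abs_powR s)).
  exact/fourier_cmeas/schwartz_cintegrable.
have B xi : cabs ((`|xi| `^ s)%:C * fourier f xi) <= M * (oneDsqr xi)^-1.
  have t0 : 0 < oneDsqr xi := lt_le_trans ltr01 (oneDsqr_ge1 xi).
  rewrite cabsM cabs_real ger0_norm ?powR_ge0//.
  apply: le_trans (ler_pM (powR_ge0 _ _) (cabs_ge0 _) (powR_le_oneDsqr xi s01) (b xi)) _.
  by rewrite mulrC divfK ?gt_eqF.
split; first exact: (cintegrable_le m (rintegrableZ M rintegrable_oneDsqrV) B).
have [L _] := L2Z M%:C oneDsqrV_L2.
apply: (L2_le m L) => xi; apply: le_trans (B xi) _.
by rewrite cabsM !cabs_real -normrM ler_norm.
Qed.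

Lemma is_derive_eps u (x l : R) :
  (forall e : R, 0 < e -> exists2 d : R, 0 < d &
    forall h : R, `|h| < d -> `|u (x + h) - u x - l * h| <= e * `|h|) ->
  is_derive x 1 u l.
Proof.
move=> H.
have c : h^-1 *: (u (h *: (1 : R) + x) - u x) @[h --> (0 : R)^'] --> l.
  apply/cvgrPdist_le => e e0; have [d d0 Hd] := H e e0.
  near=> h.
  have h0 : h != 0 by near: h; exact: nbhs_dnbhs_neq.
  have hd : `|h| < d by near: h; apply: dnbhs0_lt.
  have := Hd h hd; rewrite -(ler_pM2l (_ : 0 < `|h|^-1)) ?invr_gt0 ?normr_gt0//.
  rewrite -normfV -normrM mulrCA -normrM mulVf// normr1 mulr1; apply: le_trans.
  rewrite (_ : h^-1 *: _ = h^-1 * (u (x + h) - u x)); last first.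
    by congr (_ * (u _ - _)); rewrite addrC; congr (_ + _); exact: mulr1.
  by rewrite distrC [X in _ <= `|X|]mulrBr [h^-1 * (l * h)]mulrCA mulVf// mulr1.
by apply: DeriveDef; [apply/cvg_ex; exists l|exact: cvg_lim].
Unshelve. all: by end_near.
Qed.

Lemma exprn_le_expR k (x : R) : 0 <= x -> x ^+ k <= k`!%:R * expR x.
Proof.
move=> x0; rewrite mulrC -ler_pdivrMr ?ltr0n ?fact_gt0//.
case: k => [|k]; first by rewrite fact0 expr0 divr1 expR_ge1r.
by apply: le_trans (expR_ge1Dxn k x0); rewrite lerDr.
Qed.

Section damped_families.
Variables (u : nat -> R -> R) (dl : R).
Hypotheses (dl0 : 0 < dl) (u_derive : forall n (x : R), is_derive x 1 (u n) (u n.+1 x))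
  (u_bound : forall n, exists M A : R, forall x, `|u n x| <= M * expR (A * `|x|)).

Let gs (x : R) : R := expR (- (dl * x ^+ 2)).

(** A class that contains the damped members of the family and is closed under differentiation, with
    rapid decay provable by induction. It spares a formula for the n-th derivative of a product with
    a Gaussian. *)
Inductive damped : (R -> R) -> Prop :=
| damped_base n : damped (fun x => u n x * gs x)
| damped_add p q : damped p -> damped q -> damped (fun x => p x + q x)
| damped_mulX p : damped p -> damped (fun x => x * p x)
| damped_scale c p : damped p -> damped (fun x => c * p x).

Lemma damped_derive p : damped p -> exists2 q, damped q & forall x : R, is_derive x 1 p (q x).
Proof.
elim=> {p} [n|p q _ [p' dp' hp] _ [q' dq' hq]|p dp [p' dp' hp]|c p _ [p' dp' hp]].
- exists (fun x => u n.+1 x * gs x + (- 2 * dl) * (x * (u n x * gs x))).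
    by apply: damped_add; [|apply/damped_scale/damped_mulX]; exact: damped_base.
  move=> x; have dg : is_derive x 1 gs (- 2 * dl * x * gs x).
    by apply: is_derive_eq; rewrite /GRing.scale/= /gs; ring.
  have := is_deriveM (u_derive n x) dg; rewrite /GRing.scale/=.
  by congr is_derive; ring.
- exists (fun x => p' x + q' x); first exact: damped_add.
  by move=> x; exact: is_deriveD.
- exists (fun x => p x + x * p' x); first by apply: damped_add => //; exact: damped_mulX.
  move=> x; have := is_deriveM (is_derive_id x 1) (hp x); rewrite /GRing.scale/=.
  by congr is_derive; ring.
- exists (fun x => c * p' x); first exact: damped_scale.
  by move=> x; have := is_deriveZ c (hp x).
Qed.

Lemma damped_bound p : damped p -> forall k, exists M : R, forall x, `|x ^+ k * p x| <= M.
Proof.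
elim=> {p} [n|p q _ hp _ hq|p _ hp|c p _ hp] k.
- have [M [A b]] := u_bound n.
  (* The power is absorbed by |x|^k <= k! exp |x|; the exponential factor is the maximum of exp ((A
     + 1) y - dl y^2). *)
  exists (k`!%:R * (M * expR ((A + 1) ^+ 2 / (4 * dl)))) => x.
  rewrite mulrA normrM (ger0_norm (expR_ge0 _)) normrM normrX.
  have M0 : 0 <= M by rewrite -(pmulr_lge0 _ (expR_gt0 (A * `|0 : R|))) (le_trans _ (b 0)).
  have e1 := exprn_le_expR k (normr_ge0 x).
  apply: le_trans (ler_pM _ _ (ler_pM _ _ e1 (b x)) (lexx _)) _; rewrite ?mulr_ge0 ?expR_ge0//.
  rewrite [leLHS](_ : _ = k`!%:R * (M * (expR `|x| * expR (A * `|x|) * expR (- (dl * x ^+ 2)))));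
    last by ring.
  rewrite ler_wpM2l// ler_wpM2l// -!expRD ler_expR.
  rewrite -real_normK ?num_real//; move: `|x| => y.
  rewrite -subr_ge0 (_ : _ - _ = dl * (y - (A + 1) / (2 * dl)) ^+ 2); last by field; rewrite gt_eqF.
  by rewrite mulr_ge0 ?sqr_ge0// ltW.
- have [M bM] := hp k; have [N bN] := hq k; exists (M + N) => x.
  by rewrite mulrDr (le_trans (ler_normD _ _))// lerD.
- have [M bM] := hp k.+1; exists M => x; by rewrite mulrA -exprSr.
- have [M bM] := hp k; exists (`|c| * M) => x; by rewrite mulrCA normrM ler_wpM2l.
Qed.

Lemma damped_derive1n p n : damped p -> damped (derive1n n p).
Proof.
move=> dp; elim: n => [//|n IH]; rewrite derive1nS.
have [q dq hq] := damped_derive IH.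
rewrite (_ : derive1 _ = q)//; apply/funext => x; rewrite derive1E.
by have := hq x => h; exact: derive_val.
Qed.

Lemma damped_schwartz_real : schwartz_real (fun x => u 0 x * gs x).
Proof.
split=> [n x|k n].
  by have [q _ hq] := damped_derive (damped_derive1n n (damped_base 0)); have := hq x => h;
    exact: ex_derive.
exact: (damped_bound (damped_derive1n n (damped_base 0))).
Qed.

End damped_families.

End schwartz_functions.

(** * Gaussian-damped entire functions and the Fourier-Laplace transform of compactly supported
    functions *)

Section exponential_families.
Context {R : realType}.
Local Notation C := R[i].
Local Notation mu := (@lebesgue_measure R).
Local Notation cint := (cintegral setT).
Local Notation rintegrable h := (mu.-integrable setT (fun x => (h x)%:E)).
Local Notation c0 := ((Num.sqrt (2 * pi : R))^-1).

Lemma cderiv_sqr (f : C -> C) z l (K : R) :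
  (forall h, cabs h < 1 -> cabs (f (z + h) - f z - l * h) <= K * cabs h ^+ 2) ->
  cderiv f z l.
Proof.
move=> H e e0; exists (Num.min 1 (e / (`|K| + 1))) => [|h].
  by rewrite lt_min ltr01 divr_gt0// ltr_wpDl.
rewrite lt_min => /andP[h1 h2]; apply: le_trans (H h h1) _.
rewrite expr2 mulrA ler_wpM2r ?cabs_ge0//.
move: h2; rewrite ltr_pdivlMr ?ltr_wpDl// => h2; apply: le_trans (ltW h2).
by rewrite mulrC ler_wpM2l ?cabs_ge0// (le_trans (ler_norm K))// lerDl.
Qed.

Lemma cexp_expand_scale (z : C) (K r : R) : r <= 1 -> 0 <= K -> cabs z <= K * r ->
  cabs (cexp z - 1 - z) <= 6 * K ^+ 2 * expR K * r ^+ 2.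
Proof.
move=> r1 K0 zr; apply: le_trans (cexp_expand _) _; move: (cabs z) (cabs_ge0 z) zr => t t0 tr.
have tK : t <= K by rewrite (le_trans tr)// ler_piMr.
rewrite [leRHS](_ : _ = 6 * (K * r) ^+ 2 * expR K); last by ring.
apply: ler_pM; first by rewrite mulr_ge0// sqr_ge0.
- exact: expR_ge0.
- by apply: ler_wpM2l => //; rewrite !expr2; exact: ler_pM.
- by rewrite ler_expR.
Qed.

Lemma cderiv_cexpM (b z : C) : cderiv (fun w => cexp (b * w)) z (b * cexp (b * z)).
Proof.
apply: (@cderiv_sqr _ _ _ (cabs (cexp (b * z)) * (6 * cabs b ^+ 2 * expR (cabs b)))) => h h1.
rewrite mulrDr cexpD.
rewrite (_ : _ - _ = cexp (b * z) * (cexp (b * h) - 1 - b * h)); last by ring.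
rewrite cabsM -[leRHS]mulrA; apply: ler_wpM2l; rewrite ?cabs_ge0//.
by apply: (cexp_expand_scale (ltW h1) (cabs_ge0 b)); rewrite cabsM.
Qed.

Lemma cderivZ (c : C) f z l : cderiv f z l -> cderiv (fun w => c * f w) z (c * l).
Proof.
move=> H e e0; have [|d d0 Hd] := H (e / (cabs c + 1)).
  by rewrite divr_gt0// ltr_wpDl ?cabs_ge0.
exists d => // h hd; rewrite -mulrA -!mulrBr cabsM.
apply: le_trans (ler_wpM2l (cabs_ge0 c) (Hd h hd)) _.
rewrite mulrA ler_wpM2r ?cabs_ge0// mulrCA ger_pMr// ler_pdivrMr ?ltr_wpDl ?cabs_ge0//.
by rewrite mul1r lerDl.
Qed.

Lemma cderiv_entire (f f' : C -> C) : (forall z, cderiv f z (f' z)) -> entire f.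
Proof. by move=> H z; exact: (cderiv_derivable (H z)). Qed.

(** [F n] plays the part of the n-th complex derivative of [F 0]; the real and imaginary parts on
    the real line then form families of the kind treated by [damped_schwartz_real]. *)
Lemma schwartz_damped (F : nat -> C -> C) (dl : R) : 0 < dl ->
  (forall n z, cderiv (F n) z (F n.+1 z)) ->
  (forall n, exists M A : R, forall x : R, cabs (F n x%:C) <= M * expR (A * `|x|)) ->
  schwartz (fun x => F 0%N x%:C * (expR (- (dl * x ^+ 2)))%:C).
Proof.
move=> dl0 dF bF.
have E n (x : R) e : 0 < e -> exists2 d : R, 0 < d & forall h : R, `|h| < d ->
    cabs (F n (x + h)%:C - F n x%:C - F n.+1 x%:C * h%:C) <= e * `|h|.
  move=> e0; have [d d0 Hd] := dF n x%:C e e0; exists d => // h hd.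
  by have := Hd h%:C; rewrite cabs_real -real_complexD; exact.
split.
  rewrite (_ : (fun x => _) = (fun x => Re (F 0%N x%:C) * expR (- (dl * x ^+ 2)))); last first.
    by apply/funext => x; rewrite ReM/= mulr0 subr0.
  apply: (@damped_schwartz_real _ (fun n x => Re (F n x%:C)) dl dl0) => n.
    move=> x; apply: is_derive_eps => e e0; have [d d0 Hd] := E n x e e0.
    exists d => // h hd; apply: le_trans (Hd h hd); apply: le_trans (Re_le_cabs _).
    by rewrite !ReImE/= mulr0 subr0.
  have [M [A b]] := bF n; exists M, A => x; exact: le_trans (Re_le_cabs _) (b x).
rewrite (_ : (fun x => _) = (fun x => Im (F 0%N x%:C) * expR (- (dl * x ^+ 2)))); last first.
  by apply/funext => x; rewrite ImM/= mulr0 add0r.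
apply: (@damped_schwartz_real _ (fun n x => Im (F n x%:C)) dl dl0) => n.
  move=> x; apply: is_derive_eps => e e0; have [d d0 Hd] := E n x e e0.
  exists d => // h hd; apply: le_trans (Hd h hd); apply: le_trans (Im_le_cabs _).
  by rewrite !ReImE/= mulr0 add0r.
have [M [A b]] := bF n; exists M, A => x; exact: le_trans (Im_le_cabs _) (b x).
Qed.

Lemma schwartz_cgauss (k b : C) (dl : R) : 0 < dl ->
  schwartz (fun x => k * cexp (b * x%:C - (dl * x ^+ 2)%:C)).
Proof.
move=> dl0; have := @schwartz_damped (fun n z => k * b ^+ n * cexp (b * z)) dl dl0.
under eq_fun do rewrite expr0 mulr1 -mulrA -cexp_real -cexpD real_complexN; apply=> n.
  by move=> z; rewrite exprSr mulrA -[X in cderiv _ _ X]mulrA; apply: cderivZ; exact: cderiv_cexpM.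
exists (cabs (k * b ^+ n)), (cabs b) => x.
rewrite cabsM cabs_cexp ler_wpM2l ?cabs_ge0// ler_expR.
by rewrite (le_trans (ler_norm _))// (le_trans (Re_le_cabs _))// cabsM cabs_real.
Qed.

Definition laplace (w : R -> C) (z : C) : C :=
  c0%:C * cint (fun xi => w xi * cexp ('i%C * z * xi%:C)).

Lemma laplace_real w (x : R) : laplace w x%:C = inv_fourier w x.
Proof.
rewrite /laplace /inv_fourier; congr (_ * cint _); apply/funext => xi.
by rewrite -mulrA -real_complexM.
Qed.

Lemma cabs_cexp_iz (z : C) (xi : R) : cabs (cexp ('i%C * z * xi%:C)) = expR (- Im z * xi).
Proof. by rewrite cabs_cexp !ReImE/= !(mul0r, mulr0, mul1r, subr0, add0r, addr0, sub0r). Qed.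

Lemma cmeas_cexpM (b : C) : cmeas (fun xi : R => cexp (b * xi%:C)).
Proof. by apply/cmeas_cexp/cmeasM; [exact: cmeas_cst|exact: cmeas_real]. Qed.

Section compact_support.
Variables (B : R) (w : R -> C).
Hypotheses (B0 : 0 <= B) (iw : cintegrable w) (wB : forall xi, B < `|xi| -> w xi = 0).

Lemma supp_le (z : C) (xi M : R) : (`|xi| <= B -> cabs z <= M) ->
  cabs (w xi * z) <= M * cabs (w xi).
Proof.
move=> H; have [xB|/wB ->] := leP `|xi| B; last by rewrite mul0r cabs0 mulr0.
by rewrite cabsM mulrC ler_wpM2r ?cabs_ge0// H.
Qed.

Lemma supp_cintegrable (g : R -> C) (M : R) : cmeas g ->
  (forall xi, `|xi| <= B -> cabs (g xi) <= M) -> cintegrable (fun xi => w xi * g xi).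
Proof.
move=> mg H.
apply: (cintegrable_le _ (rintegrableZ M (cintegrable_abs iw))).
  by apply: cmeasM => //; exact: cintegrable_cmeas.
by move=> xi; apply: supp_le; exact: H.
Qed.

Lemma supp_cint_bound (g : R -> C) (M : R) : cmeas g ->
  (forall xi, `|xi| <= B -> cabs (g xi) <= M) ->
  cabs (cint (fun xi => w xi * g xi)) <= M * \int[mu]_xi cabs (w xi).
Proof.
move=> mg H; rewrite -RintegralZl//; last exact: cintegrable_abs.
apply: le_cabs_cint_bound; last by move=> xi; apply: supp_le; exact: H.
  by apply: cmeasM => //; exact: cintegrable_cmeas.
exact: rintegrableZ (cintegrable_abs iw).
Qed.

Lemma cexp_iz_supp (z : C) (xi : R) : `|xi| <= B ->
  cabs (cexp ('i%C * z * xi%:C)) <= expR (B * `|Im z|).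
Proof.
move=> xB; rewrite cabs_cexp_iz ler_expR (le_trans (ler_norm _))// normrM normrN mulrC.
by rewrite ler_wpM2r.
Qed.

Lemma laplace_cintegrable (z : C) :
  cintegrable (fun xi => w xi * cexp ('i%C * z * xi%:C)).
Proof.
by apply: (supp_cintegrable (cmeas_cexpM _)) => xi; exact: cexp_iz_supp.
Qed.

Lemma laplace_bound (z : C) :
  cabs (laplace w z) <= c0 * \int[mu]_xi cabs (w xi) * expR (B * `|Im z|).
Proof.
rewrite cabsM cabs_real ger0_norm ?c0_ge0// -mulrA ler_wpM2l ?c0_ge0// [leRHS]mulrC.
by apply: (supp_cint_bound (cmeas_cexpM _)) => xi; exact: cexp_iz_supp.
Qed.

(** Differentiation under the integral sign by a direct estimate: on the support of [w] the
    remainder of [cexp_expand] is quadratic in the increment, uniformly in xi. *)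
Lemma laplace_cderiv (z : C) : cderiv (laplace w) z (laplace (fun xi => 'i%C * xi%:C * w xi) z).
Proof.
have miz (b : C) : cmeas (fun xi : R => b * xi%:C).
  by apply: cmeasM; [exact: cmeas_cst|exact: cmeas_real].
have i1 := laplace_cintegrable z.
have mi2 : cmeas (fun xi : R => 'i%C * xi%:C * cexp ('i%C * z * xi%:C)).
  by apply: cmeasM => //; exact: cmeas_cexpM.
have i2 : cintegrable (fun xi : R => w xi * ('i%C * xi%:C * cexp ('i%C * z * xi%:C))).
  apply: (@supp_cintegrable _ (B * expR (B * `|Im z|))) => // xi xB.
  rewrite !cabsM cabs_i mul1r cabs_real ler_pM ?mulr_ge0 ?cabs_ge0//.
  exact: cexp_iz_supp.
apply: (@cderiv_sqr _ _ _ (c0 * (expR (B * `|Im z|) * (6 * B ^+ 2 * expR B) * \int[mu]_xi cabs (w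
  xi)))) => h h1.
pose g (xi : R) := cexp ('i%C * z * xi%:C) * (cexp ('i%C * h * xi%:C) - 1 - 'i%C * h * xi%:C).
have mg : cmeas g.
  apply: cmeasM; first exact: cmeas_cexpM.
  apply: cmeasB; last exact: miz.
  by apply: cmeasB; [exact: cmeas_cexpM|exact: cmeas_cst].
have -> : laplace w (z + h) - laplace w z - laplace (fun xi => 'i%C * xi%:C * w xi) z * h =
    c0%:C * cint (fun xi => w xi * g xi).
  rewrite /laplace -mulrA -!mulrBr; congr (_ * _).
  rewrite [X in X * h](_ : _ = cint (fun xi : R => w xi * ('i%C * xi%:C * cexp ('i%C * z *
    xi%:C)))); last first.
    by congr cint; apply/funext => xi; rewrite -mulrA mulrCA.
  rewrite [X in _ - X]mulrC -cintZ// -!cintB//; last 3 first.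
  - exact: cintegrableB (laplace_cintegrable _) i1.
  - exact: cintegrableZ.
  - exact: laplace_cintegrable.
  congr cint; apply/funext => xi; rewrite /g mulrDr mulrDl cexpD; ring.
rewrite cabsM cabs_real ger0_norm ?c0_ge0// -[leRHS]mulrA; apply: ler_wpM2l; rewrite ?c0_ge0//.
rewrite mulrAC; apply: (supp_cint_bound mg) => xi xB; rewrite cabsM -[leRHS]mulrA.
apply: ler_pM; rewrite ?cabs_ge0//; first exact: cexp_iz_supp.
apply: (cexp_expand_scale (ltW h1) B0).
by rewrite !cabsM cabs_i mul1r cabs_real mulrC ler_wpM2r ?cabs_ge0.
Qed.

End compact_support.


Lemma laplace_entire (B : R) w : 0 <= B -> cintegrable w -> (forall xi, B < `|xi| -> w xi = 0) ->
  entire (laplace w).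
Proof. by move=> B0 iw wB; exact: cderiv_entire (laplace_cderiv B0 iw wB). Qed.

(** The successive derivatives of the transform are the transforms of (i xi)^k w. These are again
    integrable with support in [-B, B], so all derivatives are bounded on the real line. *)
Lemma schwartz_laplace_damped (B : R) w n : 0 <= B -> cintegrable w ->
  (forall xi, B < `|xi| -> w xi = 0) ->
  schwartz (fun x => inv_fourier w x * (damp n x)%:C).
Proof.
move=> B0 iw wB; pose W k (xi : R) := ('i%C * xi%:C) ^+ k * w xi.
have WB k xi : B < `|xi| -> W k xi = 0 by move=> /wB; rewrite /W => ->; rewrite mulr0.
have iW k : cintegrable (W k).
  rewrite /W; under eq_fun do rewrite mulrC.
  apply: (@supp_cintegrable B w iw wB _ (B ^+ k)).
    elim: k => [|k IH]; first by under eq_fun do rewrite expr0; exact: cmeas_cst.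
    under eq_fun do rewrite exprS; apply: cmeasM => //.
    by apply: cmeasM; [exact: cmeas_cst|exact: cmeas_real].
  move=> xi xB; elim: k => [|k IH]; first by rewrite !expr0 cabs1.
  rewrite !exprS !cabsM cabs_i mul1r cabs_real ler_pM ?cabs_ge0//.
have d0 : 0 < (4 * n.+1%:R)^-1 :> R by rewrite invr_gt0.
have := @schwartz_damped (fun k => laplace (W k)) _ d0.
have W0 : W 0%N = w by apply/funext => xi; rewrite /W expr0 mul1r.
have WS k : (fun xi => 'i%C * xi%:C * W k xi) = W k.+1.
  by apply/funext => xi; rewrite /W exprS mulrA.
under eq_fun do rewrite laplace_real W0; apply=> k.
  by move=> z; rewrite -WS; exact: (laplace_cderiv B0 (iW k) (WB k)).
exists (c0 * \int[mu]_xi cabs (W k xi)), 0 => x; rewrite mul0r.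
by have := laplace_bound (iW k) (WB k) x%:C; rewrite /= normr0 mulr0.
Qed.

End exponential_families.

(** * Pairing with Gaussian tests and decay of entire functions of exponential type *)

Section weights.
Context {R : realType}.
Variable s : R.
Hypotheses (s0 : 0 < s) (s12 : s < 2^-1).
Local Notation C := R[i].
Local Notation mu := (@lebesgue_measure R).
Local Notation cint := (cintegral setT).
Local Notation rintegrable h := (mu.-integrable setT (fun x => (h x)%:E)).
Local Notation L2 := (@in_Lp R 2).

Definition inb (A x : R) : R := (`|x| <= A)%R%:R.

Lemma inbE A : inb A = \1_`[- A, A].
Proof. by apply/funext => x; rewrite /inb indicE mem_setE in_itv/= ler_norml. Qed.

Lemma rintegrable_inb A : rintegrable (inb A).
Proof. by rewrite inbE; exact: rintegrable_indic. Qed.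

Lemma measurable_inb A : measurable_fun setT (inb A).
Proof. exact: rintegrable_meas (rintegrable_inb A). Qed.

Lemma Rintegral_inb A : 0 <= A -> \int[mu]_x inb A x = 2 * A.
Proof. by move=> A0; rewrite inbE Rintegral_indic ?opprK ?mulr_natl// ge0_cp. Qed.

Lemma inb_ge0 A x : 0 <= inb A x. Proof. by rewrite /inb. Qed.

Lemma inb_le1 A x : inb A x <= 1. Proof. by rewrite /inb; case: (`|x| <= A)%R. Qed.

Lemma inb_in A x : `|x| <= A -> inb A x = 1.
Proof. by rewrite /inb => ->. Qed.

Lemma inb_out A x : A < `|x| -> inb A x = 0.
Proof. by rewrite /inb => /lt_geF ->. Qed.

(** The inverse of the multiplier |x|^s. Since s is nonzero, its value at 0 is 0 by the convention
    for [powR], so the two cancel only off the origin, as in [wtK]. *)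
Definition wt (x : R) : R := `|x| `^ (- s).

Lemma wt_ge0 x : 0 <= wt x. Proof. exact: powR_ge0. Qed.

Lemma wt_sqr x : wt x ^+ 2 = `|x| `^ (- 2 * s).
Proof. by rewrite /wt -powR_mulrn ?powR_ge0// -powRrM; congr (_ `^ _); ring. Qed.

Lemma measurable_wt : measurable_fun setT wt.
Proof. exact: (measurable_abs_powR (- s)). Qed.

Lemma wt_le (e x : R) : 0 < e -> e <= `|x| -> wt x <= e `^ (- s).
Proof.
move=> e0 ex; rewrite /wt !powRN lef_pV2 ?posrE ?powR_gt0 ?(lt_le_trans e0)//.
by apply: ge0_ler_powR => //; rewrite ?nnegrE ltW.
Qed.

(** On A / 2 < |x| <= A the squared weight is at most (A / 2)^(-2 s), which over the length 2 A
    gives 2 * 2^(2 s) A^(1 - 2 s). Halving A multiplies this by q < 1, and K sums the geometric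
    series. *)
Let q : R := 2 `^ (- (1 - 2 * s)).
Let K : R := 2 * 2 `^ (2 * s) / (1 - q).

Definition wt_const : R := K.

Let q_lt1 : q < 1.
Proof.
rewrite /q powRN invf_lt1 ?powR_gt0//.
have p0 : 0 < 1 - 2 * s by rewrite subr_gt0 -ltr_pdivlMl// mulr1.
have := @gt0_ltr_powR _ _ p0 1 2; rewrite powR1; apply; rewrite ?nnegrE//.
by rewrite ltr1n.
Qed.

Lemma wt_const_ge0 : 0 <= wt_const.
Proof. by rewrite /wt_const divr_ge0 ?mulr_ge0 ?powR_ge0// subr_ge0 ltW. Qed.

(** The squared weight on the annulus A / 2^n < |x| <= A, away from its singularity; n dyadic layers
    are peeled off one at a time from the outside. *)
Let shell n (A x : R) : R := (inb A x - inb (A * 2^-1 ^+ n) x) * wt x ^+ 2.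

Let shell_half n (A x : R) : 0 < A ->
  shell n.+1 A x <= 2 `^ (2 * s) * A `^ (- 2 * s) * inb A x + shell n (A / 2) x.
Proof.
move=> A0; rewrite /shell [2^-1 ^+ n.+1]exprS (mulrA A).
have -> : inb A x - inb (A / 2 * 2^-1 ^+ n) x =
  (inb A x - inb (A / 2) x) + (inb (A / 2) x - inb (A / 2 * 2^-1 ^+ n) x) by ring.
rewrite mulrDl lerD2r.
have [xA|xA] := leP `|x| A; last first.
  rewrite (inb_out xA) inb_out ?subrr ?mul0r ?mulr0// (le_lt_trans _ xA)//.
  by rewrite ger_pMr// invf_le1// ler1n.
have [xA2|xA2] := leP `|x| (A / 2).
  by rewrite !inb_in// subrr mul0r mulr1 mulr_ge0// powR_ge0.
rewrite (inb_in xA) (inb_out xA2).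
have A20 : 0 < A / 2 by rewrite divr_gt0.
rewrite subr0 mul1r mulr1; apply: le_trans (_ : _ <= ((A / 2) `^ (- s)) ^+ 2) _.
  by rewrite ler_sqr ?nnegrE ?wt_ge0 ?powR_ge0// wt_le// ltW.
rewrite -powR_mulrn ?powR_ge0// -powRrM (_ : - s * 2 = - 2 * s); last by ring.
rewrite (powRM _ (ltW A0)) ?invr_ge0// [leRHS]mulrC ler_wpM2l ?powR_ge0//.
by rewrite -powR_inv1// -powRrM (_ : -1 * (- 2 * s) = 2 * s)//; ring.
Qed.

Let shell_ge0 n (A x : R) : 0 < A -> 0 <= shell n A x.
Proof.
move=> A0; rewrite mulr_ge0 ?sqr_ge0// subr_ge0.
have [xA|xA] := leP `|x| A; first by rewrite (inb_in xA) inb_le1.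
by rewrite (inb_out xA) inb_out// (le_lt_trans _ xA)// ger_pMr// exprn_ile1// invf_le1// ler1n.
Qed.

Let shell_meas n A : measurable_fun setT (shell n A).
Proof.
apply: measurable_funM; first by apply: measurable_funB; exact: measurable_inb.
by apply: measurable_funX; exact: measurable_wt.
Qed.

Let shell_integral n (A : R) : 0 < A ->
  rintegrable (shell n A) /\ \int[mu]_x shell n A x <= K * A `^ (1 - 2 * s).
Proof.
elim: n A => [|n IH] A A0.
  rewrite (_ : shell 0 A = fun=> 0); last first.
    by apply/funext => x; rewrite /shell expr0 mulr1 subrr mul0r.
  split; first exact: integrable0.
  by rewrite /Rintegral integral0 mulr_ge0 ?powR_ge0//; exact: wt_const_ge0.
have A20 : 0 < A / 2 by rewrite divr_gt0.
have [i b] := IH _ A20.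
have i1 := rintegrableZ (2 `^ (2 * s) * A `^ (- 2 * s)) (rintegrable_inb A).
have i2 := rintegrableD i1 i.
have ile : rintegrable (shell n.+1 A).
  apply: (rintegrable_le (shell_meas _ _) i2) => x.
  by rewrite ger0_norm ?shell_ge0// shell_half.
split=> //; apply: le_trans (_ : _ <= \int[mu]_x (2 `^ (2 * s) * A `^ (- 2 * s) * inb A x + shell
  n (A / 2) x)) _.
  by apply: le_Rintegral => // x _; exact: shell_half.
rewrite RintegralD// RintegralZl//; last exact: rintegrable_inb.
rewrite (Rintegral_inb (ltW A0));
  apply: le_trans (_ : _ <= 2 `^ (2 * s) * A `^ (- 2 * s) * (2 * A) + K * (A / 2) `^ (1 - 2 * s))
    _; first by rewrite lerD2l.
have -> : A `^ (1 - 2 * s) = A * A `^ (- 2 * s).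
  rewrite (_ : 1 - 2 * s = 1 + - 2 * s); last by ring.
  by rewrite powRD ?(powRr1 (ltW A0)) ?(gt_eqF A0) ?implybT.
have -> : (A / 2) `^ (1 - 2 * s) = A * A `^ (- 2 * s) * q.
  rewrite (powRM _ (ltW A0)) ?invr_ge0//; congr (_ * _).
    rewrite (_ : 1 - 2 * s = 1 + - 2 * s); last by ring.
    by rewrite powRD ?(powRr1 (ltW A0)) ?(gt_eqF A0) ?implybT.
  by rewrite -powR_inv1// -powRrM mulN1r.
move: (A `^ (- 2 * s)) => p.
rewrite le_eqVlt; apply/orP; left; apply/eqP; rewrite /K; field.
by rewrite subr_eq0 eq_sym lt_eqF.
Qed.

(** Fatou over the annuli. The positivity of 1 - 2 s makes the integral finite, and the exact power
    of A is what later matches the exponent 2^* in the Sobolev inequality. *)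
Lemma wt_sqr_inb (A : R) : 0 < A -> rintegrable (fun x => inb A x * wt x ^+ 2) /\
  \int[mu]_x (inb A x * wt x ^+ 2) <= wt_const * A `^ (1 - 2 * s).
Proof.
move=> A0; apply: (@Rfatou _ (fun n => shell n A)).
- by move=> n; exact: (shell_integral n A0).1.
- apply: measurable_funM; first exact: measurable_inb.
  by apply: measurable_funX; exact: measurable_wt.
- by move=> n x; exact: shell_ge0.
- apply: ae_mono (ae_neq 0) => x /eqP x0; apply: cvg_near_cst.
  have c : A * 2^-1 ^+ n @[n --> \oo] --> A * 0.
    apply: cvgM; first exact: cvg_cst.
    by apply: cvg_expr; rewrite ger0_norm// invf_lt1// ltr1n.
  rewrite mulr0 in c; move/cvgrPdist_lt : c => /(_ `|x|); rewrite normr_gt0 => /(_ x0).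
  apply: filterS => n; rewrite sub0r normrN ger0_norm ?mulr_ge0 ?exprn_ge0 ?ltW// => h.
  by rewrite /shell (inb_out h) subr0.
- by move=> n; exact: (shell_integral n A0).2.
Qed.

Lemma wt_inb_L2 (A : R) : 0 < A -> L2 (fun x => (inb A x * wt x)%:C) /\
  N2 (fun x => (inb A x * wt x)%:C) ^+ 2 <= wt_const * A `^ (1 - 2 * s).
Proof.
move=> A0; have [i b] := wt_sqr_inb A0.
have E x : (inb A x * wt x) ^+ 2 = inb A x * wt x ^+ 2.
  by rewrite exprMn; congr (_ * _); rewrite /inb; case: (`|x| <= A); rewrite ?expr1n ?expr0n.
have L : L2 (fun x => (inb A x * wt x)%:C).
  apply: L2_real; last by under eq_fun do rewrite E.
  by apply: measurable_funM; [exact: measurable_inb|exact: measurable_wt].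
split=> //; rewrite N2_sqr//; apply: le_trans b; rewrite le_eqVlt; apply/orP; left; apply/eqP.
by apply: eq_Rintegral => x _; rewrite cabs_real real_normK ?num_real// E.
Qed.

Lemma wt_tail_L2 : L2 (fun x => (wt x * (oneDsqr x)^-1)%:C).
Proof.
have m : measurable_fun setT (fun x => wt x * (oneDsqr x)^-1).
  apply: measurable_funM; first exact: measurable_wt.
  exact: rintegrable_meas rintegrable_oneDsqrV.
have [i _] := wt_sqr_inb ltr01.
apply: L2_real => //; apply: (rintegrable_le _ (rintegrableD i rintegrable_oneDsqrV)).
  by apply: measurable_funX.
move=> x; rewrite ger0_norm ?sqr_ge0// exprMn /inb.
have := oneDsqr_ge1 x; move: (oneDsqr x) => t t1.
have t0 : 0 <= t^-1 by rewrite invr_ge0 (le_trans _ t1).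
have t1' : t^-1 <= 1 by rewrite invf_le1// (lt_le_trans _ t1).
have [x1|x1] := leP `|x| 1; first by rewrite mul1r ler_wpDr// ler_piMr ?sqr_ge0// exprn_ile1.
rewrite mul0r add0r expr2 (mulrA _ t^-1) ler_piMl// mulr_ile1 ?sqr_ge0//.
have w1 : wt x <= 1 by rewrite (le_trans (wt_le ltr01 (ltW x1)))// powR1.
  by rewrite mulr_ile1 ?wt_ge0.
Qed.

Lemma wtK (x : R) : x != 0 -> wt x * `|x| `^ s = 1.
Proof. by move=> x0; rewrite /wt powRN mulVf// gt_eqF// powR_gt0 ?normr_gt0. Qed.

Lemma wt_schwartz_L2 (psi : R -> C) : schwartz psi -> L2 (fun x => (wt x)%:C * psi x).
Proof.
move=> [sr si]; have [M b] := schwartz_real_bound sr; have [N c] := schwartz_real_bound si.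
have [L _] := L2Z (M + N)%:C wt_tail_L2.
apply: (L2_le _ L) => [|x].
  apply: cmeasM; first exact: (cmeas_real measurable_wt).
  by apply/cintegrable_cmeas/schwartz_cintegrable.
rewrite !cabsM !cabs_real !normrM (ger0_norm (wt_ge0 x)) mulrCA ler_wpM2l ?wt_ge0//.
rewrite -normrM (le_trans _ (ler_norm _))// mulrDl.
by rewrite (le_trans (cabs_le_ReIm _))// lerD.
Qed.

End weights.

(** * Action of a tempered limit on Gaussians, expressed through the spectral function *)

Section pairing.
Context {R : realType}.
Variable s : R.
Hypotheses (s0 : 0 < s) (s12 : s < 2^-1).
Local Notation C := R[i].
Local Notation mu := (@lebesgue_measure R).
Local Notation cint := (cintegral setT).
Local Notation rintegrable h := (mu.-integrable setT (fun x => (h x)%:E)).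
Local Notation L2 := (@in_Lp R 2).
Local Notation c0 := ((Num.sqrt (2 * pi : R))^-1).
Local Notation wt := (wt s).

Lemma ccvgP (u : nat -> C) (l : C) : (u n @[n --> \oo] --> (l : C^o)) <-> ccvg u l.
Proof.
have E := @cvgrPdist_lt C C^o nat \oo _ (u : nat -> C^o) l.
split=> [/E H|/cvgrPdist_lt H].
  apply/cvgrPdist_lt => e e0; have /H : (0 : C) < e%:C by rewrite ltcR.
  by apply: filterS => n; rewrite normCE ltcR cabsBC sub0r normrN ger0_norm ?cabs_ge0.
apply/E => e /posC_real[r r0 ->]; move/(_ _ r0) : H.
by apply: filterS => n; rewrite normCE ltcR cabsBC sub0r normrN ger0_norm ?cabs_ge0.
Qed.

Lemma fourier_gauss (k b : C) (d : R) (x : R) : 0 < d ->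
  fourier (fun xi => k * cexp (b * xi%:C - (d * xi ^+ 2)%:C)) x =
  k * (c0 * Num.sqrt (pi / d))%:C * cexp ((b - 'i%C * x%:C) * (b - 'i%C * x%:C) * ((4 * d)^-1)%:C).
Proof.
move=> d0; have [i e] := cgauss_integral (b - 'i%C * x%:C) d0.
rewrite /fourier; under eq_fun do rewrite -mulrA -cexpD.
rewrite (_ : (fun xi : R => k * cexp (_ + _)) =
  (fun xi : R => k * cexp ((b - 'i%C * x%:C) * xi%:C - (d * xi ^+ 2)%:C))); last first.
  by apply/funext => xi; congr (_ * cexp _); rewrite real_complexM; ring.
by rewrite cintZ// e real_complexM; ring.
Qed.

Section approximants.
Variables (f_ : nat -> R -> C) (T : functional R) (G : R -> C).
Let G_ n (xi : R) : C := (`|xi| `^ s)%:C * fourier (f_ n) xi.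
Hypotheses (sf : forall n, schwartz (f_ n)) (cT : tempered_cvg (fun n => distr_of (f_ n)) T)
  (LG : L2 G) (cG : N2 (fun xi => G_ n xi - G xi) @[n --> \oo] --> (0 : R)).

(* |xi|^-s |xi|^s = 1 almost everywhere. *)
Lemma tempered_limit_pairing (psi : R -> C) : schwartz psi -> schwartz (fourier psi) ->
  T (fourier psi) = cint (fun xi => (wt xi)%:C * G xi * psi xi).
Proof.
have s01 : 0 <= s <= 1 by rewrite ltW//= (le_trans (ltW s12))// invf_le1// ler1n.
move=> sp sFp; have Lp := wt_schwartz_L2 s0 s12 sp.
have c1 := (ccvgP _ _).1 (cT sFp).
apply: (ccvg_unique c1).
have c2 : N2 (fun xi => G_ n xi - G xi) * N2 (fun xi => (wt xi)%:C * psi xi) @[n --> \oo] --> (0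
  : R).
  by apply: (cvg_eq_lim (mul0r (N2 (fun xi => (wt xi)%:C * psi xi)))); apply: cvgM => //;
    exact: cvg_cst.
apply: (ccvg_le c2) => n.
have [_ LGn] := schwartz_weighted_fourier s01 (sf n).
have [i1 _] := L2M LGn Lp; have [i2 _] := L2M LG Lp.
have -> : distr_of (f_ n) (fourier psi) = cint (fun xi => G_ n xi * ((wt xi)%:C * psi xi)).
  rewrite /distr_of -fourier_mult; try exact: schwartz_cintegrable.
  apply: ae_eq_cint.
  - apply: cmeasM; first exact/fourier_cmeas/schwartz_cintegrable.
    exact/cintegrable_cmeas/schwartz_cintegrable.
  - exact: cintegrable_cmeas i1.
  - apply: ae_mono (ae_neq 0) => xi /eqP xi0; rewrite /G_ mulrACA -real_complexM.
    by rewrite [X in X%:C]mulrC wtK// mul1r.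
rewrite (_ : (fun xi => (wt xi)%:C * G xi * psi xi) = (fun xi => G xi * ((wt xi)%:C * psi xi)));
  last first.
  by apply/funext => xi; rewrite mulrA [G xi * _]mulrC.
rewrite -cintB//; have [LB _] := L2B LGn LG; have [_] := L2M LB Lp.
by under eq_fun do rewrite mulrBl.
Qed.

(** One formula with free complex parameters. The specialisations below choose them so that the
    argument of [T] becomes a Gaussian centred at a complex point, or a wide Gaussian modulated by a
    real frequency. *)
Lemma tempered_limit_gauss (k b : C) (d : R) : 0 < d ->
  T (fun x => k * (c0 * Num.sqrt (pi / d))%:C *
       cexp ((b - 'i%C * x%:C) * (b - 'i%C * x%:C) * ((4 * d)^-1)%:C)) =
  cint (fun xi => (wt xi)%:C * G xi * (k * cexp (b * xi%:C - (d * xi ^+ 2)%:C))).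
Proof.
move=> d0; rewrite -tempered_limit_pairing.
- by congr T; apply/funext => x; rewrite fourier_gauss.
- exact: schwartz_cgauss.
have -> : fourier (fun xi => k * cexp (b * xi%:C - (d * xi ^+ 2)%:C)) =
    (fun x => k * (c0 * Num.sqrt (pi / d))%:C * cexp (b * b * ((4 * d)^-1)%:C) *
      cexp (- 'i%C * b * ((2 * d)^-1)%:C * x%:C - ((4 * d)^-1 * x ^+ 2)%:C)); last first.
  by apply: schwartz_cgauss; rewrite invr_gt0 mulr_gt0.
apply/funext => x; rewrite fourier_gauss// -[RHS]mulrA -cexpD; congr (_ * cexp _).
have i2 : 'i%C * 'i%C = -1 :> C by rewrite -expr2 sqr_i.
have -> : ((2 * d)^-1)%:C = 2 * ((4 * d)^-1)%:C :> C.
  rewrite (_ : (2 * d)^-1 = 2 * (4 * d)^-1); first by rewrite real_complexM rmorphMn rmorph1.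
  by field; rewrite gt_eqF.
rewrite real_complexM expr2 real_complexM.
rewrite [LHS](_ : _ = b * b * ((4 * d)^-1)%:C + - 'i%C * b * (2 * ((4 * d)^-1)%:C) * x%:C +
  ('i%C * 'i%C) * (((4 * d)^-1)%:C * (x%:C * x%:C))); last by ring.
by rewrite i2 mulN1r -addrA.
Qed.

(** The kernel [gk n] continued to complex arguments, so that it can be centred off the real
    line. *)
Definition gkC n (z : C) : C := (Num.sqrt (n.+1%:R / pi))%:C * cexp (- (n.+1%:R%:C * (z * z))).

Lemma tempered_limit_gkC n (c : C) :
  T (fun x => gkC n (x%:C - c)) =
  cint (fun xi => (wt xi)%:C * G xi * (c0%:C * (cexp ('i%C * c * xi%:C) * (damp n xi)%:C))).
Proof.
have n0 : 0 < n.+1%:R :> R by [].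
have d0 : 0 < (4 * n.+1%:R)^-1 :> R by rewrite invr_gt0 mulr_gt0.
have := tempered_limit_gauss c0%:C ('i%C * c) d0.
have -> : (4 * (4 * n.+1%:R)^-1)^-1 = n.+1%:R :> R by field.
rewrite -real_complexM c0_peak// => e; transitivity (T (fun x => (Num.sqrt (n.+1%:R / pi))%:C *
    cexp (('i%C * c - 'i%C * x%:C) * ('i%C * c - 'i%C * x%:C) * n.+1%:R%:C))).
  congr T; apply/funext => x; congr (_ * cexp _).
  have i2 : 'i%C * 'i%C = -1 :> C by rewrite -expr2 sqr_i.
  rewrite [RHS](_ : _ = 'i%C * 'i%C * (n.+1%:R%:C * ((x%:C - c) * (x%:C - c)))); last by ring.
  by rewrite i2 mulN1r.
rewrite e; congr cint; apply/funext => xi; congr (_ * (_ * _)).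
by rewrite cexpD -real_complexN cexp_real.
Qed.

(** The right-hand side is a local average of |xi|^-s G around the frequency [t], while the
    left-hand side can be estimated by moving contours. *)
Lemma tempered_limit_modulated n (t : R) :
  T (fun x => c0%:C * (cexp (- ('i%C * (x * t)%:C)) * (damp n x)%:C)) =
  cint (fun xi => (wt xi)%:C * G xi * (gk n (xi - t))%:C).
Proof.
have n0 : 0 < n.+1%:R :> R by [].
have := tempered_limit_gauss (Num.sqrt (n.+1%:R / pi) * expR (- (n.+1%:R * t ^+ 2)))%:C
  (2 * n.+1%:R * t)%:C n0.
have p1 : Num.sqrt (n.+1%:R / pi) * Num.sqrt (pi / n.+1%:R) = 1 :> R.
  by rewrite -sqrtrM ?divr_ge0 ?pi_ge0// mulrA divfK ?gt_eqF ?pi_gt0// divff ?gt_eqF// sqrtr1.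
move=> e; transitivity (T (fun x => (Num.sqrt (n.+1%:R / pi) * expR (- (n.+1%:R * t ^+ 2)))%:C *
   (c0 * Num.sqrt (pi / n.+1%:R))%:C * cexp (((2 * n.+1%:R * t)%:C - 'i%C * x%:C) *
     ((2 * n.+1%:R * t)%:C - 'i%C * x%:C) * ((4 * n.+1%:R)^-1)%:C))).
  congr T; apply/funext => x.
  have E1 : Num.sqrt (n.+1%:R / pi) * expR (- (n.+1%:R * t ^+ 2)) * (c0 * Num.sqrt (pi / n.+1%:R)) =
      c0 * expR (- (n.+1%:R * t ^+ 2)) :> R.
    by rewrite mulrCA mulrAC p1 mul1r.
  rewrite -real_complexM E1.
  rewrite (real_complexM c0) -(cexp_real (- (n.+1%:R * t ^+ 2))) -[RHS]mulrA -cexpD; congr (_ * _).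
  rewrite /damp -cexp_real -cexpD; congr cexp.
  have v4 : 4 * n.+1%:R%:C * ((4 * n.+1%:R)^-1)%:C = 1 :> C.
    rewrite (_ : 4 = (4 : R)%:C) -?real_complexM ?divff ?mulf_neq0// ?gt_eqF//.
    by rewrite rmorphMn rmorph1.
  have i2 : 'i%C * 'i%C = -1 :> C by rewrite -expr2 sqr_i.
  rewrite !real_complexN !real_complexM.
  rewrite (_ : 2%:C = 2 :> C) ?(rmorphMn, rmorph1)//.
  have NC : n.+1%:R%:C = n.+1%:R :> C by rewrite rmorphMn rmorph1.
  rewrite NC in v4; move: (((4 * n.+1%:R)^-1)%:C) (n.+1%:R : C) v4 => v p v4.
  rewrite [RHS](_ : _ = - (p * (t%:C * t%:C)) + (4 * p * v) * (p * (t%:C * t%:C)) -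
    (4 * p * v) * ('i%C * (x%:C * t%:C)) + 'i%C * 'i%C * (v * (x%:C * x%:C))); last by ring.
  by rewrite v4 i2 !mul1r mulN1r addNr add0r.
rewrite e; congr cint; apply/funext => xi; congr (_ * _).
rewrite -real_complexM -real_complexN -real_complexD cexp_real -real_complexM; congr (_%:C).
rewrite /gk -[LHS]mulrA -expRD; congr (_ * expR _); ring.
Qed.

End approximants.
End pairing.

(* Otherwise unification unfolds [entire] down to filters and diverges. *)
Opaque entire.

(** * Decay of the windowed Fourier transform of a function of exponential type *)

Section exponential_type_decay.
Context {R : realType}.
Local Notation C := R[i].
Local Notation mu := (@lebesgue_measure R).
Local Notation cint := (cintegral setT).
Local Notation rintegrable h := (mu.-integrable setT (fun x => (h x)%:E)).
Local Notation c0 := ((Num.sqrt (2 * pi : R))^-1).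
Variables (f : C -> C) (A B : R).
Hypotheses (ef : entire f) (A0 : 0 < A) (B0 : 0 <= B)
  (fb : forall z, cabs (f z) <= B * expR (A * cabs z)).

Let h (dl t : R) (z : C) : C := f z * cexp (- (dl%:C * (z * z)) - 'i%C * t%:C * z).

Let h_entire dl t : entire (h dl t).
Proof.
have e1 : entire (fun z : C => - (dl%:C * (z * z))).
  rewrite (_ : (fun z => _) = (fun z : C => (- dl%:C) * (z * z))); last by apply/funext => z;
    rewrite mulNr.
  by apply: entireM; [exact: entire_cst|apply: entireM; exact: entire_id].
have e2 : entire (fun z : C => 'i%C * t%:C * z).
  by apply: entireM; [exact: entire_cst|exact: entire_id].
exact: (entireM ef (entire_comp (@entire_cexp R) (entireB e1 e2))).
Qed.

Let h_bound (dl t x y : R) : 0 < dl -> cabs (h dl t (x +i* y)) <=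
  B * expR (A ^+ 2 / (2 * dl) + A * `|y| + dl * y ^+ 2 + t * y) * expR (- (dl / 2 * x ^+ 2)).
Proof.
move=> dl0; rewrite /h cabsM cabs_cexp -[leRHS]mulrA -expRD.
apply: le_trans (ler_wpM2r (expR_ge0 _) (fb _)) _;
  rewrite -[leLHS]mulrA -expRD ler_wpM2l// ler_expR.
have cz : cabs (x +i* y) <= `|x| + `|y| by exact: cabs_le_ReIm.
apply: le_trans (_ : A * (`|x| + `|y|) + Re (- (dl%:C * ((x +i* y) * (x +i* y))) - 'i%C * t%:C *
  (x +i* y)) <= _).
  by rewrite lerD2r ler_wpM2l// ltW.
have -> : Re (- (dl%:C * ((x +i* y) * (x +i* y))) - 'i%C * t%:C * (x +i* y)) =
    - (dl * (x ^+ 2 - y ^+ 2)) + t * y by rewrite !ReImE/=; ring.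
rewrite -[x ^+ 2]real_normK ?num_real//; move: `|x| `|y| => u v.
(* Half of the Gaussian absorbs the growth A |x| at the cost of A^2 / (2 dl); the difference is a
   perfect square. *)
rewrite -subr_ge0 (_ : _ - _ = dl / 2 * (u - A / dl) ^+ 2); last by field; rewrite gt_eqF.
by rewrite mulr_ge0 ?sqr_ge0// divr_ge0// ltW.
Qed.

(* Integrate along the line of height -sgn(t) (|t| - A) / (2 dl), which minimizes
   the exponent. *)
Let h_shift (dl t : R) : 0 < dl -> 3 * A <= `|t| ->
  cabs (cint (fun x => h dl t x%:C)) <=
  B * expR (- (A ^+ 2 / (2 * dl))) * Num.sqrt (pi / (dl / 2)).
Proof.
move=> dl0 tA; pose L := (`|t| - A) / (2 * dl).
have L0 : 0 <= L by rewrite divr_ge0 ?mulr_ge0 ?ltW// subr_gt0 (lt_le_trans _ tA)// ltr_pMl// ltr1n.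
pose Y := - Num.sg t * L.
have nY : `|Y| <= L by rewrite normrM normrN (ger0_norm L0) ler_piMl// normr_sg; case: (_ != _).
have tY : t * Y = - (`|t| * L) by rewrite /Y mulNr mulrN mulrA mulrC (mulrC t) -normrEsg mulrC.
have [i e] := gauss_integral 0 (divr_gt0 dl0 (ltr0Sn R 1)).
pose M := B * expR (A ^+ 2 / (2 * dl) + A * `|Y| + dl * Y ^+ 2 + `|t| * `|Y|).
have hM x y : `|y| <= `|Y| -> cabs (h dl t (x +i* y)) <= M * expR (- (dl / 2 * x ^+ 2)).
  move=> yY; apply: le_trans (h_bound _ _ _ dl0) _.
  rewrite ler_wpM2r ?expR_ge0// ler_wpM2l// ler_expR !lerD//.
  - by rewrite ler_wpM2l// ltW.
  - by rewrite ler_wpM2l ?(ltW dl0)// ler_sqr_norm.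
  - by rewrite (le_trans (ler_norm _))// normrM ler_wpM2l.
rewrite (contour_shift (@h_entire dl t) (divr_gt0 dl0 (ltr0Sn R 1)) hM).
rewrite -e -RintegralZl//.
apply: le_cabs_cint_bound; first exact: rcont_cmeas (entire_rcont_h _ (@h_entire _ _)).
  exact: rintegrableZ.
move=> x; apply: le_trans (h_bound _ _ _ dl0) _; rewrite subr0.
rewrite ler_wpM2r ?expR_ge0// ler_wpM2l// ler_expR tY.
apply: le_trans (_ : A ^+ 2 / (2 * dl) + A * L + dl * L ^+ 2 - `|t| * L <= _).
  rewrite lerD2r; apply: lerD; first by rewrite lerD2l ler_wpM2l// ltW.
  by rewrite ler_wpM2l ?(ltW dl0)// ler_sqr_norm// (ger0_norm L0).
rewrite (_ : _ - _ = A ^+ 2 / (2 * dl) - (`|t| - A) ^+ 2 / (4 * dl)); last first.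
  by rewrite /L; field; rewrite gt_eqF.
(* Here |t| >= 3 A is used: then |t| - A >= 2 A, so the gain (|t| - A)^2 / (4 dl) is at least A^2 /
   dl, twice the loss. *)
rewrite lerBlDr -lerBlDl opprK -mulrDl ler_pdivlMr ?mulr_gt0//.
rewrite (_ : _ * (4 * dl) = (2 * A) ^+ 2); last by field; rewrite gt_eqF.
rewrite ler_sqr ?nnegrE; first by move: tA; rewrite lerBrDr; lra.
  by rewrite mulr_ge0// ltW.
by rewrite subr_ge0 (le_trans _ tA)// ler_peMl ?ltW// ltr1n.
Qed.

(** For dl = 1 / (4 (n + 1)) the exponent in [h_shift] is X = 2 (n + 1) A^2. The decay is
    exponential in n, but X^2 exp (-X) <= 4 against the prefactor 8 pi (n + 1) already leaves a rate
    1 / n, uniform in [t]. *)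
Lemma modulated_decay n (t : R) : 3 * A <= `|t| ->
  cabs (cint (fun x => f x%:C * (c0%:C * (cexp (- ('i%C * (x * t)%:C)) * (damp n x)%:C)))) <=
  c0 * (B * (8 * pi) / A ^+ 4) / n.+1%:R.
Proof.
move=> tA; have n0 : 0 < n.+1%:R :> R by [].
have d0 : 0 < (4 * n.+1%:R)^-1 :> R by rewrite invr_gt0 mulr_gt0.
rewrite (_ : (fun x => _) = (fun x => c0%:C * h (4 * n.+1%:R)^-1 t x%:C)); last first.
  apply/funext => x; rewrite mulrCA /h /damp -cexp_real -cexpD; congr (_ * (_ * cexp _)).
  by rewrite addrC !real_complexN !real_complexM; ring.
have ih : cintegrable (fun x => h (4 * n.+1%:R)^-1 t x%:C).
  apply: (cintegrable_le (h := fun x => B * expR (A ^+ 2 / (2 * (4 * n.+1%:R)^-1)) * expR (- ((4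
    * n.+1%:R)^-1 / 2 * x ^+ 2)))).
  - exact: rcont_cmeas (entire_rcont_h 0 (@h_entire _ _)).
  - exact: rintegrableZ (gauss_integral0 (divr_gt0 d0 (ltr0Sn R 1))).
  - move=> x; have := h_bound t x 0 d0.
    by rewrite normr0 expr0n !mulr0 !addr0.
rewrite (cintZ _ ih) cabsM cabs_real (ger0_norm (@c0_ge0 R)) -[leRHS]mulrA.
apply: ler_wpM2l (@c0_ge0 R) _ _ _.
apply: le_trans (h_shift d0 tA) _; rewrite -2![leRHS]mulrA -[leLHS]mulrA ler_wpM2l//.
have -> : A ^+ 2 / (2 * (4 * n.+1%:R)^-1) = 2 * n.+1%:R * A ^+ 2 by field.
have -> : pi / ((4 * n.+1%:R)^-1 / 2) = 8 * pi * n.+1%:R :> R by field.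
have p1 : 1 <= pi :> R by rewrite (le_trans _ (pi_ge2 _))// ler1n.
have s1 : Num.sqrt (8 * pi * n.+1%:R) <= 8 * pi * n.+1%:R :> R.
  have y1 : 1 <= 8 * pi * n.+1%:R :> R by rewrite !mulr_ege1// ler1n.
  rewrite -[leRHS]ger0_norm ?(le_trans _ y1)// -sqrtr_sqr ler_wsqrtr// expr2 ler_peMr// (le_trans
    _ y1)//.
have X0 : 0 < 2 * n.+1%:R * A ^+ 2 by rewrite !mulr_gt0// exprn_gt0.
have := expRN_le2 (ltW X0); rewrite -ler_pdivlMl ?exprn_gt0// => e2.
apply: le_trans (ler_pM (expR_ge0 _) (sqrtr_ge0 _) e2 s1) _.
rewrite le_eqVlt; apply/orP; left; apply/eqP; field.
by rewrite gt_eqF//= gt_eqF.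
Qed.

End exponential_type_decay.

(** * Weak convergence of Gaussian averages of a function that is integrable against 1 / (1 +
    x^2) *)

Section weak_approximation.
Context {R : realType}.
Local Notation C := R[i].
Local Notation mu := (@lebesgue_measure R).
Local Notation cint := (cintegral setT).
Local Notation rintegrable h := (mu.-integrable setT (fun x => (h x)%:E)).
Variables (g : R -> C) (a b : R).
Hypotheses (mg : cmeas g) (ig : rintegrable (fun x => cabs (g x) * (oneDsqr x)^-1)).

Let K : R := 1 + 2 * (`|a| + `|b|) ^+ 2.

(** From x^2 <= 2 t^2 + 2 (x - t)^2; the last term contributes at most 2 by [gk_le_inv2]. *)
Let gk_oneDsqr n (t x : R) : a <= t <= b -> oneDsqr x * gk n (x - t) <= K * gk n (x - t) + 2.
Proof.
move=> /andP[at_ tb]; have := gk_le_inv2 n (x - t); have := gk_ge0 n (x - t).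
have tm : `|t| <= `|a| + `|b|.
  have := ler_norm b; have := ler_normr a (- a) ; have := normr_ge0 b; have := normr_ge0 a.
  have := lerNnormlW (lexx `|a|).
  by move=> h1 h2 h3 h4 h5; rewrite ler_norml; apply/andP; split; lra.
have t2 : t ^+ 2 <= (`|a| + `|b|) ^+ 2 by rewrite ler_sqr_norm// (ger0_norm (addr_ge0 _ _)).
move: (gk n (x - t)) => y y0 y1; rewrite /oneDsqr /K.
have e1 : 1 + x ^+ 2 <= 1 + 2 * (`|a| + `|b|) ^+ 2 + 2 * (x - t) ^+ 2.
  have := sqr_ge0 (x - 2 * t); rewrite !sqrrB; lra.
apply: le_trans (ler_wpM2r y0 e1) _; rewrite mulrDl lerD2l -mulrA; lra.
Qed.

Let J n (x : R) : C := cint (fun t => (\1_`[a, b] t)%:C * (gk n (t - x))%:C).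

Let J_meas n : cmeas (J n).
Proof.
rewrite (_ : J n = gconv (fun x => (\1_`[a, b] x)%:C) n).
  apply: gconv_cmeas; have ii := rintegrable_indic a b.
  apply: (cintegrable_le (cmeas_real (rintegrable_meas ii)) ii) => x.
  by rewrite cabs_real ger0_norm// indic_ge0.
by apply/funext => x; rewrite /J /gconv; congr cint; apply/funext => t; rewrite gkBC.
Qed.

Let indic_gk_cintegrable n (x : R) :
  cintegrable (fun t => (\1_`[a, b] t)%:C * (gk n (t - x))%:C).
Proof.
have [i _] := gk_integral n x.
apply: (cintegrable_le _ i) => [|t].
  by apply: cmeasM; apply: cmeas_real; apply: rintegrable_meas => //; exact: rintegrable_indic.
rewrite -real_complexM cabs_real ger0_norm ?mulr_ge0 ?gk_ge0 ?indic_ge0//.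
by rewrite ler_piMl ?gk_ge0// indicE; case: (_ \in _).
Qed.

Let J_bound n (x : R) : a <= b -> cabs (J n x) <= (K + 2 * (b - a)) * (oneDsqr x)^-1.
Proof.
move=> ab; have t0 : 0 < oneDsqr x := lt_le_trans ltr01 (oneDsqr_ge1 x).
have [i e] := gk_integral n x; have ii := rintegrable_indic a b.
rewrite ler_pdivlMr// mulrC -[X in X * _](ger0_norm (ltW t0)) -cabs_real -cabsM /J.
have mi : cmeas (fun t => (\1_`[a, b] t)%:C * (gk n (t - x))%:C : C).
  by apply: cmeasM; apply: cmeas_real; exact: rintegrable_meas.
have i1 : rintegrable (fun t => K * gk n (t - x) + 2 * \1_`[a, b] t).
  by apply: rintegrableD; exact: rintegrableZ.
rewrite -(cintZ _ (indic_gk_cintegrable n x)).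
have -> : K + 2 * (b - a) = \int[mu]_t (K * gk n (t - x) + 2 * \1_`[a, b] t).
  have i2 := rintegrableZ K i; have i3 := rintegrableZ 2 ii.
  have E2 : \int[mu]_t (K * gk n (t - x)) = K by rewrite RintegralZl// e mulr1.
  have E3 : \int[mu]_t (2 * \1_`[a, b] t) = 2 * (b - a) by rewrite RintegralZl// Rintegral_indic.
  by rewrite RintegralD// E2 E3.
apply: le_cabs_cint_bound i1 _; first by apply: cmeasM => //; exact: cmeas_cst.
move=> t; rewrite -!real_complexM cabs_real ger0_norm; last first.
  by rewrite !mulr_ge0 ?gk_ge0 ?indic_ge0// ltW.
rewrite indicE; case: (boolP (t \in _)) => [|_]; last first.
  by rewrite mul0r mulr0 addr_ge0// ?mulr0// mulr_ge0 ?gk_ge0// addr_ge0// mulr_ge0// sqr_ge0.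
rewrite mem_setE in_itv/= mul1r mulr1 gkBC; exact: gk_oneDsqr.
Qed.

Let gJ n : cint (fun t => (\1_`[a, b] t)%:C * cint (fun x => g x * (gk n (x - t))%:C)) =
  cint (fun x => g x * J n x).
Proof.
have ii := rintegrable_indic a b; have mi := rintegrable_meas ii.
have m2 : cmeas (fun p : R * R => (\1_`[a, b] p.1)%:C * (g p.2 * (gk n (p.2 - p.1))%:C)).
  apply: cmeasM; first exact: (cmeas_fst (cmeas_real mi)).
  apply: cmeasM; first exact: cmeas_snd.
  by apply: cmeas_real; apply: (measurableT_comp (measurable_gk n)); exact: measurable_funB.
have iv := rintegrableZ (K * n.+1%:R + 2) ig.
have gb (t x : R) : a <= t <= b -> gk n (x - t) <= (K * n.+1%:R + 2) * (oneDsqr x)^-1.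
  move=> tab; have t0 : 0 < oneDsqr x := lt_le_trans ltr01 (oneDsqr_ge1 x).
  rewrite ler_pdivlMr// mulrC (le_trans (gk_oneDsqr n x tab))// lerD2r.
  by rewrite ler_wpM2l ?gk_le// addr_ge0// mulr_ge0// sqr_ge0.
have K0 : 0 <= K * n.+1%:R + 2.
  by rewrite addr_ge0// mulr_ge0// addr_ge0// mulr_ge0// sqr_ge0.
have V0 (x : R) : 0 <= (oneDsqr x)^-1 by rewrite invr_ge0 (le_trans _ (oneDsqr_ge1 x)).
have bd (t x : R) : cabs ((\1_`[a, b] t)%:C * (g x * (gk n (x - t))%:C)) <=
    \1_`[a, b] t * ((K * n.+1%:R + 2) * (cabs (g x) * (oneDsqr x)^-1)).
  rewrite indicE; case: (boolP (t \in _)) => [|_]; last by rewrite !mul0r cabs0.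
  rewrite mem_setE in_itv/= !mul1r => tab; rewrite cabsM cabs_real ger0_norm ?gk_ge0//.
  by rewrite [leRHS]mulrCA ler_wpM2l ?cabs_ge0// gb.
have gg t : a <= t <= b -> cintegrable (fun x => g x * (gk n (x - t))%:C).
  move=> tab; apply: (cintegrable_le _ iv) => [|x].
    by apply: cmeasM => //; apply: cmeas_real; exact: rintegrable_meas (gk_integral n t).1.
  rewrite cabsM cabs_real ger0_norm ?gk_ge0// [leRHS]mulrCA ler_wpM2l ?cabs_ge0//.
  exact: gb.
have VV x : 0 <= (K * n.+1%:R + 2) * (cabs (g x) * (oneDsqr x)^-1) :=
  mulr_ge0 K0 (mulr_ge0 (cabs_ge0 _) (V0 x)).
have Fub := cint_Fubini m2 ii iv (indic_ge0 _) _ bd.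
transitivity (cint (fun t => cint (fun x => (\1_`[a, b] t)%:C * (g x * (gk n (x - t))%:C)))).
  congr cint; apply/funext => t; rewrite indicE; case: (boolP (t \in _)) => [|_]; last first.
    by rewrite !mul0r; under [in RHS]eq_fun do rewrite mul0r; rewrite cint0.
  by rewrite mem_setE in_itv/= => tab; rewrite (cintZ _ (gg t tab)).
apply: (etrans (Fub VV)).
congr cint; apply/funext => x; rewrite /J -cintZ.
  by congr cint; apply/funext => t; rewrite mulrCA gkBC.
exact: indic_gk_cintegrable.
Qed.

(** The function [g] will be |xi|^-s G before anything is known about its support, hence the weak
    integrability. Fubini moves the kernel to the indicator of [a, b], and [J_bound] gives the
    smoothed indicator the decay 1 / (1 + x^2) uniformly in n. *)
Lemma weak_gk_cvg : a <= b ->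
  ccvg (fun n => cint (fun t => (\1_`[a, b] t)%:C * cint (fun x => g x * (gk n (x - t))%:C)))
    (cint (fun x => g x * (\1_`[a, b] x)%:C)).
Proof.
move=> ab; under eq_fun do rewrite gJ.
apply: (cint_dct _ _ _ (rintegrableZ (K + 2 * (b - a)) ig)).
- by move=> n; apply: cmeasM => //; exact: J_meas.
- by apply: cmeasM => //; apply: cmeas_real; exact: rintegrable_meas (rintegrable_indic a b).
- apply: ae_mono (ae_and (ae_neq a) (ae_neq b)) => x [/eqP xa /eqP xb].
  by apply: ccvgM; [exact: ccvg_cst|exact: gk_indic].
- move=> n x; rewrite cabsM [leRHS]mulrCA ler_wpM2l ?cabs_ge0//.
  exact: J_bound.
Qed.

End weak_approximation.

(** * The support of the spectrum *)

Section laplace_inversion.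
Context {R : realType}.
Local Notation C := R[i].
Local Notation mu := (@lebesgue_measure R).
Local Notation cint := (cintegral setT).
Local Notation rintegrable h := (mu.-integrable setT (fun x => (h x)%:E)).
Local Notation c0 := ((Num.sqrt (2 * pi : R))^-1).

Lemma series_exp_coeff_le (x : R) N : 0 <= x -> series (exp_coeff x) N <= expR x.
Proof.
move=> x0; apply: nondecreasing_cvgn_le; last exact: is_cvg_series_exp_coeff.
by apply: nondecreasing_series => k _ _; exact: exp_coeff_ge0.
Qed.

Lemma seriesS_exp_coeff (x : R) N :
  \sum_(0 <= k < N) exp_coeff x k.+1 = series (exp_coeff x) N.+1 - 1.
Proof.
rewrite /series/= big_nat_recl//= [exp_coeff x 0]/exp_coeff/= expr0 fact0 divr1.
by rewrite addrC addKr.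
Qed.

Lemma exp_coeffE (x : R) k : exp_coeff x k = x ^+ k / k`!%:R. Proof. by []. Qed.

Lemma measurable_half_line (sg t : R) :
  measurable_fun setT (fun xi : R => ((t < sg * xi)%R%:R : R)).
Proof.
rewrite (_ : (fun xi : R => _) = \1_[set xi | t < sg * xi]); last first.
  by apply/funext => xi; rewrite indicE; congr (nat_of_bool _)%:R; apply/idP/idP; rewrite inE.
apply: measurable_indic.
have ms : measurable_fun setT (fun xi : R => sg * xi) by exact: measurable_funM.
have := ms measurableT _ (measurable_itv `]t, +oo[); rewrite setTI.
by congr measurable; apply/seteqP; split=> xi; rewrite /= in_itv/= andbT.
Qed.

Section half_line.
Variables (B A M sg t : R) (w : R -> C).
Hypotheses (iw : cintegrable w) (wB : forall xi, B < `|xi| -> w xi = 0).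
Hypotheses (sg1 : sg * sg = 1) (At : A < t)
  (growth : forall n : nat, cabs (cint (fun xi => w xi * (expR (n%:R * (sg * xi)))%:C)) <=
    M * expR (n%:R * A)).

Let y n (xi : R) : R := expR (n%:R * (sg * xi - t)).
(** A partial sum of exp (-y) - 1. The constant term is left out because only positive powers of y
    bring the factor exp (-n t) that makes the pairings with [w] small. *)
Let S n N (xi : R) : R := \sum_(0 <= k < N) exp_coeff (- y n xi) k.+1.

Let sgn1 : `|sg| = 1.
Proof. by apply/eqP; rewrite -sqrp_eq1 ?normr_ge0// real_normK ?num_real// expr2 sg1. Qed.

Let y_le n xi : `|xi| <= B -> y n xi <= expR (n%:R * (B + `|t|)).
Proof.
move=> xB; rewrite ler_expR ler_wpM2l// lerD//.
  by rewrite (le_trans (ler_norm _))// normrM sgn1 mul1r.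
by rewrite -normrN ler_norm.
Qed.

Let y_meas n : measurable_fun setT (y n).
Proof.
apply: measurableT_comp => //; apply: measurable_funM; first exact: measurable_cst.
by apply: measurable_funB; [exact: measurable_funM|exact: measurable_cst].
Qed.

Let S_meas n N : measurable_fun setT (S n N).
Proof.
rewrite /S; elim: N => [|N IH]; first by under eq_fun do rewrite big_nil; exact: measurable_cst.
under eq_fun do rewrite big_nat_recr//=; apply: measurable_funD => //.
rewrite /exp_coeff/=; apply: measurable_funM; last exact: measurable_cst.
by apply: measurable_funX; apply: measurableT_comp => //; exact: y_meas.
Qed.

Let S_bound n N xi : `|xi| <= B -> `|S n N xi| <= expR (expR (n%:R * (B + `|t|))).
Proof.
move=> xB; have y0 : 0 <= y n xi := expR_ge0 _.
apply: le_trans (_ : \sum_(0 <= k < N) exp_coeff (y n xi) k.+1 <= _).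
  apply: le_trans (ler_norm_sum _ _ _) _; apply: ler_sum => k _.
  by rewrite /exp_coeff/= normrM normrX normrN !ger0_norm// invr_ge0.
rewrite seriesS_exp_coeff lerBlDr (le_trans (series_exp_coeff_le _ y0))//.
have := y_le n xB; rewrite -ler_expR => h; apply: le_trans h _.
by rewrite lerDl ler01.
Qed.

Let S_cint n N : cintegrable (fun xi => w xi * (S n N xi)%:C).
Proof.
apply: (supp_cintegrable iw wB (cmeas_real (S_meas n N)) (M := expR (expR (n%:R * (B + `|t|))))).
by move=> xi xB; rewrite cabs_real S_bound.
Qed.

Let M0 : 0 <= M.
Proof. by rewrite -(pmulr_lge0 _ (expR_gt0 (0%:R * A))) (le_trans _ (growth 0%N)) ?cabs_ge0. Qed.

Let term_bound n k : cabs (cint (fun xi => w xi * (exp_coeff (- y n xi) k.+1)%:C)) <=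
  M * expR (n%:R * (A - t)) * exp_coeff 1 k.+1.
Proof.
(* The power y^(k + 1) is again an exponential, of index m, so [growth] applies to it; as A < t, the
   factor exp (m (A - t)) is at most exp (n (A - t)). *)
pose m := (k.+1 * n)%N.
have E xi : w xi * (exp_coeff (- y n xi) k.+1)%:C =
   ((-1) ^+ k.+1 * expR (- (m%:R * t)) / k.+1`!%:R)%:C * (w xi * (expR (m%:R * (sg * xi)))%:C).
  rewrite mulrCA -real_complexM; congr (_ * _%:C).
  rewrite exp_coeffE /y (exprNn (expR _)) -expRM_natl [RHS]mulrAC; congr (_ / _).
  rewrite -[RHS]mulrA; congr (_ * _); rewrite -expRD; congr expR; rewrite /m natrM; ring.
under eq_fun do rewrite E.
rewrite cintZ; last first.
  apply: (supp_cintegrable iw wB (M := expR (m%:R * B))) => [|xi xB].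
    apply: cmeas_real; apply: measurableT_comp => //; apply: measurable_funM;
      first exact: measurable_cst.
    exact: measurable_funM.
  rewrite cabs_real ger0_norm ?expR_ge0// ler_expR ler_wpM2l//.
  by rewrite (le_trans (ler_norm _))// normrM sgn1 mul1r.
rewrite cabsM cabs_real !normrM normrX normrN1 expr1n mul1r ger0_norm ?expR_ge0//.
apply: le_trans (ler_wpM2l _ (growth m)) _; first by rewrite mulr_ge0 ?expR_ge0.
rewrite /exp_coeff/= expr1n mul1r ger0_norm ?invr_ge0// mulrAC ler_wpM2r ?invr_ge0//.
rewrite mulrCA ler_wpM2l// -expRD ler_expR (_ : _ + _ = m%:R * (A - t)); last by ring.
rewrite /m natrM -mulrA mulr_natl.
have : n%:R * (A - t) <= 0 by rewrite mulr_ge0_le0// subr_le0 ltW.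
move: (n%:R * (A - t)) => z z0; rewrite mulrS gerDl mulrn_wle0//.
Qed.

Let S_cint_bound n N : cabs (cint (fun xi => w xi * (S n N xi)%:C)) <=
  M * expR (n%:R * (A - t)) * expR 1.
Proof.
apply: le_trans (_ : M * expR (n%:R * (A - t)) * \sum_(0 <= k < N) exp_coeff 1 k.+1 <= _);
  last first.
  rewrite ler_wpM2l ?mulr_ge0 ?expR_ge0// seriesS_exp_coeff lerBlDr.
  by rewrite (le_trans (series_exp_coeff_le _ ler01))// lerDl.
elim: N => [|N IH].
  rewrite big_nil mulr0; under eq_fun do rewrite /S big_nil mulr0.
  by rewrite cint0 cabs0.
rewrite [X in _ * X]big_nat_recr// [leRHS]mulrDr.
have E xi : w xi * (exp_coeff (- y n xi) N.+1)%:C =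
    w xi * (S n N.+1 xi)%:C - w xi * (S n N xi)%:C.
  by rewrite /S big_nat_recr//= real_complexD mulrDr addrC addKr.
have iN : cintegrable (fun xi => w xi * (exp_coeff (- y n xi) N.+1)%:C).
  by under eq_fun do rewrite E; exact: cintegrableB.
rewrite (_ : (fun xi => w xi * (S n N.+1 xi)%:C) =
    (fun xi => w xi * (S n N xi)%:C + w xi * (exp_coeff (- y n xi) N.+1)%:C)); last first.
  by apply/funext => xi; rewrite E addrC subrK.
rewrite cintD//; apply: le_trans (le_cabsD _ _) _; exact: lerD.
Qed.

Let T n (xi : R) : R := expR (- y n xi) - 1.

Let ST n xi : S n N xi @[N --> \oo] --> T n xi.
Proof.
rewrite /S /T; under eq_fun do rewrite seriesS_exp_coeff.
apply: cvgB; last exact: cvg_cst.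
by rewrite (cvg_shiftS (series (exp_coeff (- y n xi)))); exact: is_cvg_series_exp_coeff.
Qed.

Let T_cint_bound n : cabs (cint (fun xi => w xi * (T n xi)%:C)) <=
  M * expR (n%:R * (A - t)) * expR 1.
Proof.
have mT : measurable_fun setT (T n).
  apply: measurable_funB; last exact: measurable_cst.
  by apply: measurableT_comp => //; apply: measurableT_comp => //; exact: y_meas.
apply: (@ccvg_le_lim _ (fun N => cint (fun xi => w xi * (S n N xi)%:C))); last exact: S_cint_bound.
have mw := cintegrable_cmeas iw.
apply: (cint_dct _ _ _ (rintegrableZ (expR (expR (n%:R * (B + `|t|)))) (cintegrable_abs iw))).
- by move=> N; apply: cmeasM => //; apply: cmeas_real; exact: S_meas.
- by apply: cmeasM => //; exact: cmeas_real.
- apply: aeW => xi; apply: ccvgM; first exact: ccvg_cst.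
  by apply: ccvg_real; exact: ST.
- by move=> N xi; apply: (supp_le wB) => xB; rewrite cabs_real S_bound.
Qed.

(* 1 - exp (- exp (n (sg xi - t))) tends to the indicator of sg xi > t; expanded in
   a power series, its pairing with w only involves integrals bounded by [growth],
   with total O(exp (n (A - t))). *)
Lemma half_line_eq0 : cint (fun xi => w xi * ((t < sg * xi)%R%:R)%:C) = 0.
Proof.
have mT n : measurable_fun setT (T n).
  apply: measurable_funB; last exact: measurable_cst.
  by apply: measurableT_comp => //; apply: measurableT_comp => //; exact: y_meas.
have mw := cintegrable_cmeas iw.
have q_cvg (r : R) : r < 0 -> expR (n%:R * r) @[n --> \oo] --> (0 : R).
  move=> r0; under eq_fun do rewrite expRM_natl.
  by apply: cvg_expr; rewrite ger0_norm ?expR_ge0// -expR0 ltr_expR.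
have c1 : ccvg (fun n => cint (fun xi => w xi * (T n xi)%:C)) 0.
  apply: (@ccvg_le _ _ _ (fun n => M * expR (n%:R * (A - t)) * expR 1)).
    apply: (cvg_eq_lim (_ : M * 0 * expR 1 = 0)); first by rewrite mulr0 mul0r.
    apply: cvgM; last exact: cvg_cst.
    by apply: cvgM; [exact: cvg_cst|apply: q_cvg; rewrite subr_lt0].
  by move=> n; rewrite subr0; exact: T_cint_bound.
have mI := measurable_half_line sg t.
have c2 : ccvg (fun n => cint (fun xi => w xi * (T n xi)%:C))
    (cint (fun xi => w xi * (- (t < sg * xi)%R%:R)%:C)).
  apply: (cint_dct _ _ _ (cintegrable_abs iw)).
  - by move=> n; apply: cmeasM => //; exact: cmeas_real.
  - by apply: cmeasM => //; apply: cmeas_real; exact: measurable_funN.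
  - apply: ae_mono (ae_neq (sg * t)) => xi /eqP xt; apply: ccvgM; first exact: ccvg_cst.
    apply: ccvg_real; rewrite /T; have [lt|ge] := ltP t (sg * xi).
      apply: (cvg_eq_lim (_ : 0 - 1 = - 1)); first by rewrite sub0r.
      apply: cvgB; last exact: cvg_cst.
      apply: (squeeze_cvgr (f := fun=> 0) (h := fun n => expR (n%:R * - (sg * xi - t)))).
      + apply: nearW => n; rewrite expR_ge0/= /y ler_expR mulrN lerN2.
        by apply: le_trans (expR_ge1Dx _); rewrite lerDr.
      + exact: cvg_cst.
      + by apply: q_cvg; rewrite oppr_lt0 subr_gt0.
    rewrite oppr0; apply: (cvg_eq_lim (_ : expR (- 0) - 1 = 0)); first by rewrite oppr0 expR0 subrr.
    apply: cvgB; last exact: cvg_cst.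
    apply: (continuous_cvg _ (@continuous_expR R _)); apply: cvgN; apply: q_cvg.
    rewrite subr_lt0 lt_neqAle ge andbT; apply: contra xt => /eqP <-.
    by rewrite mulrA sg1 mul1r.
  - move=> n xi; rewrite cabsM cabs_real ler_piMr ?cabs_ge0//.
    have := expR_ge0 (- y n xi); have : expR (- y n xi) <= 1 by rewrite expR_le1 oppr_le0 expR_ge0.
    by move=> h1 h2; rewrite ler_norml /T; apply/andP; split; lra.
have := ccvg_unique c1 c2; under eq_fun do rewrite real_complexN mulrN.
rewrite cintN => [/eqP|]; first by rewrite eq_sym oppr_eq0 => /eqP.
apply: (cintegrable_le _ (cintegrable_abs iw)).
  by apply: cmeasM => //; exact: cmeas_real.
by move=> xi; rewrite cabsM cabs_real ler_piMr ?cabs_ge0//; case: (t < _); rewrite ?normr1 ?normr0.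
Qed.

End half_line.

Section support.
Variables (B a : R) (w : R -> C).
Hypotheses (iw : cintegrable w) (wB : forall xi, B < `|xi| -> w xi = 0).
Hypothesis growth : forall A : R, a < A -> exists M : R, forall sg : R, sg * sg = 1 ->
  forall n : nat, cabs (cint (fun xi => w xi * (expR (n%:R * (sg * xi)))%:C)) <=
    M * expR (n%:R * A).

Let half_line (sg t : R) : sg * sg = 1 -> a < t ->
  cint (fun xi => w xi * ((t < sg * xi)%R%:R)%:C) = 0.
Proof.
move=> sg1 at_; have [|M H] := growth (_ : a < (a + t) / 2); first by rewrite midf_lt.
apply: (half_line_eq0 iw wB sg1 (_ : (a + t) / 2 < t)); first by rewrite midf_lt.
by move=> n; exact: H.
Qed.

Let ind_cintegrable (sg t : R) : sg * sg = 1 ->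
  cintegrable (fun xi => w xi * ((t < sg * xi)%R%:R)%:C).
Proof.
move=> sg1; apply: (cintegrable_le _ (cintegrable_abs iw)) => [|xi].
  apply: cmeasM; first exact: cintegrable_cmeas.
  exact: cmeas_real (measurable_half_line sg t).
by rewrite cabsM cabs_real ler_piMr ?cabs_ge0//; case: (t < _); rewrite ?normr1 ?normr0.
Qed.

Let itv_cintegrable (c x : R) : cintegrable (fun xi => (\1_`[c, x] xi)%:C * w xi).
Proof.
have ii := rintegrable_indic c x.
apply: (cintegrable_le _ (cintegrable_abs iw)) => [|xi].
  by apply: cmeasM; [exact: cmeas_real (rintegrable_meas ii)|exact: cintegrable_cmeas].
by rewrite cabsM cabs_real ger0_norm ?indic_ge0// ler_piMl ?cabs_ge0// indicE; case: (_ \in _).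
Qed.

Let itv_eq0 (c x : R) : c <= x -> a < c \/ x < - a ->
  cint (fun xi => (\1_`[c, x] xi)%:C * w xi) = 0.
Proof.
move=> cx; have iw' := cintegrable_cmeas (itv_cintegrable c x).
have [p1 n1] : (1 : R) * 1 = 1 /\ (- 1 : R) * -1 = 1 by rewrite mulrNN mulr1.
case=> [ac|xa].
  transitivity (cint (fun xi => w xi * ((c < 1 * xi)%R%:R)%:C - w xi * ((x < 1 * xi)%R%:R)%:C)).
    apply: ae_eq_cint => //; first by apply: cmeasB;
      exact: cintegrable_cmeas (ind_cintegrable _ p1).
    apply: ae_mono (ae_neq c) => xi /eqP xc; rewrite -mulrBr mulrC; congr (_ * _).
    rewrite -real_complexN -real_complexD; congr (_%:C); rewrite mul1r indicE mem_setE in_itv/=.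
    have [lt1|gt1|e1] := ltgtP c xi; last by rewrite e1 eqxx in xc.
      by have [_|_] := leP xi x; rewrite ?subr0 ?subrr.
    by rewrite ltNge (le_trans (ltW gt1) cx)/= subr0.
  rewrite cintB; try exact: ind_cintegrable.
  by rewrite !half_line ?subrr// (lt_le_trans ac).
transitivity (cint (fun xi => w xi * ((- x < -1 * xi)%R%:R)%:C - w xi * ((- c < -1 * xi)%R%:R)%:C)).
  apply: ae_eq_cint => //; first by apply: cmeasB; exact: cintegrable_cmeas (ind_cintegrable _ n1).
  apply: ae_mono (ae_neq x) => xi /eqP xc; rewrite -mulrBr mulrC; congr (_ * _).
  rewrite -real_complexN -real_complexD; congr (_%:C);
    rewrite !mulN1r !ltrN2 indicE mem_setE in_itv/=.
  have [lt1|gt1|e1] := ltgtP xi x; last by rewrite e1 eqxx in xc.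
    by rewrite andbT; have [_|_] := ltP xi c; rewrite ?subr0 ?subrr.
  by rewrite andbF ltNge (le_trans cx (ltW gt1))/= subr0.
rewrite cintB; try exact: ind_cintegrable.
by rewrite !half_line ?subrr// ?ltrN2 1?ltrNr ?(le_lt_trans cx).
Qed.

(** Half-lines beyond any t > a carry no integral, so neither do intervals beyond a, and
    differentiation of the primitive gives the claim on intervals kept at distance 1 / (N + 1) from
    a. The number a may be negative: with a = -1 the lemma yields the injectivity of [synth]. *)
Lemma support_of_growth : {ae mu, forall xi, a < `|xi| -> w xi = 0}.
Proof.
have P N : {ae mu, forall xi, a + N.+1%:R^-1 < xi < N%:R -> w xi = 0}.
  apply: ae_eq0_itv; first exact: itv_cintegrable.
  move=> x /andP[h1 h2]; apply: itv_eq0; first exact: ltW.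
  by left; rewrite ltrDl invr_gt0.
have Q N : {ae mu, forall xi, - N%:R < xi < - (a + N.+1%:R^-1) -> w xi = 0}.
  apply: ae_eq0_itv; first exact: itv_cintegrable.
  move=> x /andP[h1 h2]; apply: itv_eq0; first exact: ltW.
  by right; rewrite (lt_trans h2)// ltrN2 ltrDl invr_gt0.
apply: ae_mono (ae_and (ae_foralln P) (ae_foralln Q)) => xi [HP HQ] axi.
have [N aN xN] : exists2 N : nat, a + N.+1%:R^-1 < `|xi| & `|xi| < N%:R.
  have d0 : 0 < `|xi| - a by rewrite subr_gt0.
  exists (maxn (Num.bound (`|xi| - a)^-1) (Num.bound `|xi|)).
    rewrite -ltrBrDl invf_plt ?posrE//.
    have := archi_boundP (ltW (_ : 0 < (`|xi| - a)^-1)); rewrite invr_gt0 => /(_ d0) /lt_trans;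
      apply.
    by rewrite ltr_nat ltnS leq_maxl.
  apply: lt_le_trans (archi_boundP (normr_ge0 _)) _.
  by rewrite ler_nat leq_maxr.
have [x0|x0] := leP 0 xi.
  by apply: (HP N); move: aN xN; rewrite ger0_norm// => -> ->.
by apply: (HQ N); move: aN xN; rewrite ltr0_norm// ltrNr ltrNl => -> ->.
Qed.

End support.

(** * Recovery of the values of an entire function from its restriction to the real line *)

Section gaussian_approximation.
Variables (f : C -> C) (A B : R).
Hypotheses (ef : entire f) (A0 : 0 <= A) (B0 : 0 <= B)
  (fb : forall z, cabs (f z) <= B * expR (A * cabs z)).

Let h n (c z : C) : C := f z * gkC n (z - c).

Let h_entire n c : entire (h n c).
Proof.
have e1 : entire (fun z : C => z - c) by apply: entireB; [exact: entire_id|exact: entire_cst].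
have e2 : entire (fun z : C => - (n.+1%:R%:C * ((z - c) * (z - c)))).
  rewrite (_ : (fun z => _) = (fun z : C => (- n.+1%:R%:C) * ((z - c) * (z - c)))); last first.
    by apply/funext => z; rewrite mulNr.
  by apply: entireM; [exact: entire_cst|exact: entireM].
exact: (entireM ef (entireM (@entire_cst R _) (entire_comp (@entire_cexp R) e2))).
Qed.

Let cabs_gkC n (x y : R) : cabs (gkC n (x +i* y)) =
  Num.sqrt (n.+1%:R / pi) * expR (- (n.+1%:R * (x ^+ 2 - y ^+ 2))).
Proof.
rewrite cabsM cabs_real ger0_norm ?sqrtr_ge0// cabs_cexp; congr (_ * expR _).
by rewrite !ReImE/=; ring.
Qed.

Let gkC_real n (x : R) : gkC n (x +i* 0) = (gk n x)%:C.
Proof.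
rewrite real_complexM -cexp_real; congr (_ * cexp _).
by apply: complex_ext; rewrite !ReImE/=; ring.
Qed.

Let h_bound n (X Y x y : R) : `|y| <= `|Y| -> cabs (h n (X +i* Y) (x +i* y)) <=
  B * Num.sqrt (n.+1%:R / pi) *
    expR (A * `|Y| + 4 * n.+1%:R * Y ^+ 2 + A ^+ 2 / n.+1%:R + n.+1%:R * X ^+ 2) *
  expR (- (n.+1%:R / 4 * x ^+ 2)).
Proof.
move=> yY; have n0 : 0 < n.+1%:R :> R by [].
rewrite /h cabsM (_ : _ - _ = (x - X) +i* (y - Y)); last by apply: complex_ext; rewrite !ReImE.
rewrite cabs_gkC; apply: le_trans (ler_wpM2r _ (fb _)) _;
  first by rewrite mulr_ge0 ?sqrtr_ge0 ?expR_ge0.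
rewrite mulrACA -[leRHS]mulrA; apply: ler_wpM2l; first by rewrite mulr_ge0 ?sqrtr_ge0.
rewrite -!expRD ler_expR.
have cz : A * cabs (x +i* y) <= A * (`|x| + `|Y|).
  by rewrite ler_wpM2l// (le_trans (cabs_le_ReIm _))// lerD2l.
apply: le_trans (lerD cz (lexx _)) _.
have h1 : (y - Y) ^+ 2 <= 4 * Y ^+ 2.
  have := ler_sqr_norm yY; have := sqr_ge0 (y + Y); rewrite sqrrB sqrrD; lra.
have h2 : x ^+ 2 / 2 - X ^+ 2 <= (x - X) ^+ 2.
  by have := sqr_ge0 (x - 2 * X); rewrite !sqrrB; lra.
have h3 : A * `|x| <= n.+1%:R / 4 * x ^+ 2 + A ^+ 2 / n.+1%:R.
  rewrite -[x ^+ 2]real_normK ?num_real// -subr_ge0.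
  rewrite (_ : _ - _ = n.+1%:R / 4 * (`|x| - 2 * A / n.+1%:R) ^+ 2); last by field.
  by rewrite mulr_ge0 ?sqr_ge0.
have := ler_wpM2l (ltW n0) h1; have := ler_wpM2l (ltW n0) h2.
move: n.+1%:R h3 => p h3 h4 h5; move: (A ^+ 2 / p) h3 => Q h3; lra.
Qed.

(** Moving the contour to the height of [c] turns the kernel centred at a complex point into the
    real kernel [gk n], applied to [f] on that horizontal line, where [gk_approx] concludes. *)
Lemma gkC_approx (c : C) : ccvg (fun n => cint (fun x => f x%:C * gkC n (x%:C - c))) (f c).
Proof.
case: c => X Y.
have E n : cint (fun x => f x%:C * gkC n (x%:C - (X +i* Y))) =
    cint (fun x => f (x +i* Y) * (gk n (x - X))%:C).
  have n4 : 0 < n.+1%:R / 4 :> R by rewrite divr_gt0.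
  rewrite -[LHS]/(cint (fun x => h n (X +i* Y) x%:C)).
  rewrite (contour_shift (@h_entire n (X +i* Y)) n4 (@h_bound n X Y)).
  congr cint; apply/funext => x; rewrite /h -gkC_real; congr (_ * gkC _ _).
  by apply: complex_ext; rewrite !ReImE/= ?subrr.
under eq_fun do rewrite E.
have kb x : cabs (f (x +i* Y)) <= B * expR (A * (`|X| + `|Y|)) * expR (A * `|x - X|).
  apply: le_trans (fb _) _; rewrite -mulrA ler_wpM2l// -expRD ler_expR -mulrDr ler_wpM2l//.
  rewrite (le_trans (cabs_le_ReIm _))//= addrAC lerD2r addrC.
  by rewrite -{1}[x](subrK X) ler_normD.
have B1 : 0 <= B * expR (A * (`|X| + `|Y|)) by rewrite mulr_ge0 ?expR_ge0.
have mk : cmeas (fun x => f (x +i* Y)) := rcont_cmeas (entire_rcont_h Y ef).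
apply: (@gk_approx _ (fun x => f (x +i* Y)) X A _ mk B1 kb A0); last first.
  by move=> n; exact: (cintegrable_gk _ mk B1 A0 kb).
move=> e e0; have [l dl] := derivable_cderiv (@ef (X +i* Y)).
have [d d0 H] := cderiv_cont dl e0; exists d => // x xd.
have := H (x - X)%:C; rewrite cabs_real => /(_ xd).
congr (cabs (f _ - _) < _); apply: complex_ext; rewrite !ReImE/= ?addr0//.
by rewrite addrC subrK.
Qed.

End gaussian_approximation.
End laplace_inversion.

(** * Support of the spectral function and the representation of [f] by it *)

Section spectral_support.
Context {R : realType}.
Variables (s a : R).
Hypotheses (s0 : 0 < s) (s12 : s < 2^-1) (a0 : 0 < a).
Local Notation C := R[i].
Local Notation mu := (@lebesgue_measure R).
Local Notation cint := (cintegral setT).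
Local Notation rintegrable h := (mu.-integrable setT (fun x => (h x)%:E)).
Local Notation L2 := (@in_Lp R 2).
Local Notation c0 := ((Num.sqrt (2 * pi : R))^-1).
Local Notation wt := (wt s).

Lemma wt_L2_oneDsqr (G : R -> C) : L2 G ->
  rintegrable (fun x => cabs ((wt x)%:C * G x) * (oneDsqr x)^-1).
Proof.
move=> LG; have [i _] := L2M (wt_tail_L2 s0 s12) LG.
have := cintegrable_abs i; congr (integrable _ _ _); apply/funext => x; congr (_%:E).
have V : `|(oneDsqr x)^-1| = (oneDsqr x)^-1 by rewrite ger0_norm// invr_ge0 (le_trans _
  (oneDsqr_ge1 x)).
by rewrite !cabsM !cabs_real normrM V mulrAC.
Qed.

Lemma wt_inb_cintegrable (A : R) (G : R -> C) : 0 < A -> L2 G ->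
  cintegrable (fun x => (wt x)%:C * ((inb A x)%:C * G x)).
Proof.
move=> A0 LG; have [i _] := L2M (wt_inb_L2 s0 s12 A0).1 LG.
by under eq_fun do rewrite mulrA -real_complexM [wt _ * _]mulrC.
Qed.

Lemma oneDsqr_itv_cintegrable (g : R -> C) (c d : R) : cmeas g ->
  rintegrable (fun x => cabs (g x) * (oneDsqr x)^-1) ->
  cintegrable (fun x => (\1_`[c, d] x)%:C * g x).
Proof.
move=> mg ig; have ii := rintegrable_indic c d.
apply: (cintegrable_le _ (rintegrableZ (1 + (`|c| + `|d|) ^+ 2) ig)) => [|x].
  by apply: cmeasM => //; exact: cmeas_real (rintegrable_meas ii).
have t0 : 0 < oneDsqr x := lt_le_trans ltr01 (oneDsqr_ge1 x).
rewrite cabsM cabs_real ger0_norm ?indic_ge0// mulrCA mulrC ler_wpM2l ?cabs_ge0//.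
rewrite ler_pdivlMr// indicE; case: (boolP (x \in _)) => [|_]; last first.
  by rewrite mul0r addr_ge0// sqr_ge0.
rewrite mem_setE in_itv/= => /andP[cx xd]; rewrite mul1r lerD2l ler_sqr_norm//.
rewrite [leRHS]ger0_norm ?addr_ge0//; have h1 := ler_norm d.
have h2 := lerNnormlW (lexx `|c|); have h3 := normr_ge0 c; have h4 := normr_ge0 d.
by rewrite ler_norml; apply/andP; split; lra.
Qed.

Lemma expR_damp_le n (A x : R) :
  expR (A * `|x|) * damp n x <= expR (2 * n.+1%:R * A ^+ 2) * expR (- ((8 * n.+1%:R)^-1 * x ^+ 2)).
Proof.
rewrite -!expRD ler_expR -[x ^+ 2]real_normK ?num_real// -subr_ge0.
rewrite (_ : _ - _ = (8 * n.+1%:R)^-1 * (`|x| - 4 * n.+1%:R * A) ^+ 2); last by field.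
by rewrite mulr_ge0 ?sqr_ge0// invr_ge0.
Qed.

Variables (f : C -> C) (f_ : nat -> R -> C) (G : R -> C).
Hypotheses (Ef : exp_type_space a f) (sf : forall n, schwartz (f_ n))
  (cT : tempered_cvg (fun n => distr_of (f_ n)) (distr_of (on_real f)))
  (LG : L2 G)
  (cG : N2 (fun xi => (`|xi| `^ s)%:C * fourier (f_ n) xi - G xi) @[n --> \oo] --> (0 : R)).

(** The growth condition is used with e = 1 until the support is known to be compact; the sharp
    exponents enter in [w_support]. *)
Let A := a + 1.
Let A0 : 0 < A. Proof. exact: addr_gt0. Qed.
Let g xi := (wt xi)%:C * G xi.

Let mg : cmeas g.
Proof. by apply: cmeasM; [exact: cmeas_real (measurable_wt s)|exact: L2_cmeas]. Qed.

Let ig := wt_L2_oneDsqr LG.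

Let f_damp_cintegrable n : cintegrable (fun x => f x%:C * (damp n x)%:C).
Proof.
have [ef /(_ 1 ltr01)[B [B0 fb]]] := Ef.
have n0 : 0 < (8 * n.+1%:R)^-1 :> R by rewrite invr_gt0.
apply: (cintegrable_le _ (rintegrableZ (B * expR (2 * n.+1%:R * A ^+ 2)) (gauss_integral0 n0)))
  => [|x].
  apply: cmeasM; first exact: rcont_cmeas (entire_rcont_h 0 ef).
  exact: cmeas_real (rintegrable_meas (rintegrable_damp n)).
rewrite cabsM cabs_real ger0_norm ?damp_ge0// -mulrA.
apply: le_trans (ler_wpM2r (damp_ge0 _ _) (fb _)) _; rewrite -[leLHS]mulrA.
by apply: ler_wpM2l; [exact: ltW|rewrite cabs_real; exact: expR_damp_le].
Qed.

(** The integral is the weak limit of the Gaussian averages of [g]; each average equals a windowed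
    transform of [f], which is O(1 / n) uniformly on the interval by [modulated_decay]. *)
Let far_itv (c d : R) : c <= d -> 3 * A <= c \/ d <= - (3 * A) ->
  cint (fun xi => (\1_`[c, d] xi)%:C * g xi) = 0.
Proof.
move=> cd far; have [ef /(_ 1 ltr01)[B [B0 fb]]] := Ef.
have := weak_gk_cvg mg ig cd; under [X in ccvg _ (cint X)]eq_fun do rewrite mulrC.
move=> c1; apply: (ccvg_unique c1).
pose K := c0 * (B * (8 * pi) / A ^+ 4).
apply: (@ccvg_le _ _ _ (fun n => K * (d - c) * n.+1%:R^-1)).
  apply: (cvg_eq_lim (mulr0 (K * (d - c)))).
  by apply: cvgM; [exact: cvg_cst|exact: cvg_harmonic].
move=> n; rewrite subr0.
have E t : cint (fun x => g x * (gk n (x - t))%:C) = fourier (fun x => f x%:C * (damp n x)%:C) t.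
  rewrite -(tempered_limit_modulated s0 s12 sf cT LG cG) /distr_of /fourier -cintZ; last first.
      exact: (cintegrable_cisN t (f_damp_cintegrable n)).
  congr cint; apply/funext => x; rewrite /on_real mulrCA; congr (_ * _).
  by rewrite -mulrA [X in _ = _ * X]mulrC.
have ii := rintegrable_indic c d.
rewrite (_ : (fun t => _) = (fun t => (\1_`[c, d] t)%:C * fourier (fun x => f x%:C * (damp n
  x)%:C) t)); last first.
  by apply/funext => t; rewrite E.
rewrite (_ : K * (d - c) / _ = \int[mu]_t (K / n.+1%:R * \1_`[c, d] t)); last first.
  by rewrite RintegralZl// Rintegral_indic// mulrAC.
apply: le_cabs_cint_bound (rintegrableZ _ ii) _.
  apply: cmeasM; first exact: cmeas_real (rintegrable_meas ii).
  exact: fourier_cmeas.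
move=> t; rewrite cabsM cabs_real ger0_norm ?indic_ge0// mulrC indicE.
case: (boolP (t \in _)) => [tcd|_]; last by rewrite !mulr0.
have /andP[ct td] : c <= t <= d by move: tcd; rewrite mem_setE in_itv.
rewrite !mulr1.
have tA : 3 * A <= `|t|.
  case: far => h; first by rewrite (le_trans h)// (le_trans ct)// ler_norm.
  by rewrite -normrN (le_trans _ (ler_norm _))// lerNr (le_trans td).
have := modulated_decay ef A0 (ltW B0) fb n tA; congr (cabs _ <= _).
rewrite -E -(tempered_limit_modulated s0 s12 sf cT LG cG) /distr_of.
by [].
Qed.

Let w xi := (wt xi)%:C * ((inb (3 * A) xi)%:C * G xi).

Let iw : cintegrable w.
Proof. by apply: wt_inb_cintegrable => //; rewrite mulr_gt0. Qed.

Let wB xi : 3 * A < `|xi| -> w xi = 0.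
Proof. by move=> h; rewrite /w (inb_out h) mul0r mulr0. Qed.

Let ae_wg : {ae mu, forall xi, g xi = w xi}.
Proof.
have P N : {ae mu, forall xi, 3 * A < xi < N%:R -> g xi = 0}.
  apply: ae_eq0_itv; first exact: oneDsqr_itv_cintegrable.
  by move=> x /andP[h1 h2]; apply: far_itv; [exact: ltW|left].
have Q N : {ae mu, forall xi, - N%:R < xi < - (3 * A) -> g xi = 0}.
  apply: ae_eq0_itv; first exact: oneDsqr_itv_cintegrable.
  by move=> x /andP[h1 h2]; apply: far_itv; [exact: ltW|right; exact: ltW].
apply: ae_mono (ae_and (ae_foralln P) (ae_foralln Q)) => xi [HP HQ].
have [xA|xA] := leP `|xi| (3 * A); first by rewrite /w (inb_in xA) mul1r.
rewrite (wB xA); have xN := archi_boundP (normr_ge0 xi).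
have [x0|x0] := leP 0 xi.
  by apply: (HP (Num.bound `|xi|)); move: xA xN; rewrite ger0_norm// => -> ->.
by apply: (HQ (Num.bound `|xi|)); move: xA xN; rewrite ltr0_norm// ltrNr ltrNl => -> ->.
Qed.

(** The pairing of [f] with the kernel [gkC n] centred at z has two limits: f z by [gkC_approx], and
    the transform of [w] at z because the damping on the frequency side tends to 1. *)
Let f_laplace z : f z = laplace w z.
Proof.
have [ef /(_ 1 ltr01)[B [B0 fb]]] := Ef.
apply: (ccvg_unique (gkC_approx ef (ltW A0) (ltW B0) fb z)).
have mc n : cmeas (fun xi : R => c0%:C * (cexp ('i%C * z * xi%:C) * (damp n xi)%:C)).
  apply: cmeasM; first exact: cmeas_cst.
  apply: cmeasM; first exact: cmeas_cexpM.
  exact: cmeas_real (rintegrable_meas (rintegrable_damp n)).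
have mw := cintegrable_cmeas iw.
have E n : cint (fun x => f x%:C * gkC n (x%:C - z)) =
    c0%:C * cint (fun xi => w xi * cexp ('i%C * z * xi%:C) * (damp n xi)%:C).
  rewrite -[LHS]/(distr_of (on_real f) (fun x => gkC n (x%:C - z))).
  rewrite (tempered_limit_gkC s0 s12 sf cT LG cG) -cintZ.
    apply: ae_eq_cint; first exact: cmeasM.
      apply: cmeasM; first exact: cmeas_cst.
      apply: cmeasM; first by apply: cmeasM => //; exact: cmeas_cexpM.
      exact: cmeas_real (rintegrable_meas (rintegrable_damp n)).
    by apply: ae_mono ae_wg => xi <-; rewrite mulrCA !mulrA.
  have ml := laplace_cintegrable iw wB z.
  apply: (cintegrable_le _ (cintegrable_abs ml)) => [|xi].
    apply: cmeasM; first exact: cintegrable_cmeas.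
    exact: cmeas_real (rintegrable_meas (rintegrable_damp n)).
  by rewrite [X in X <= _]cabsM cabs_real ger0_norm ?damp_ge0// ler_piMr ?cabs_ge0// damp_le1.
under eq_fun do rewrite E; apply: ccvgZ.
have ml := laplace_cintegrable iw wB z.
apply: (cint_dct _ _ _ (cintegrable_abs ml)).
- move=> n; apply: cmeasM; first exact: cintegrable_cmeas.
  exact: cmeas_real (rintegrable_meas (rintegrable_damp n)).
- exact: cintegrable_cmeas.
- apply: aeW => xi; rewrite -[X in ccvg _ X]mulr1; apply: ccvgM; first exact: ccvg_cst.
  by apply: ccvg_real; exact: cvg_damp.
- by move=> n xi; rewrite [X in X <= _]cabsM cabs_real ger0_norm ?damp_ge0// ler_piMr ?cabs_ge0//
  damp_le1.
Qed.

Let w_support : {ae mu, forall xi, a < `|xi| -> w xi = 0}.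
Proof.
apply: (support_of_growth iw wB) => A' aA'; have e0 : 0 < A' - a by rewrite subr_gt0.
have [_ /(_ _ e0)[B [B0 fb]]] := Ef.
(* At z = -i n sg the factor exp (i z xi) is the real exponential exp (n sg xi), so the growth of f
   is the bound required; c0^-1 compensates the normalisation of [laplace]. *)
exists (c0^-1 * B) => sg sg1 n; have := fb (- 'i%C * (n%:R * sg)%:C).
rewrite f_laplace /laplace cabsM cabs_real ger0_norm ?c0_ge0//.
have -> : cabs (- 'i%C * (n%:R * sg)%:C) = n%:R.
  rewrite cabsM cabsN cabs_i mul1r cabs_real normrM ger0_norm//.
  have : `|sg| ^+ 2 = 1 by rewrite real_normK ?num_real// expr2.
  by move/eqP; rewrite sqrp_eq1// => /eqP ->; rewrite mulr1.
rewrite subrKC -ler_pdivlMl ?c0_gt0// [A' * _]mulrC.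
rewrite (_ : (fun xi => w xi * cexp _) = (fun xi => w xi * (expR (n%:R * (sg * xi)))%:C));
  first by rewrite mulrA.
apply/funext => xi; congr (_ * _); rewrite -cexp_real; congr cexp.
rewrite !mulrA mulrN -expr2 sqr_i opprK mul1r -real_complexM; congr (_%:C); ring.
Qed.

Theorem spectral_representation : {ae mu, forall xi, a < `|xi| -> G xi = 0} /\
  forall z, f z = laplace (fun xi => (wt xi)%:C * ((inb a xi)%:C * G xi)) z.
Proof.
have G0 : {ae mu, forall xi, a < `|xi| -> G xi = 0}.
  apply: ae_mono (ae_and (ae_neq 0) (ae_and ae_wg w_support)) => xi [/eqP xi0 [wg w0]] axi.
  move: (w0 axi); rewrite -wg => /eqP; rewrite /g mulf_eq0 => /orP[|/eqP//].
  move=> /eqP/complexI/eqP; rewrite /wt powR_eq0 normr_eq0 (negbTE xi0).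
  by [].
split=> // z; rewrite f_laplace /laplace; congr (_ * _).
have m1 : cmeas (fun xi : R => cexp ('i%C * z * xi%:C)) := cmeas_cexpM _.
apply: ae_eq_cint.
- by apply: cmeasM => //; exact: cintegrable_cmeas.
- by apply: cmeasM => //; apply: cintegrable_cmeas; exact: wt_inb_cintegrable.
- apply: ae_mono G0 => xi H; congr (_ * _); rewrite /w.
  have [xa|xa] := leP `|xi| a; last by rewrite H// !mulr0.
  rewrite !inb_in// (le_trans xa)// /A mulrDr mulr1.
  by have := a0; lra.
Qed.

End spectral_support.

(** * The Sobolev inequality for band-limited functions *)

Section sobolev.
Context {R : realType}.
Variables (s a : R).
Hypotheses (s0 : 0 < s) (s12 : s < 2^-1) (a0 : 0 < a).
Local Notation C := R[i].
Local Notation mu := (@lebesgue_measure R).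
Local Notation cint := (cintegral setT).
Local Notation rintegrable h := (mu.-integrable setT (fun x => (h x)%:E)).
Local Notation L2 := (@in_Lp R 2).
Local Notation c0 := ((Num.sqrt (2 * pi : R))^-1).
Local Notation wt := (wt s).

(** The retained terms form a geometric series starting below both c and t. The minimum, rather than
    t alone, lets the induction close: if c < t, the first term c is added to at most c r / (1 -
    r). *)
Lemma truncated_geometric_sum (r t : R) J (c : R) : 0 < r -> r < 1 -> 0 <= c -> 0 <= t ->
  \sum_(0 <= j < J) (c * r ^+ j) * (c * r ^+ j < t)%R%:R <= Num.min c t / (1 - r).
Proof.
move=> r0 r1 c_ge0 t0; have r10 : 0 < 1 - r by rewrite subr_gt0.
elim: J c c_ge0 => [|J IH] c c_ge0.
  by rewrite big_nil divr_ge0 ?(ltW r10)// le_min c_ge0.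
rewrite big_nat_recl// expr0 mulr1.
under eq_bigr do rewrite exprS mulrA.
apply: le_trans (lerD (lexx _) (IH _ (mulr_ge0 c_ge0 (ltW r0)))) _.
have m1 : Num.min (c * r) t <= c * r by rewrite ge_min lexx.
have m2 : Num.min (c * r) t <= t by rewrite ge_min lexx orbT.
have [ct|tc] := ltP c t.
  rewrite mulr1 ler_pdivlMr// mulrDl divfK ?gt_eqF//; lra.
by rewrite mulr0 add0r ler_pM2r ?invr_gt0.
Qed.

(** Vanishing is required at every point, not almost everywhere, to match the pointwise support
    hypotheses on [laplace]; representatives are adjusted by multiplying with [inb a]. *)
Definition band_limited (G : R -> C) := L2 G /\ forall xi, a < `|xi| -> G xi = 0.

(* The entire function whose image under |D|^s has Fourier transform G. *)
Definition synth (G : R -> C) : C -> C := laplace (fun xi => (wt xi)%:C * G xi).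

Section synthesis.
Variable G : R -> C.
Hypothesis BG : band_limited G.
Let w xi := (wt xi)%:C * G xi.
Let LG : L2 G. Proof. by case: BG. Qed.

Lemma inb_band_limited xi : (inb a xi)%:C * G xi = G xi.
Proof.
have [xa|xa] := leP `|xi| a; first by rewrite inb_in// mul1r.
by rewrite (BG.2 xi xa) mulr0.
Qed.

Lemma synth_cintegrable : cintegrable w.
Proof. by have := wt_inb_cintegrable s0 s12 a0 LG; under eq_fun do rewrite inb_band_limited. Qed.

Lemma synth_supp xi : a < `|xi| -> w xi = 0.
Proof. by move=> xa; rewrite /w (BG.2 xi xa) mulr0. Qed.

Lemma synth_real (x : R) : synth G x%:C = inv_fourier w x.
Proof. exact: laplace_real. Qed.

Let N := N2 G.
Let F := inv_fourier w.
Let iw := synth_cintegrable.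

Let low_cintegrable A : cintegrable (fun xi => (inb A xi)%:C * w xi).
Proof.
apply: (cintegrable_le _ (cintegrable_abs iw)) => [|xi].
  by apply: cmeasM; [exact: cmeas_real (measurable_inb A)|exact: cintegrable_cmeas].
by rewrite cabsM cabs_real ger0_norm ?inb_ge0// ler_piMl ?cabs_ge0// inb_le1.
Qed.

(** Cauchy-Schwarz between G and the weight truncated at A. The resulting exponent (1 - 2 s) / 2 is
    the inverse of 2^*. *)
Let low_bound (A x : R) : 0 < A ->
  cabs (inv_fourier (fun xi => (inb A xi)%:C * w xi) x) <=
  c0 * (N * Num.sqrt (wt_const s)) * A `^ (2^-1 - s).
Proof.
move=> A0; rewrite /inv_fourier cabsM cabs_real (ger0_norm (@c0_ge0 R)) -mulrA.
apply: ler_wpM2l (@c0_ge0 R) _ _ _.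
have [Lw bw] := wt_inb_L2 s0 s12 A0.
have cis1 xi : cabs (G xi * cexp ('i%C * (x * xi)%:C)) = cabs (G xi).
  by rewrite cabsM cabs_cis mulr1.
have mGc : cmeas (fun xi => G xi * cexp ('i%C * (x * xi)%:C)).
  by apply: cmeasM (L2_cmeas LG) _; exact: cmeas_cis.
have Lc := L2_le mGc LG (fun xi => le_of_eq (cis1 xi)).
have Nc := N2_mono mGc LG (fun xi => le_of_eq (cis1 xi)).
have [_] := L2M Lw Lc.
rewrite (_ : (fun xi => (inb A xi * wt xi)%:C * _) =
    (fun xi => (inb A xi)%:C * w xi * cexp ('i%C * (x * xi)%:C))); last first.
  by apply/funext => xi; rewrite /w real_complexM !mulrA.
move=> h; apply: le_trans h _; rewrite mulrC -mulrA.
apply: ler_pM; rewrite ?N2_ge0//.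
have A1 : Num.sqrt (A `^ (1 - 2 * s)) = A `^ (2^-1 - s).
  rewrite -powR12_sqrt ?powR_ge0// -powRrM; congr (_ `^ _); by field.
rewrite -A1 -sqrtrM ?wt_const_ge0// -[leLHS]ger0_norm ?N2_ge0// -sqrtr_sqr.
by rewrite ler_wsqrtr.
Qed.

Let hw A xi : C := w xi - (inb A xi)%:C * w xi.

Let cabs_hw A xi : cabs (hw A xi) ^+ 2 = (1 - inb A xi) * (wt xi ^+ 2 * cabs (G xi) ^+ 2).
Proof.
rewrite /hw /w; have [xA|xA] := leP `|xi| A.
  by rewrite inb_in// mul1r !subrr cabs0 mul0r expr0n.
by rewrite inb_out// mul0r !subr0 mul1r cabsM cabs_real exprMn real_normK ?num_real.
Qed.

Let hw_L2 A : 0 < A -> L2 (hw A).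
Proof.
move=> A0; have [L _] := L2Z (A `^ (- s))%:C LG.
apply: (L2_le _ L) => [|xi].
  exact: cmeasB (cintegrable_cmeas iw) (cintegrable_cmeas (low_cintegrable A)).
rewrite cabsM cabs_real ger0_norm ?powR_ge0// /hw.
have [xA|xA] := leP `|xi| A.
  by rewrite inb_in// mul1r subrr cabs0 mulr_ge0 ?powR_ge0 ?cabs_ge0.
rewrite inb_out// mul0r subr0 cabsM cabs_real ger0_norm ?wt_ge0// ler_wpM2r ?cabs_ge0//.
by apply: wt_le => //; exact: ltW.
Qed.

Let high_bound A : 0 < A ->
  rintegrable (fun x => cabs (inv_fourier (hw A) x) ^+ 2) /\
  \int[mu]_x cabs (inv_fourier (hw A) x) ^+ 2 <=
  \int[mu]_xi ((1 - inb A xi) * (wt xi ^+ 2 * cabs (G xi) ^+ 2)).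
Proof.
move=> A0; have Lh := hw_L2 A0.
have ih : cintegrable (hw A) by exact: cintegrableB.
have [LF NF] := bessel ih Lh; split; first exact: ((L2P _).1 LF).2.
rewrite -N2_sqr//; apply: le_trans (_ : N2 (hw A) ^+ 2 <= _).
  by rewrite ler_sqr ?nnegrE ?N2_ge0.
rewrite N2_sqr// le_eqVlt; apply/orP; left; apply/eqP.
by apply: eq_Rintegral => xi _; exact: cabs_hw.
Qed.

Let q := two_star s.

Let q_gt2 : 2 < q.
Proof.
rewrite /q /two_star -[X in X < _]invrK ltf_pV2 ?posrE ?subr_gt0 ?invr_gt0//.
by rewrite ltrBlDr ltrDl.
Qed.

Let q_inv : q^-1 = 2^-1 - s. Proof. by rewrite /q /two_star invrK. Qed.

(** The levels [lam j] = M / 2^j start strictly above all values of |F|. The threshold [cut j] is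
    chosen so that [low_bound] gives at most lam j * k0 / k <= lam j / 4; the 1 added in k covers
    the case k0 = 0. *)
Let M := c0 * \int[mu]_t cabs (w t) + 1.
Let k0 := c0 * (N * Num.sqrt (wt_const s)).
Let k := 4 * k0 + 1.
Let lam j : R := M * 2^-1 ^+ j.
Let cut j : R := (lam j / k) `^ q.

Let FM x : cabs (F x) < M.
Proof. by rewrite /M ltr_pwDr// invF_bound. Qed.

Let M0 : 0 < M. Proof. exact: le_lt_trans (cabs_ge0 _) (FM 0). Qed.

Let k00 : 0 <= k0.
Proof. by rewrite !mulr_ge0 ?sqrtr_ge0 ?N2_ge0// c0_ge0. Qed.

Let k_gt0 : 0 < k. Proof. by rewrite /k ltr_wpDl// mulr_ge0. Qed.

Let lam_gt0 j : 0 < lam j. Proof. by rewrite mulr_gt0// exprn_gt0. Qed.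

Let cut_gt0 j : 0 < cut j. Proof. by apply: powR_gt0; exact: divr_gt0. Qed.

Let low_le j x : cabs (inv_fourier (fun xi => (inb (cut j) xi)%:C * w xi) x) <= lam j / 4.
Proof.
apply: le_trans (low_bound x (cut_gt0 j)) _; rewrite -/k0 -q_inv /cut -powRrM.
rewrite divff ?(gt_eqF (lt_trans _ q_gt2))// powRr1 ?(ltW (divr_gt0 _ _))//.
rewrite mulrCA ler_wpM2l ?(ltW (lam_gt0 j))// ler_pdivrMr// /k mulrDr mulKf//.
by rewrite lerDl mulr_ge0// invr_ge0.
Qed.

Let F_split A x : F x = inv_fourier (fun xi => (inb A xi)%:C * w xi) x + inv_fourier (hw A) x.
Proof.
rewrite -invFD//; last exact: cintegrableB.
rewrite (_ : (fun y => _) = w)//.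
by apply/funext => xi; rewrite addrC subrK.
Qed.

Let T J (x : R) : R :=
  \sum_(0 <= j < J) 4 * lam j `^ (q - 2) * cabs (inv_fourier (hw (cut j)) x) ^+ 2.

Let term_ge0 j x : 0 <= 4 * lam j `^ (q - 2) * cabs (inv_fourier (hw (cut j)) x) ^+ 2.
Proof.
by apply: mulr_ge0; [apply: mulr_ge0 => //; exact: powR_ge0|exact: sqr_ge0].
Qed.

Let T_ge0 J x : 0 <= T J x.
Proof. by apply: sumr_ge0 => j _; exact: term_ge0. Qed.

Let TS J x : T J.+1 x = T J x + 4 * lam J `^ (q - 2) * cabs (inv_fourier (hw (cut J)) x) ^+ 2.
Proof. by rewrite /T big_nat_recr. Qed.

(** If |F x| lies between lam J / 2 and lam J, the low frequencies account for at most lam J / 4 <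
    |F x| / 2, so the high-frequency part is at least |F x| / 2. Then |F|^q = |F|^(q - 2) |F|^2 is
    at most the J-th term of [T]. *)
Let level_le J x : lam J < cabs (F x) -> cabs (F x) `^ q <= T J x.
Proof.
elim: J => [|J IH] h.
  by have := lt_trans h (FM x); rewrite /lam expr0 mulr1 ltxx.
rewrite TS; have [lt|ge] := ltP (lam J) (cabs (F x)).
  by apply: le_trans (IH lt) _; rewrite lerDl; exact: term_ge0.
apply: ler_wpDl; first exact: T_ge0.
have F0 : 0 < cabs (F x) := lt_trans (lam_gt0 J.+1) h.
have uv : cabs (F x) <= 2 * cabs (inv_fourier (hw (cut J)) x).
  have := low_le J x; have := le_cabsD (inv_fourier (fun xi => (inb (cut J) xi)%:C * w xi) x)
    (inv_fourier (hw (cut J)) x).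
  move: h; rewrite -F_split /lam exprS mulrCA; lra.
move: (cabs (F x)) (cabs (inv_fourier (hw (cut J)) x)) F0 uv ge => u v u0 uv ge.
have -> : u `^ q = u `^ (q - 2) * u ^+ 2.
  by rewrite -powR_mulrn ?(ltW u0)// -powRD ?subrK// (gt_eqF u0) implybT.
rewrite -[leRHS]mulrA [leRHS]mulrCA; apply: ler_pM; rewrite ?powR_ge0 ?sqr_ge0//.
  by apply: ge0_ler_powR; rewrite ?nnegrE ?subr_ge0 ?(ltW u0) ?(ltW q_gt2) ?(ltW (lam_gt0 J)).
rewrite (_ : 4 * v ^+ 2 = (2 * v) ^+ 2); last by ring.
by rewrite ler_sqr ?nnegrE ?(le_trans (ltW u0) uv)// ltW.
Qed.

Let r : R := 2 `^ (- (q - 2)).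

Let r_gt0 : 0 < r. Proof. by rewrite powR_gt0. Qed.

Let r_lt1 : r < 1.
Proof.
rewrite /r powRN invf_lt1 ?powR_gt0//.
have p0 : 0 < q - 2 by rewrite subr_gt0.
have := @gt0_ltr_powR _ _ p0 1 2; rewrite powR1; apply; rewrite ?nnegrE//.
by rewrite ltr1n.
Qed.

Let lam_pow j : lam j `^ (q - 2) = M `^ (q - 2) * r ^+ j.
Proof.
rewrite /lam powRM ?exprn_ge0 ?(ltW M0)//; congr (_ * _).
have h0 : 0 <= 2^-1 :> R by rewrite invr_ge0.
rewrite -(powR_mulrn j h0) -(powR_mulrn j (ltW r_gt0)) /r -(powR_inv1 (ler0n R 2)) -!powRrM.
by congr (_ `^ _); ring.
Qed.

Let E0 : R := k `^ (q - 2) / (1 - r).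

(** A frequency counts as high at level j only when lam j < k |xi|^(1/q). The powers lam j^(q - 2)
    of these levels sum geometrically to a multiple of |xi|^((q - 2) / q), and (q - 2) / q = 2 s is
    exactly what the squared weight cancels. *)
Let weight_le J xi : xi != 0 ->
  \sum_(0 <= j < J) lam j `^ (q - 2) * ((1 - inb (cut j) xi) * wt xi ^+ 2) <= E0.
Proof.
move=> xi0; have x0 : 0 < `|xi| by rewrite normr_gt0.
have p0 : 0 < q - 2 by rewrite subr_gt0.
pose t := k `^ (q - 2) * `|xi| `^ (2 * s).
have tE : t = (k * `|xi| `^ q^-1) `^ (q - 2).
  rewrite powRM ?powR_ge0 ?(ltW k_gt0)// -powRrM; congr (_ * _ `^ _).
  rewrite mulrBr mulVf ?(gt_eqF (lt_trans _ q_gt2))// q_inv; by field.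
have H j : lam j `^ (q - 2) * (1 - inb (cut j) xi) <=
    (M `^ (q - 2) * r ^+ j) * (M `^ (q - 2) * r ^+ j < t)%R%:R.
  rewrite -lam_pow; have [xc|xc] := leP `|xi| (cut j).
    by rewrite inb_in// subrr mulr0 mulr_ge0 ?powR_ge0.
  rewrite inb_out// subr0; suff -> : lam j `^ (q - 2) < t by [].
  rewrite tE; apply: gt0_ltr_powR => //; rewrite ?nnegrE ?(ltW (lam_gt0 j))//.
    by rewrite mulr_ge0 ?powR_ge0 ?(ltW k_gt0).
  rewrite mulrC -ltr_pdivrMr//.
  have qi0 : 0 < q^-1 by rewrite invr_gt0 (lt_trans _ q_gt2).
  have := @gt0_ltr_powR _ _ qi0 (cut j) `|xi|;
    rewrite !nnegrE (ltW (cut_gt0 j)) (ltW x0) => /(_ isT isT xc).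
  rewrite /cut -powRrM mulfV ?(gt_eqF (lt_trans _ q_gt2))// powRr1//.
  exact: ltW (divr_gt0 _ _).
have t0 : 0 <= t by rewrite mulr_ge0 ?powR_ge0.
apply: le_trans (_ : t / (1 - r) * wt xi ^+ 2 <= _).
  under eq_bigr do rewrite mulrA; rewrite -mulr_suml ler_wpM2r ?sqr_ge0//.
  apply: le_trans (_ : \sum_(0 <= j < J) (M `^ (q - 2) * r ^+ j) * (M `^ (q - 2) * r ^+ j <
    t)%R%:R <= _).
    by apply: ler_sum => j _; exact: H.
  apply: le_trans (truncated_geometric_sum J r_gt0 r_lt1 (powR_ge0 _ _) t0) _.
  by rewrite ler_wpM2r ?invr_ge0 ?subr_ge0 ?(ltW r_lt1)// ge_min lexx orbT.
have e1 : `|xi| `^ (2 * s) * wt xi ^+ 2 = 1.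
  by rewrite wt_sqr -powRD ?(gt_eqF x0) ?implybT// (_ : 2 * s + - 2 * s = 0) ?powRr0//; ring.
by rewrite mulrAC /t -(mulrA (k `^ _)) e1 mulr1.
Qed.

Let hi_cintegrable A : 0 < A -> rintegrable (fun xi => (1 - inb A xi) * (wt xi ^+ 2 * cabs (G xi)
  ^+ 2)).
Proof.
move=> A0; have [_] := (L2P _).1 (hw_L2 A0).
by under eq_fun do rewrite cabs_hw.
Qed.

Let S J xi := \sum_(0 <= j < J) lam j `^ (q - 2) * ((1 - inb (cut j) xi) * wt xi ^+ 2).

Let T_integral_sum J : [/\ rintegrable (T J), rintegrable (fun xi => S J xi * cabs (G xi) ^+ 2) &
  \int[mu]_x T J x <= 4 * \int[mu]_xi (S J xi * cabs (G xi) ^+ 2)].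
Proof.
elim: J => [|J [i1 i2 IH]].
  rewrite (_ : T 0 = fun=> 0); last by apply/funext => x; rewrite /T big_nil.
  have S0 xi : S 0 xi * cabs (G xi) ^+ 2 = 0 by rewrite /S big_nil mul0r.
  have z : \int[mu]_x (0 : R) = 0 by rewrite /Rintegral integral0.
  have z2 : \int[mu]_xi (S 0 xi * cabs (G xi) ^+ 2) = 0.
    by rewrite -[RHS]z; apply: eq_Rintegral => xi _; exact: S0.
  split; [exact: integrable0| |by rewrite z z2 mulr0].
  by under [X in integrable _ _ X]eq_fun do rewrite S0; exact: integrable0.
have [j1 b1] := high_bound (cut_gt0 J); have j2 := hi_cintegrable (cut_gt0 J).
have k1 := rintegrableZ (4 * lam J `^ (q - 2)) j1; have k2 := rintegrableZ (lam J `^ (q - 2)) j2.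
have E2 xi : S J.+1 xi * cabs (G xi) ^+ 2 = S J xi * cabs (G xi) ^+ 2 +
    lam J `^ (q - 2) * ((1 - inb (cut J) xi) * (wt xi ^+ 2 * cabs (G xi) ^+ 2)).
  by rewrite /S big_nat_recr// [LHS]mulrDl !mulrA.
have r1 := rintegrableD i1 k1; have r2 := rintegrableD i2 k2.
have I1 : \int[mu]_x T J.+1 x = \int[mu]_x (T J x +
    4 * lam J `^ (q - 2) * cabs (inv_fourier (hw (cut J)) x) ^+ 2).
  by apply: eq_Rintegral => x _; exact: TS.
have I2 : \int[mu]_xi (S J.+1 xi * cabs (G xi) ^+ 2) = \int[mu]_xi (S J xi * cabs (G xi) ^+ 2 +
    lam J `^ (q - 2) * ((1 - inb (cut J) xi) * (wt xi ^+ 2 * cabs (G xi) ^+ 2))).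
  by apply: eq_Rintegral => x _; exact: E2.
split.
- by under eq_fun do rewrite TS.
- by under eq_fun do rewrite E2.
rewrite I1 I2 RintegralD// RintegralD// RintegralZl// RintegralZl// mulrDr lerD//.
by rewrite -mulrA ler_wpM2l// ler_wpM2l ?powR_ge0.
Qed.

Let T_integral J : rintegrable (T J) /\ \int[mu]_x T J x <= 4 * (E0 * N ^+ 2).
Proof.
have [i1 i2 b] := T_integral_sum J; split=> //; apply: le_trans b _.
have iG := ((L2P _).1 LG).2.
rewrite ler_wpM2l// N2_sqr// -RintegralZl//.
(* [weight_le] excludes the origin, so the integrand is set to 0 there, which leaves the integral
   unchanged. *)
pose S' xi := S J xi * cabs (G xi) ^+ 2 * (xi != 0)%:R.
have E xi : xi <> 0 -> S' xi = S J xi * cabs (G xi) ^+ 2.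
  by move=> /eqP x0; rewrite /S' x0 mulr1.
have mS' : measurable_fun setT S'.
  apply: measurable_funM; first exact: rintegrable_meas.
  rewrite (_ : (fun xi : R => _) = \1_(~` [set 0 : R])); last first.
    apply/funext => xi; rewrite indicE; congr (nat_of_bool _)%:R.
    by apply/idP/idP => [/eqP h|/set_mem/eqP//]; exact: mem_set.
  exact: measurable_indic (measurableC (measurable_set1 _)).
have aeE : {ae mu, forall xi, S J xi * cabs (G xi) ^+ 2 = S' xi}.
  by apply: ae_mono (ae_neq 0) => xi h; rewrite E.
rewrite (ae_eq_Rintegral (rintegrable_meas i2) mS' aeE).
apply: le_Rintegral => //; [exact: ae_rintegrable mS' aeE i2|exact: rintegrableZ|].
move=> xi _; rewrite /S'; have [->|x0] := eqVneq xi 0.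
  by rewrite mulr0 mulr_ge0 ?sqr_ge0// divr_ge0 ?powR_ge0// subr_ge0 ltW.
by rewrite mulr1 ler_wpM2r ?sqr_ge0// weight_le.
Qed.

Let F_meas : cmeas F. Proof. exact: invF_cmeas. Qed.

(* Chemin-Xu: at each dyadic level lam_j the low frequencies |xi| <= cut_j
   contribute at most lam_j / 4, so the level set is controlled by the L^2 norm
   of the high frequencies. *)
Lemma sobolev : in_Lp (two_star s) F.
Proof.
have q0 : 0 < q := lt_trans (ltr0Sn R 1) q_gt2.
apply/in_LpP => //; split; first exact: F_meas.
have mF : measurable_fun setT (fun x => cabs (F x)) := measurable_cabs F_meas.
have mFq : measurable_fun setT (fun x => cabs (F x) `^ q).
  exact: (measurableT_comp (@measurable_powR R q) mF).
(* The factor 1 is the sign parameter of [measurable_half_line]. *)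
have mI J : measurable_fun setT (fun x => ((lam J < 1 * cabs (F x))%R%:R : R)).
  exact: (measurableT_comp (measurable_half_line 1 (lam J)) mF).
have hT J x : cabs (F x) `^ q * (lam J < 1 * cabs (F x))%R%:R <= T J x.
  rewrite mul1r; case: ltP => [lt|_]; first by rewrite mulr1; exact: level_le.
  by rewrite mulr0.
have h0 J x : 0 <= cabs (F x) `^ q * (lam J < 1 * cabs (F x))%R%:R by rewrite mulr_ge0 ?powR_ge0.
have ih J : rintegrable (fun x => cabs (F x) `^ q * (lam J < 1 * cabs (F x))%R%:R).
  apply: (rintegrable_le _ (T_integral J).1) => [|x]; first exact: measurable_funM.
  by rewrite ger0_norm.
have lam0 : lam J @[J --> \oo] --> (0 : R).
  apply: (cvg_eq_lim (mulr0 M)); apply: cvgM; first exact: cvg_cst.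
  by apply: cvg_expr; rewrite ger0_norm// invf_lt1// ltr1n.
have hc : {ae mu, forall x, cabs (F x) `^ q * (lam J < 1 * cabs (F x))%R%:R @[J --> \oo] -->
    cabs (F x) `^ q}.
  apply: aeW => x; apply: cvg_near_cst; have [->|F0] := eqVneq (cabs (F x)) 0.
    by apply: nearW => J; rewrite powR0 ?mul0r// gt_eqF.
  have {}F0 : 0 < cabs (F x) by rewrite lt_neqAle eq_sym F0 cabs_ge0.
  move/cvgrPdist_lt : lam0 => /(_ _ F0); apply: filterS => J.
  by rewrite sub0r normrN ger0_norm ?(ltW (lam_gt0 J))// mul1r => ->; rewrite mulr1.
have hE J : \int[mu]_x (cabs (F x) `^ q * (lam J < 1 * cabs (F x))%R%:R) <= 4 * (E0 * N ^+ 2).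
  have [iT bT] := T_integral J; apply: le_trans bT.
  by apply: le_Rintegral => //; try exact: ih; move=> x _; exact: hT.
exact: (Rfatou ih mFq h0 hc hE).1.
Qed.

End synthesis.
End sobolev.

(** * Schwartz approximants of band-limited functions *)

Section approximants.
Context {R : realType}.
Variables (s a : R).
Hypotheses (s0 : 0 < s) (s12 : s < 2^-1) (a0 : 0 < a).
Local Notation C := R[i].
Local Notation mu := (@lebesgue_measure R).
Local Notation cint := (cintegral setT).
Local Notation rintegrable h := (mu.-integrable setT (fun x => (h x)%:E)).
Local Notation L2 := (@in_Lp R 2).
Local Notation c0 := ((Num.sqrt (2 * pi : R))^-1).
Local Notation wt := (wt s).
Local Notation synth := (synth s).

Variable G : R -> C.
Hypothesis BG : band_limited a G.
Let w xi := (wt xi)%:C * G xi.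
Let LG : L2 G. Proof. by case: BG. Qed.
Let iw : cintegrable w. Proof. exact: (synth_cintegrable s0 s12 a0 BG). Qed.
Let wa xi : a < `|xi| -> w xi = 0. Proof. exact: synth_supp. Qed.

Let d (k : nat) : R := k.+1%:R^-1.
Let d_gt0 k : 0 < d k. Proof. by rewrite invr_gt0. Qed.

(** The function w is integrable but need not be square integrable near 0. Cutting out the low
    frequencies makes the weight bounded, so that [gconv_cvg] becomes applicable. *)
Let h k xi : C := (1 - inb (d k) xi)%:C * w xi.

Let h_meas k : cmeas (h k).
Proof.
apply: cmeasM; last exact: cintegrable_cmeas.
by apply: cmeas_real; apply: measurable_funB; [exact: measurable_cst|exact: measurable_inb].
Qed.

Let h_le k xi : cabs (h k xi) <= cabs (w xi).
Proof.
rewrite cabsM cabs_real ger0_norm ?subr_ge0 ?inb_le1// ler_piMl ?cabs_ge0//.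
by rewrite gerBl inb_ge0.
Qed.

Let ih k : cintegrable (h k).
Proof. exact: cintegrable_le (h_meas k) (cintegrable_abs iw) (h_le k). Qed.

Let ha k xi : a < `|xi| -> h k xi = 0. Proof. by move=> /wa; rewrite /h => ->; rewrite mulr0. Qed.

Let Lh k : L2 (h k).
Proof.
have [L _] := L2Z (d k `^ (- s))%:C LG.
apply: (L2_le (h_meas k) L) => xi; rewrite !cabsM !cabs_real (ger0_norm (powR_ge0 (d k) (- s))).
have [xA|xA] := leP `|xi| (d k).
  by rewrite inb_in// subrr normr0 mul0r mulr_ge0 ?powR_ge0 ?cabs_ge0.
rewrite inb_out// subr0 normr1 mul1r ger0_norm ?wt_ge0// ler_wpM2r ?cabs_ge0//.
by apply: wt_le => //; exact: ltW.
Qed.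

Let hG k xi : (`|xi| `^ s)%:C * h k xi = (1 - inb (d k) xi)%:C * G xi.
Proof.
have [xA|xA] := leP `|xi| (d k); first by rewrite /h inb_in// subrr !mul0r mulr0.
have x0 : xi != 0 by rewrite -normr_gt0 (lt_trans (d_gt0 k)).
have E : `|xi| `^ s * wt xi = 1 by rewrite mulrC wtK.
by rewrite /h /w mulrCA [X in _ * X]mulrA -real_complexM E mul1r.
Qed.

Let D : R := 1 + (4 * a ^+ 2)^-1.
Let K k : R := 64 * D ^+ 2 * \int[mu]_t cabs (h k t).

(** For |eta| <= a and |xi| > 2 a one has |xi - eta| >= |xi| / 2, and [gk_le_inv4] yields 4 * 16 /
    ((n + 1) xi^4). Here [oneDsqr xi] <= D xi^2 trades xi^-4 for two factors 1 / (1 + xi^2); one is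
    spent on |xi|^s. *)
Let gconv_far k n xi : 2 * a < `|xi| ->
  `|xi| `^ s * cabs (gconv (h k) n xi) <= K k / n.+1%:R * (oneDsqr xi)^-1.
Proof.
move=> xa; have x0 : 0 < `|xi| := lt_trans (mulr_gt0 (ltr0Sn R 1) a0) xa.
have x40 : 0 < xi ^+ 4 by rewrite exprn_even_gt0//= -normr_gt0.
have gb eta : `|eta| <= a -> gk n (xi - eta) <= 64 / n.+1%:R / xi ^+ 4.
  move=> ea; have := gk_le_inv4 n (xi - eta).
  have xe : `|xi| / 2 <= `|xi - eta|.
    by have := ler_normD (xi - eta) eta; rewrite subrK; lra.
  have h4 : xi ^+ 4 / 16 <= (xi - eta) ^+ 4.
    have n4 (x : R) : `|x| ^+ 4 = x ^+ 4 by rewrite -normrX ger0_norm// exprn_even_ge0.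
    rewrite (_ : xi ^+ 4 / 16 = (`|xi| / 2) ^+ 4); last first.
      by rewrite expr_div_n n4; congr (_ / _); ring.
    rewrite -n4.
    by rewrite ler_pXn2r ?nnegrE ?divr_ge0.
  have := gk_ge0 n (xi - eta); move: (gk n _) => y y0 h5.
  have h6 : xi ^+ 4 * y <= 16 * ((xi - eta) ^+ 4 * y).
    by rewrite mulrA ler_wpM2r// -ler_pdivrMl// mulrC.
  rewrite ler_pdivlMr// mulrC (le_trans h6)//.
  have -> : 64 / n.+1%:R = 16 * (4 / n.+1%:R) :> R by field.
  by rewrite ler_wpM2l.
have cb : cabs (gconv (h k) n xi) <= 64 / n.+1%:R / xi ^+ 4 * \int[mu]_t cabs (h k t).
  apply: (supp_cint_bound (ih k) (@ha k)) => [|eta ea].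
    by apply: cmeas_real; exact: rintegrable_meas (gk_integralC n xi).1.
  by rewrite cabs_real ger0_norm ?gk_ge0// gb.
have s01 : 0 <= s <= 1 by rewrite ltW//= (le_trans (ltW s12))// invf_le1// ler1n.
have := ler_pM (powR_ge0 _ _) (cabs_ge0 _) (powR_le_oneDsqr xi s01) cb.
have t0 : 0 < oneDsqr xi := lt_le_trans ltr01 (oneDsqr_ge1 xi).
move=> h1; rewrite ler_pdivlMr//; apply: le_trans (ler_wpM2r (ltW t0) h1) _.
have tD : oneDsqr xi <= xi ^+ 2 * D.
  rewrite /oneDsqr /D mulrDr mulr1 addrC lerD2l ler_pdivlMr ?mulr_gt0 ?exprn_gt0// mul1r.
  rewrite (_ : 4 * a ^+ 2 = (2 * a) ^+ 2); last by ring.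
  by rewrite ler_sqr_norm// [X in X <= _]ger0_norm ?mulr_ge0// ltW.
have m0 : 0 < n.+1%:R :> R by [].
have I0 : 0 <= \int[mu]_t cabs (h k t) by apply: Rintegral_ge0 => t _; exact: cabs_ge0.
have x20 : 0 < xi ^+ 2 by rewrite exprn_even_gt0//= -normr_gt0.
rewrite /K; move: (\int[mu]_t _) (oneDsqr xi) D (n.+1%:R : R) t0 tD I0 m0 => I t D' m t0 tD I0 m0.
rewrite (_ : _ * t = 64 * I / m * (t / xi ^+ 2) ^+ 2); last first.
  by field; rewrite (gt_eqF m0) /= -[xi == 0]normr_eq0 (gt_eqF x0).
rewrite (_ : 64 * D' ^+ 2 * I / m = 64 * I / m * D' ^+ 2); last by field; rewrite gt_eqF.
have tp : t / xi ^+ 2 <= D' by rewrite ler_pdivrMr// mulrC.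
apply: ler_wpM2l; first by rewrite divr_ge0 ?mulr_ge0// ltW.
have tp0 : 0 <= t / xi ^+ 2 by rewrite divr_ge0 ?(ltW t0) ?(ltW x20).
by rewrite ler_sqr ?nnegrE// (le_trans tp0 tp).
Qed.

Let err k n xi : C := (`|xi| `^ s)%:C * gconv (h k) n xi - (1 - inb (d k) xi)%:C * G xi.

Let err_meas k n : cmeas (err k n).
Proof.
apply: cmeasB; apply: cmeasM.
- exact: cmeas_real (measurable_abs_powR s).
- exact: gconv_cmeas.
- by apply: cmeas_real; apply: measurable_funB; [exact: measurable_cst|exact: measurable_inb].
- exact: L2_cmeas.
Qed.

(** The multiplier |xi|^s is unbounded, so L^2 convergence of the smoothed function is enough only
    on |xi| <= 2 a. Beyond, where [h k] vanishes but its Gaussian smoothing does not, the explicit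
    tail takes over. *)
Let err_le k n xi : cabs (err k n xi) <=
  (2 * a) `^ s * cabs (gconv (h k) n xi - h k xi) + K k / n.+1%:R * (oneDsqr xi)^-1.
Proof.
have K0 : 0 <= K k.
  apply: mulr_ge0; first by rewrite mulr_ge0 ?sqr_ge0.
  by apply: Rintegral_ge0 => t _; exact: cabs_ge0.
have V0 : 0 <= (oneDsqr xi)^-1 by rewrite invr_ge0 (le_trans _ (oneDsqr_ge1 xi)).
rewrite /err -hG -mulrBr cabsM cabs_real (ger0_norm (powR_ge0 `|xi| s)).
have [xa|xa] := leP `|xi| (2 * a).
  apply: ler_wpDr; first by rewrite mulr_ge0// divr_ge0.
  rewrite ler_wpM2r ?cabs_ge0//; apply: ge0_ler_powR; rewrite ?nnegrE ?(ltW s0)//.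
  exact: le_trans xa.
apply: ler_wpDl; first by rewrite mulr_ge0 ?powR_ge0 ?cabs_ge0.
rewrite ha ?subr0; first exact: gconv_far.
by rewrite (lt_trans _ xa)// ltr_pMl// ltr1n.
Qed.

Let err_cvg k : N2 (err k n) @[n --> \oo] --> (0 : R).
Proof.
have [Lg cg] := gconv_cvg (ih k) (Lh k).
have Lu n := (L2B (Lg n) (Lh k)).1.
have La n := (L2real_abs (Lu n)).
pose u n xi : C := ((2 * a) `^ s)%:C * (cabs (gconv (h k) n xi - h k xi))%:C +
  (K k / n.+1%:R)%:C * ((oneDsqr xi)^-1)%:C.
have Luu n : L2 (u n) /\ N2 (u n) <= `|(2 * a) `^ s| * N2 (fun xi => gconv (h k) n xi - h k xi) +
    `|K k / n.+1%:R| * N2 (fun xi => ((oneDsqr xi)^-1)%:C : C).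
  have [L1 E1] := L2Z ((2 * a) `^ s)%:C (La n).1.
  have [L2_ E2] := L2Z (K k / n.+1%:R)%:C (@oneDsqrV_L2 R).
  have [L3 E3] := L2D L1 L2_; split=> //; apply: le_trans E3 _.
  by rewrite E1 E2 !cabs_real (La n).2.
have ule n xi : cabs (err k n xi) <= cabs (u n xi).
  rewrite /u -!real_complexM -real_complexD cabs_real.
  exact: le_trans (err_le k n xi) (ler_norm _).
apply: (squeeze_cvgr (f := fun=> 0) (h := fun n => `|(2 * a) `^ s| * N2 (fun xi => gconv (h k) n
  xi - h k xi) +
    `|K k / n.+1%:R| * N2 (fun xi => ((oneDsqr xi)^-1)%:C : C))).
- apply: nearW => n; rewrite N2_ge0/=.
  by apply: le_trans (Luu n).2; apply: N2_mono (Luu n).1 (ule n); exact: err_meas.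
- exact: cvg_cst.
- apply: (cvg_eq_lim (_ : `|(2 * a) `^ s| * 0 + 0 * N2 (fun xi => ((oneDsqr xi)^-1)%:C : C) = 0)).
    by rewrite mulr0 mul0r addr0.
  apply: cvgD; first by apply: cvgM => //; exact: cvg_cst.
  apply: cvgM; last exact: cvg_cst.
  apply: (cvg_eq_lim (_ : `|K k * 0| = 0)); first by rewrite mulr0 normr0.
  apply: cvg_norm; apply: cvgM; first exact: cvg_cst.
  exact: cvg_harmonic.
Qed.

Let Lerr k n : L2 (err k n).
Proof.
have [Lg _] := gconv_cvg (ih k) (Lh k).
have [L1 _] := L2Z ((2 * a) `^ s)%:C (L2real_abs (L2B (Lg n) (Lh k)).1).1.
have [L2_ _] := L2Z (K k / n.+1%:R)%:C (@oneDsqrV_L2 R).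
apply: (L2_le (err_meas k n) (L2D L1 L2_).1) => xi.
rewrite -!real_complexM -real_complexD cabs_real.
exact: le_trans (err_le k n xi) (ler_norm _).
Qed.

Let near_d (xi : R) : xi != 0 -> \forall k \near \oo, d k < `|xi|.
Proof.
rewrite -normr_gt0 => x0; have /cvgrPdist_lt/(_ _ x0) := @cvg_harmonic R.
by apply: filterS => k; rewrite sub0r normrN ger0_norm// invr_ge0.
Qed.

Let h_cvg (x : R) : ccvg (fun k => inv_fourier (h k) x) (inv_fourier w x).
Proof.
apply: ccvgZ; have mc : cmeas (fun xi : R => cexp ('i%C * (x * xi)%:C)) := cmeas_cis x.
apply: (cint_dct _ _ _ (cintegrable_abs iw)).
- by move=> k; exact: cmeasM.
- by apply: cmeasM => //; exact: cintegrable_cmeas.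
- apply: ae_mono (ae_neq 0) => xi /eqP x0; rewrite /ccvg; apply: cvg_near_cst.
  apply: filterS (near_d x0) => k /inb_out e.
  by rewrite /h e subr0 mul1r subrr cabs0.
- by move=> k xi; rewrite cabsM cabs_cis mulr1.
Qed.

(** The condition k <= n_ k makes the damping factors tend to 1 pointwise, as tempered convergence
    requires; the other one gives the L^2 limit along the diagonal. *)
Let index : exists n_ : nat -> nat, forall k, (k <= n_ k)%N /\ N2 (err k (n_ k)) <= d k.
Proof.
suff /choice[n_ Hn] : forall k, exists n, (k <= n)%N /\ N2 (err k n) <= d k by exists n_.
move=> k; have /cvgrPdist_lt/(_ _ (d_gt0 k))[N _ HN] := err_cvg k.
exists (maxn k N); split; first exact: leq_maxl.
have := HN _ (leq_maxr k N : (N <= maxn k N)%N).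
by rewrite sub0r normrN ger0_norm ?N2_ge0// => /ltW.
Qed.

(* The approximants are supplied by cutting out the frequencies |xi| <= 1/(k+1)
   and damping by a Gaussian so wide that the L^2 error is below 1/(k+1). *)
Lemma synth_approx : exists f_ : nat -> R -> C, [/\ forall k, schwartz (f_ k),
  tempered_cvg (fun k => distr_of (f_ k)) (distr_of (on_real (synth G))) &
  N2 (fun xi => (`|xi| `^ s)%:C * fourier (f_ k) xi - G xi) @[k --> \oo] --> (0 : R)].
Proof.
have [n_ Hn] := index.
exists (fun k x => inv_fourier (h k) x * (damp (n_ k) x)%:C).
have sch k := schwartz_laplace_damped (n_ k) (ltW a0) (ih k) (@ha k).
split=> [//|phi sphi|].
  apply/ccvgP; rewrite /distr_of.
  have iphi := schwartz_cintegrable sphi; have mphi := cintegrable_cmeas iphi.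
  apply: (cint_dct _ _ _ (rintegrableZ (c0 * \int[mu]_t cabs (w t)) (cintegrable_abs iphi))).
  - move=> k; apply: cmeasM => //; apply: cmeasM; first exact: invF_cmeas.
    exact: cmeas_real (rintegrable_meas (rintegrable_damp _)).
  - apply: cmeasM => //; rewrite /on_real; under eq_fun do rewrite synth_real.
    exact: invF_cmeas.
  - apply: aeW => x; apply: ccvgM; last exact: ccvg_cst.
    rewrite /on_real synth_real -[X in ccvg _ X]mulr1; apply: ccvgM.
      exact: h_cvg.
    apply: ccvg_real; apply: (squeeze_cvgr (f := fun k => damp k x) (h := fun=> 1)).
    + apply: nearW => k; rewrite damp_le1 andbT ler_expR lerN2 ler_wpM2r ?sqr_ge0//.
      by rewrite lef_pV2 ?posrE// ler_wpM2l// ler_nat ltnS (Hn k).1.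
    + exact: cvg_damp.
    + exact: cvg_cst.
  - move=> k x; rewrite [X in X <= _]cabsM ler_wpM2r ?cabs_ge0//.
    rewrite cabsM cabs_real ger0_norm ?damp_ge0//.
    apply: le_trans (ler_piMr (cabs_ge0 _) (damp_le1 _ _)) _.
    apply: le_trans (invF_bound x (ih k)) _; rewrite ler_wpM2l ?c0_ge0//.
    apply: le_Rintegral => //; try exact: cintegrable_abs.
have Lk k := Lerr k (n_ k).
have Li k : L2 (fun xi => (inb (d k) xi)%:C * G xi).
  apply: (L2_le _ LG) => [|xi].
    by apply: cmeasM; [exact: cmeas_real (measurable_inb _)|exact: L2_cmeas].
  by rewrite cabsM cabs_real ger0_norm ?inb_ge0// ler_piMl ?cabs_ge0// inb_le1.
have ci : N2 (fun xi => (inb (d k) xi)%:C * G xi) @[k --> \oo] --> (0 : R).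
  apply: (N2_dct _ LG) => [k|k xi|]; first exact: L2_cmeas.
    by rewrite cabsM cabs_real ger0_norm ?inb_ge0// ler_piMl ?cabs_ge0// inb_le1.
  apply: ae_mono (ae_neq 0) => xi /eqP x0; rewrite /ccvg; apply: cvg_near_cst.
  apply: filterS (near_d x0) => k /inb_out ->.
  by rewrite mul0r subrr cabs0.
apply: (squeeze_cvgr (f := fun=> 0) (h := fun k => d k + N2 (fun xi => (inb (d k) xi)%:C * G xi))).
- apply: nearW => k; rewrite N2_ge0/=.
  have E xi : (`|xi| `^ s)%:C * fourier (fun x => inv_fourier (h k) x * (damp (n_ k) x)%:C) xi -
    G xi =
      err k (n_ k) xi - (inb (d k) xi)%:C * G xi.
    rewrite fourier_damp// /err -[RHS]addrA; congr (_ + _).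
    by rewrite real_complexD real_complexN mulrBl mul1r; ring.
  under eq_fun do rewrite E; apply: le_trans (L2B (Lk k) (Li k)).2 _.
  by rewrite lerD2r (Hn k).2.
- exact: cvg_cst.
- apply: (cvg_eq_lim (_ : 0 + 0 = 0)); first by rewrite addr0.
  by apply: cvgD => //; exact: cvg_harmonic.
Qed.

End approximants.

(** * The isometry with L^2(-a, a) *)

Section isometry.
Context {R : realType}.
Variables (s a : R).
Hypotheses (s0 : 0 < s) (s12 : s < 2^-1) (a0 : 0 < a).
Local Notation C := R[i].
Local Notation mu := (@lebesgue_measure R).
Local Notation cint := (cintegral setT).
Local Notation rintegrable h := (mu.-integrable setT (fun x => (h x)%:E)).
Local Notation L2 := (@in_Lp R 2).
Local Notation c0 := ((Num.sqrt (2 * pi : R))^-1).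
Local Notation wt := (wt s).
Local Notation synth := (synth s).
Local Notation band_limited := (band_limited a).
Implicit Types (f h : C -> C) (G H : R -> C).

Let s01 : 0 <= s <= 1.
Proof. by rewrite ltW//= (le_trans (ltW s12))// invf_le1// ler1n. Qed.

Definition fhat_s (u : R -> C) xi : C := (`|xi| `^ s)%:C * fourier u xi.

Let fhat_s_cintegrable u : schwartz u -> cintegrable (fhat_s u).
Proof. by move=> su; exact: (schwartz_weighted_fourier s01 su).1. Qed.

Let fhat_s_L2 u : schwartz u -> L2 (fhat_s u).
Proof. by move=> su; exact: (schwartz_weighted_fourier s01 su).2. Qed.

(** Plancherel for the difference of the weighted transforms: Cauchy sequences of fractional
    Laplacians and of weighted transforms are the same thing. *)
Lemma frac_lap_schwartz_dist u v : schwartz u -> schwartz v ->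
  N2 (fun x => frac_lap_schwartz s u x - frac_lap_schwartz s v x) =
  N2 (fun xi => fhat_s u xi - fhat_s v xi).
Proof.
move=> su sv; have [i1 L1] := schwartz_weighted_fourier s01 su.
have [i2 L2_] := schwartz_weighted_fourier s01 sv.
rewrite -(plancherel_norm (cintegrableB i1 i2) (L2B L1 L2_).1).
by congr N2; apply/funext => x; rewrite invFB.
Qed.

Lemma frac_lap_schwartz_L2 u : schwartz u -> L2 (frac_lap_schwartz s u).
Proof. by move=> su; exact: (bessel (fhat_s_cintegrable su) (fhat_s_L2 su)).1. Qed.

Lemma L2_cvgP (u : nat -> R -> C) g : (forall n, L2 (u n)) ->
  L2_cvg u g <-> L2 g /\ N2 (fun x => u n x - g x) @[n --> \oo] --> (0 : R).
Proof.
move=> Lu; split=> [[Lg c]|[Lg c]]; split=> //; first exact: (fine_cvg c).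
under eq_fun do rewrite (L2_cLnorm (L2B (Lu _) Lg).1).
by apply/fine_cvgP; split=> //; exact: nearW.
Qed.

Lemma cvg_N2_cauchy (u : nat -> R -> C) g : (forall n, L2 (u n)) -> L2 g ->
  N2 (fun x => u n x - g x) @[n --> \oo] --> (0 : R) ->
  forall e : R, 0 < e -> exists N : nat, forall m n : nat, (N <= m)%N -> (N <= n)%N ->
    N2 (fun x => u m x - u n x) < e.
Proof.
move=> Lu Lg /cvgrPdist_lt c e e0; have [N _ HN] := c (e / 2) (divr_gt0 e0 (ltr0Sn R 1)).
exists N => m n mN nN; apply: le_lt_trans (N2_dist (Lu m) Lg (Lu n)) _.
rewrite [ltRHS]splitr; have := HN m mN; have := HN n nN.
rewrite !sub0r !normrN !ger0_norm ?N2_ge0// => h1 h2.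
by apply: ltrD => //; rewrite N2BC.
Qed.

(** The definition of finiteness supplies a Cauchy sequence; completeness of L^2 gives it a limit,
    so [xget] chooses from a nonempty set and the junk value does not occur. *)
Lemma frac_lapP (T : functional R) : frac_lap_finite s T -> is_frac_lap s T (frac_lap s T).
Proof.
move=> [f_ [sf cT [Lu cu]]]; rewrite /frac_lap.
suff /xgetPex H : exists g, is_frac_lap s T g by exact: H.
have [|g Lg cg] := L2_complete Lu.
  move=> e e0; have [N HN] := cu e e0; exists N => m n mN nN.
  have := HN m n mN nN; rewrite -/(cLnorm 2 _) (L2_cLnorm (L2B (Lu m) (Lu n)).1) lte_fin.
  exact.
by exists g, f_; split=> //; apply/L2_cvgP.
Qed.

(** The link between G and the chosen representative [frac_lap] is recorded as a common
    approximating sequence [H_], converging to G while its transforms converge to [frac_lap].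
    Continuity of the inner product needs no more than that. *)
Lemma PW_spectrum f : PW s a f -> exists G, [/\ band_limited G, f = synth G,
  L2 (frac_lap s (distr_of (on_real f))) &
  exists H_ : nat -> R -> C, [/\ forall n, cintegrable (H_ n), forall n, L2 (H_ n),
    N2 (fun xi => H_ n xi - G xi) @[n --> \oo] --> (0 : R) &
    N2 (fun x => inv_fourier (H_ n) x - frac_lap s (distr_of (on_real f)) x) @[n --> \oo] --> (0
      : R)]].
Proof.
move=> [Ef [_ /frac_lapP]]; set g := frac_lap _ _ => -[f_ [sf cT cg]].
have [Lg {}cg] := (L2_cvgP g (fun n => frac_lap_schwartz_L2 (sf n))).1 cg.
have [|G0 LG0 cG0] := L2_complete (fun n => fhat_s_L2 (sf n)).
  move=> e e0; have [N HN] := cvg_N2_cauchy (fun n => frac_lap_schwartz_L2 (sf n)) Lg cg e0.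
  exists N => m n mN nN; rewrite -frac_lap_schwartz_dist//; exact: HN.
have [G0a fG0] := spectral_representation s0 s12 a0 Ef sf cT LG0 cG0.
(* The limit G0 vanishes off [-a, a] only almost everywhere; the cut selects the representative
   demanded by [band_limited]. *)
pose G xi := (inb a xi)%:C * G0 xi.
have aeG : {ae mu, forall xi, G0 xi = G xi}.
  apply: ae_mono G0a => xi h; rewrite /G; have [xa|xa] := leP `|xi| a.
    by rewrite inb_in// mul1r.
  by rewrite h// mulr0.
have mG : cmeas G by apply: cmeasM; [exact: cmeas_real (measurable_inb a)|exact: L2_cmeas].
have [LG _] := ae_N2 mG LG0 aeG.
exists G; split=> //.
- by split=> // xi xa; rewrite /G inb_out// mul0r.
- exact/funext.
exists (fun n => fhat_s (f_ n)); split=> //.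
- by move=> n; exact: fhat_s_cintegrable.
- by move=> n; exact: fhat_s_L2.
rewrite (_ : (fun n => N2 _) = (fun n => N2 (fun xi => fhat_s (f_ n) xi - G0 xi)))//.
apply/funext => n; have [L1 _] := L2B (fhat_s_L2 (sf n)) LG0.
have [L3 _] := L2B (fhat_s_L2 (sf n)) LG.
have [] // := @ae_N2 _ (fun xi => fhat_s (f_ n) xi - G0 xi) (fun xi => fhat_s (f_ n) xi - G xi)
  (L2_cmeas L3) L1.
by apply: ae_mono aeG => xi ->.
Qed.

Lemma synth_linear c G H z : band_limited G -> band_limited H ->
  synth (fun xi => c * G xi + H xi) z = c * synth G z + synth H z.
Proof.
move=> BG BH; have iG := synth_cintegrable s0 s12 a0 BG; have iH := synth_cintegrable s0 s12 a0 BH.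
have lG := laplace_cintegrable iG (synth_supp s BG) z.
have lH := laplace_cintegrable iH (synth_supp s BH) z.
rewrite /synth /laplace mulrCA -mulrDr -(cintZ _ lG) -cintD//; last exact: cintegrableZ.
by congr (_ * cint _); apply/funext => xi; ring.
Qed.

Lemma band_limited_linear c G H : band_limited G -> band_limited H ->
  band_limited (fun xi => c * G xi + H xi).
Proof.
move=> [LG G0] [LH H0]; split; first exact: (L2D (L2Z c LG).1 LH).1.
by move=> xi xa; rewrite G0// H0// mulr0 addr0.
Qed.

Lemma synth_ae_eq0 G z : band_limited G -> {ae mu, forall xi, G xi = 0} -> synth G z = 0.
Proof.
move=> BG G0; have iG := synth_cintegrable s0 s12 a0 BG.
have lG := laplace_cintegrable iG (synth_supp s BG) z.
rewrite /synth /laplace (ae_eq_cint (cintegrable_cmeas lG) (cmeas_cst 0)).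
  by rewrite cint0 mulr0.
by apply: ae_mono G0 => xi ->; rewrite mulr0 mul0r.
Qed.

(** The vanishing of the transform on the imaginary axis gives the growth hypothesis of
    [support_of_growth] with constant 0. It is applied with radius -1, where -1 < |xi| holds for
    every xi. *)
Lemma synth_inj0 G : band_limited G -> (forall z, synth G z = 0) -> {ae mu, forall xi, G xi = 0}.
Proof.
move=> BG sG; have iG := synth_cintegrable s0 s12 a0 BG.
have : {ae mu, forall xi, -1 < `|xi| -> (wt xi)%:C * G xi = 0}.
  apply: (support_of_growth iG (synth_supp s BG)) => A _; exists 0 => sg sg1 n.
  have /eqP := sG (- 'i%C * (n%:R * sg)%:C).
  rewrite /synth /laplace mulf_eq0 (negbTE (@c0C_neq0 R)) => /eqP e.
  rewrite mul0r (_ : cint _ = 0) ?cabs0// -[RHS]e; congr cint; apply/funext => xi; congr (_ * _).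
  rewrite -cexp_real; congr cexp.
  by rewrite !mulrA mulrN -expr2 sqr_i opprK mul1r -real_complexM; congr (_%:C); ring.
move=> h; apply: ae_mono (ae_and (ae_neq 0) h) => xi [/eqP x0] /(_ (lt_le_trans (ltrN10 R)
  (normr_ge0 _))).
move=> /eqP; rewrite mulf_eq0 => /orP[|/eqP//].
by move=> /eqP/complexI/eqP; rewrite powR_eq0 normr_eq0 (negbTE x0).
Qed.

Lemma synth_inj G H : band_limited G -> band_limited H -> synth G = synth H ->
  {ae mu, forall xi, G xi = H xi}.
Proof.
move=> BG BH e; have BB := band_limited_linear (-1) BH BG.
apply: ae_mono (synth_inj0 BB _) => [xi /eqP|z].
  by rewrite mulN1r addrC subr_eq0 => /eqP.
by rewrite synth_linear// e mulN1r addNr.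
Qed.

(** The spectra delivered by [PW_spectrum] come from unknown approximants, but injectivity
    identifies them with G and H almost everywhere. The inner products agree along the approximants
    by [plancherel], hence in the limit. *)
Lemma PW_inner_synth G H : band_limited G -> band_limited H ->
  PW s a (synth G) -> PW s a (synth H) ->
  PW_inner s (synth G) (synth H) = L2_inner G H.
Proof.
move=> BG BH /PW_spectrum[G' [BG' eG Lg [G_ [iG LG cG cg]]]] /PW_spectrum[H' [BH' eH Lh [H_ [iH
  LH cH ch]]]].
have aG := synth_inj BG BG' eG; have aH := synth_inj BH BH' eH.
transitivity (L2_inner G' H').
  have LF n := (bessel (iG n) (LG n)).1; have LK n := (bessel (iH n) (LH n)).1.
  apply: (ccvg_unique (L2_mulJ_cvg LF LK Lg Lh cg ch)).
  have := L2_mulJ_cvg LG LH BG'.1 BH'.1 cG cH.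
  by under eq_fun do rewrite -(plancherel (iG _) (LG _) (iH _) (LH _)).
apply: ae_eq_cint.
- exact: cintegrable_cmeas (L2M BG'.1 (L2J BH'.1).1).1.
- exact: cintegrable_cmeas (L2M BG.1 (L2J BH.1).1).1.
- by apply: ae_mono (ae_and aG aH) => xi [-> ->].
Qed.

Lemma PW_frac_lap_L2 f : PW s a f -> L2 (frac_lap s (distr_of (on_real f))).
Proof. by move=> /PW_spectrum[G [_ _ + _]]. Qed.

Lemma PW_norm_synth G : band_limited G -> PW s a (synth G) -> PW_norm s (synth G) = N2 G.
Proof.
move=> BG PG; have := PW_inner_synth BG BG PG PG; have Lg := PW_frac_lap_L2 PG.
rewrite /PW_inner (L2_inner_self Lg) (L2_inner_self BG.1) => /complexI/eqP.
by rewrite eqrXn2 ?N2_ge0// => /eqP.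
Qed.

Lemma synth_PW G : band_limited G -> PW s a (synth G).
Proof.
move=> BG; have iG := synth_cintegrable s0 s12 a0 BG; have wG := synth_supp s BG.
split; [split|split].
- exact: laplace_entire (ltW a0) iG wG.
- move=> e e0; exists (c0 * \int[mu]_xi cabs ((wt xi)%:C * G xi) + 1); split.
    by rewrite ltr_wpDl// mulr_ge0 ?c0_ge0//; apply: Rintegral_ge0 => xi _; exact: cabs_ge0.
  move=> z; apply: le_trans (laplace_bound iG wG z) _.
  have I0 : 0 <= c0 * \int[mu]_xi cabs ((wt xi)%:C * G xi).
    by rewrite mulr_ge0 ?c0_ge0//; apply: Rintegral_ge0 => xi _; exact: cabs_ge0.
  apply: ler_pM; rewrite ?expR_ge0// ?lerDl// ler_expR.
  by apply: ler_pM; rewrite ?(ltW a0) ?lerDl ?(ltW e0)//; exact: Im_le_cabs.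
- rewrite (_ : on_real _ = inv_fourier (fun xi => (wt xi)%:C * G xi)); last first.
    by apply/funext => x; rewrite /on_real synth_real.
  exact: (sobolev s0 s12 a0 BG).
have [f_ [sf cT cG]] := synth_approx s0 s12 a0 BG.
exists f_; split=> //; split=> [n|e e0]; first exact: frac_lap_schwartz_L2.
have [N HN] := cvg_N2_cauchy (fun n => fhat_s_L2 (sf n)) BG.1 cG e0.
exists N => m n mN nN.
rewrite (L2_cLnorm (L2B (frac_lap_schwartz_L2 (sf m)) (frac_lap_schwartz_L2 (sf n))).1) lte_fin.
by rewrite frac_lap_schwartz_dist//; exact: HN.
Qed.

Lemma PWE f : PW s a f <-> exists2 G, band_limited G & f = synth G.
Proof.
split=> [/PW_spectrum[G [BG fG _ _]]|[G BG ->]]; first by exists G.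
exact: synth_PW.
Qed.

Definition kernel_symbol (z : C) (xi : R) : C :=
  c0%:C * (inb a xi * wt xi)%:C * cexp (- ('i%C * conjc z) * xi%:C).

Lemma kernel_symbol_band_limited z : band_limited (kernel_symbol z).
Proof.
split=> [|xi xa]; last by rewrite /kernel_symbol inb_out// mul0r mulr0 mul0r.
have [L _] := L2Z (c0 * expR (a * `|Im z|))%:C (wt_inb_L2 s0 s12 a0).1.
apply: (L2_le _ L) => [|xi].
  apply: cmeasM; last exact: cmeas_cexpM.
  by apply: cmeasM; [exact: cmeas_cst|exact: L2_cmeas (wt_inb_L2 s0 s12 a0).1].
rewrite /kernel_symbol (real_complexM c0).
have v0 : a < `|xi| -> (inb a xi * wt xi)%:C = 0 :> C by move=> xa; rewrite inb_out// mul0r.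
move: ((inb a xi * wt xi)%:C) v0 => v v0; rewrite !cabsM -[leLHS]mulrA -[leRHS]mulrA.
apply: ler_wpM2l; first exact: cabs_ge0.
rewrite [leRHS]mulrC; have [xa|/v0 ->] := leP `|xi| a; last by rewrite cabs0 !mul0r.
apply: ler_wpM2l; first exact: cabs_ge0.
rewrite cabs_cexp cabs_real ger0_norm ?expR_ge0// ler_expR !ReImE/=.
rewrite !(mul0r, mul1r, mulr0, subr0, add0r, addr0, sub0r) opprK mulrC.
apply: le_trans (ler_norm _) _; rewrite normrM ?normrN.
by rewrite ler_wpM2r.
Qed.

(** The weight of the synthesis and that of the symbol multiply to |xi|^(-2 s), and the two
    normalising constants to 1 / (2 pi). *)
Lemma synth_kernel_symbol (w z : C) : synth (kernel_symbol z) w =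
  ((2 * pi)^-1)%:C * cintegral `[(- a), a]
    (fun xi : R => cexp ('i%C * (w - conjc z) * xi%:C) * (`|xi| `^ (- 2 * s))%:C).
Proof.
have B := kernel_symbol_band_limited z.
have l := laplace_cintegrable (synth_cintegrable s0 s12 a0 B) (synth_supp s B) w.
rewrite cintegral_setT -inbE -c0_sqr real_complexM -mulrA /synth /laplace; congr (_ * _).
have E xi : (wt xi)%:C * kernel_symbol z xi * cexp ('i%C * w * xi%:C) =
    c0%:C * ((inb a xi)%:C * (cexp ('i%C * (w - conjc z) * xi%:C) * (`|xi| `^ (- 2 * s))%:C)).
  rewrite -wt_sqr expr2 !real_complexM.
  have -> : 'i%C * (w - conjc z) * xi%:C = - ('i%C * conjc z) * xi%:C + 'i%C * w * xi%:C by ring.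
  by rewrite cexpD /kernel_symbol real_complexM; ring.
under eq_fun do rewrite E; rewrite cintZ//.
have := cintegrableZ (c0%:C^-1) l; congr cintegrable; apply/funext => xi.
by rewrite E mulKf// c0C_neq0.
Qed.

Lemma reproducing G z : band_limited G -> synth G z = L2_inner G (kernel_symbol z).
Proof.
move=> BG; have iG := synth_cintegrable s0 s12 a0 BG.
have l := laplace_cintegrable iG (synth_supp s BG) z.
rewrite /synth /laplace -(cintZ _ l); congr cint; apply/funext => xi.
rewrite /kernel_symbol !conjcM !conjc_real -cexpJ.
have -> : conjc (- ('i%C * conjc z) * xi%:C) = 'i%C * z * xi%:C.
  by apply: complex_ext; rewrite !ReImE/=; ring.
by rewrite -{1}(inb_band_limited BG xi) real_complexM; ring.
Qed.

Theorem PW_hilbert : is_hilbert_function_space (PW s a) (PW_norm s) (PW_inner s).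
Proof.
have Z : band_limited (fun=> 0) by split=> //; exact: (@L2_zero R).1.
split.
- rewrite (_ : (fun=> 0) = synth (fun=> 0)); first exact: synth_PW.
  by apply/funext => z; rewrite synth_ae_eq0//; exact: aeW.
- move=> c f g /PWE[G BG ->] /PWE[H BH ->]; apply/PWE.
  exists (fun xi => c * G xi + H xi); first exact: band_limited_linear.
  by apply/funext => z; rewrite synth_linear.
- move=> c f g h /PWE[G BG ->] /PWE[H BH ->] /PWE[K BK ->].
  have BL := band_limited_linear c BG BH.
  rewrite (_ : (fun x => _) = synth (fun xi => c * G xi + H xi)); last first.
    by apply/funext => z; rewrite synth_linear.
  rewrite !PW_inner_synth//; try exact: synth_PW.
  have iGK := (L2M BG.1 (L2J BK.1).1).1; have iHK := (L2M BH.1 (L2J BK.1).1).1.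
  rewrite /L2_inner -(cintZ _ iGK) -cintD//; last exact: cintegrableZ.
  by congr cint; apply/funext => xi; rewrite mulrDl mulrA.
- move=> f g /PWE[G BG ->] /PWE[H BH ->].
  rewrite !PW_inner_synth//; try exact: synth_PW.
  rewrite /L2_inner -cintJ; last exact: (L2M BG.1 (L2J BH.1).1).1.
  by congr cint; apply/funext => xi; rewrite conjcM conjcK mulrC.
- by move=> f _; exact: N2_ge0.
- move=> f /PWE[G BG ->]; rewrite PW_inner_synth ?PW_norm_synth//; try exact: synth_PW.
  exact: (L2_inner_self BG.1).
- move=> f /PWE[G BG ->]; rewrite PW_norm_synth//; last exact: synth_PW.
  by move=> N0 z; apply: synth_ae_eq0 => //; exact: (N2_eq0 BG.1).
- move=> u Pu cu; have /choice[G_ HG] : forall n, exists G, band_limited G /\ u n = synth G.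
    by move=> n; have /PWE[G BG e] := Pu n; exists G.
  have D (G H : R -> C) : band_limited G -> band_limited H ->
      PW_norm s (fun z => synth G z - synth H z) = N2 (fun xi => G xi - H xi).
    move=> BG BH; have BL := band_limited_linear (-1) BH BG.
    have -> : (fun z => synth G z - synth H z) = synth (fun xi => -1 * H xi + G xi).
      by apply/funext => z; rewrite synth_linear// mulN1r addrC.
    rewrite PW_norm_synth//; last exact: synth_PW.
    by congr N2; apply/funext => xi; rewrite mulN1r addrC.
  have [|G0 LG0 cG0] := L2_complete (fun n => (HG n).1.1).
    move=> e e0; have [N HN] := cu e e0; exists N => m n mN nN.
    have [[Bm em] [Bn en]] := (HG m, HG n).
    by rewrite -D// -em -en; exact: HN.
  (* All [G_ n] vanish off [-a, a], so cutting the limit there cannot increase its distance to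
     them. *)
  pose G xi := (inb a xi)%:C * G0 xi.
  have BG : band_limited G.
    split=> [|xi xa]; last by rewrite /G inb_out// mul0r.
    apply: (L2_le _ LG0) => [|xi].
      by apply: cmeasM; [exact: cmeas_real (measurable_inb a)|exact: L2_cmeas].
    by rewrite cabsM cabs_real ger0_norm ?inb_ge0// ler_piMl ?cabs_ge0// inb_le1.
  exists (synth G); split; first exact: synth_PW.
  apply: (squeeze_cvgr (f := fun=> 0) (h := fun n => N2 (fun xi => G_ n xi - G0 xi))) => //.
    apply: nearW => n; rewrite N2_ge0/= (HG n).2 D//; last exact: (HG n).1.
    have L1 := (L2B (HG n).1.1 LG0).1.
    apply: N2_mono => //; first exact: L2_cmeas (L2B (HG n).1.1 BG.1).1.
    move=> xi; have e := inb_band_limited (HG n).1 xi.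
    rewrite /G -{1}e -mulrBr cabsM cabs_real ger0_norm ?inb_ge0// ler_piMl ?cabs_ge0//.
    exact: inb_le1.
  exact: cvg_cst.
Qed.

End isometry.

Theorem corollary3p2 (R : realType) (a s : R)
  (a_gt0 : 0 < a) (s_gt0 : 0 < s) (s_lt_half : s < 2^-1) :
  is_RKHS (PW s a) (PW_norm s) (PW_inner s) /\
  is_reproducing_kernel (PW s a) (PW_inner s)
    (fun w z : R[i] =>
      ((2 * pi)^-1)%:C *
      cintegral `[(- a), a]
        (fun xi : R => cexp ('i%C * (w - conjc z) * xi%:C) *
                       (`|xi| `^ (- 2 * s))%:C)).
Proof.
have BK z := kernel_symbol_band_limited s_gt0 s_lt_half a_gt0 z.
have PK z := synth_PW s_gt0 s_lt_half a_gt0 (BK z).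
split; [split; first exact: PW_hilbert|split].
(* Cauchy-Schwarz in the reproducing formula bounds point evaluation by the norm of the symbol of
   the kernel. *)
- move=> z; exists (N2 (kernel_symbol s a z)) => f /(PWE s_gt0 s_lt_half a_gt0)[G BG ->].
  have PG := synth_PW s_gt0 s_lt_half a_gt0 BG.
  rewrite (PW_norm_synth s_gt0 s_lt_half a_gt0 BG PG).
  have [L E] := L2J (BK z).1.
  by rewrite (reproducing s_gt0 s_lt_half a_gt0 z BG) mulrC -E; exact: (L2M BG.1 L).2.
- move=> z; rewrite (_ : (fun w => _) = synth s (kernel_symbol s a z))//.
  by apply/funext => w; rewrite synth_kernel_symbol.
- move=> f z /(PWE s_gt0 s_lt_half a_gt0)[G BG ->].
  rewrite (_ : (fun w => _) = synth s (kernel_symbol s a z)); last first.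
    by apply/funext => w; rewrite synth_kernel_symbol.
  have PG := synth_PW s_gt0 s_lt_half a_gt0 BG.
  rewrite (PW_inner_synth s_gt0 s_lt_half a_gt0 BG (BK z) PG (PK z)).
  exact: reproducing.
Qed.
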